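(* Let $\mathcal C$ be a $K$-linear Grothendieck category. Let $A=\bigoplus_{n\in\mathbb Z}A_n$ be an $A_\infty$-algebra over $K$ that is even and let $(\mathbb F,\theta_{\mathbb F})$ be a non-unital monad on $\mathcal C$. Suppose that $\mathbb F$ has a right adjoint $\mathbb G$. Then the collection of functors $$\mathbb V^{A,\mathbb G}_{\mathcal C}=\{\mathbb V^{A,\mathbb G}_{\mathcal C,n}:=\underline{Hom}(A_n,\mathbb G(-)):\mathcal C\to\mathcal C\}_{n\in\mathbb Z}$$ is an $A_\infty$-comonad on $\mathcal C$. In particular, the collection of functors $\mathbb V^A_{\mathcal C}=\{\mathbb V^A_{\mathcal C,n}:=\underline{Hom}(A_n,-):\mathcal C\to\mathcal C\}_{n\in\mathbb Z}$ is an $A_\infty$-comonad on $\mathcal C$. Further, with $\mathbb U^{A,\mathbb F}_{\mathcal C}=\{A_n\otimes\mathbb F(-)\}_{n\in\mathbb Z}$, there are isomorphisms of categories $$EM^{e}_{\mathbb U^{A,\mathbb F}_{\mathcal C}}\cong EM_{e}^{\mathbb V^{A,\mathbb G}_{\mathcal C}}\qquad\text{and}\qquad\widetilde{EM}^{eo}_{\mathbb U^{A,\mathbb F}_{\mathcal C}}\cong\widetilde{EM}_{eo}^{\mathbb V^{A,\mathbb G}_{\mathcal C}}.$$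
   Context: $K$ is a field. For a $K$-vector space $V$, $V\otimes(-):\mathcal C\to\mathcal C$ is the tensor (copower) functor, left adjoint to $\underline{Hom}(V,-)$. A non-unital monad $(\mathbb F,\theta_{\mathbb F})$ is an endofunctor with an associative $\theta_{\mathbb F}:\mathbb F\circ\mathbb F\to\mathbb F$. An $A_\infty$-algebra: $A=\bigoplus_{n\in\mathbb Z}A_n$ with graded $K$-linear maps $m_k:A^{\otimes k}\to A$ of degree $2-k$ ($k\ge1$) with $\sum_{p+q+r=n,\,p,r\ge0,\,q\ge1}(-1)^{p+qr}m_{p+1+r}(1^{\otimes p}\otimes m_q\otimes1^{\otimes r})=0$ for each $n\ge1$. It is even if $m_k=0$ whenever $k$ is odd. For $\bar n=(n_1,\dots,n_k)\in\mathbb Z^k$: $|\bar n|=k$, $\Sigma\bar n=n_1+\dots+n_k$, $\bar n^{op}=(n_k,\dots,n_1)$, $\mathbb U_{\bar n}=\mathbb U_{n_1}\circ\dots\circ\mathbb U_{n_k}$ (identity for the empty tuple). $\ast$ is horizontal composition. An $A_\infty$-monad $(\mathbb U,\Theta)$: endofunctors $\{\mathbb U_n\}_{n\in\mathbb Z}$ with natural transformations $\theta_k(\bar n):\mathbb U_{\bar n}\to\mathbb U_{\Sigma\bar n+(2-k)}$ such that for each $\bar z\in\mathbb Z^N$, $N\ge1$, $0=\sum(-1)^{p+qr+q\Sigma\bar n}\theta_{p+1+r}(\bar n,\Sigma\bar n'+(2-q),\bar n'')(\mathbb U_{\bar n}\ast\theta_q(\bar n')\ast\mathbb U_{\bar n''})$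 over partitions $\bar z=(\bar n,\bar n',\bar n'')$, $|\bar n|=p$, $|\bar n'|=q\geq 1$, $|\bar n''|=r$. An $A_\infty$-comonad $(\mathbb V,\Delta)$: endofunctors $\{\mathbb V_n\}_{n\in\mathbb Z}$ with $\delta_k(\bar n):\mathbb V_{\Sigma\bar n+(2-k)}\to\mathbb V_{\bar n}$ such that $0=\sum(-1)^{pq+r+q\Sigma\bar n}(\mathbb V_{\bar n}\ast\delta_q(\bar n')\ast\mathbb V_{\bar n''})\delta_{p+1+r}(\bar n,\Sigma\bar n'+(2-q),\bar n'')$ (same partitions). Structures meant: $\mathbb U^{A,\mathbb F}_{\mathcal C}$ is the $A_\infty$-monad with $\theta_k(\bar n):A_{n_1}\otimes\dots\otimes A_{n_k}\otimes\mathbb F^k(-)\to A_{\Sigma\bar n+(2-k)}\otimes\mathbb F(-)$ induced by $m_k$ and the iterated multiplication $\mathbb F^k\to\mathbb F$. The functor $\underline{Hom}(A_n,\mathbb G(-))$ is right adjoint to $A_n\otimes\mathbb F(-)$, and the comonad structure on $\mathbb V^{A,\mathbb G}_{\mathcal C}$ is $\delta_k(\bar n)=\theta_k^R(\bar n^{op})$, with $\eta^R$ the mate of $\eta$ between right adjoints. Modules over $(\mathbb U,\Theta)$: objects $\{M_n\}_{n\in\mathbb Z}$ with $\pi_k(\bar n,l):\mathbb U_{\bar n}M_l\to M_{\Sigma\bar n+l+(2-k)}$ ($k\ge1$, $\bar n\in\mathbb Z^{k-1}$, $l\in\mathbb Z$) such that for each $\bar z\in\mathbb Z^N$, $N\ge0$,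 $l\in\mathbb Z$, $$\sum_{\bar z=(\bar n,\bar n',\bar n'')}(-1)^{p+qr+q\Sigma\bar n}\pi_{p+1+r}(\bar n,\Sigma\bar n'+(2-q),\bar n'',l)\circ(\mathbb U_{\bar n}\ast\theta_q(\bar n'))(\mathbb U_{\bar n''}M_l)=-\sum_{\bar z=(\bar m,\bar m')}(-1)^{a+b\Sigma\bar m}\pi_{a+1}(\bar m,\Sigma\bar m'+l+(2-b))\circ\mathbb U_{\bar m}(\pi_b(\bar m',l)),$$ with $|\bar n|=p$, $|\bar n'|=q\ge1$, $|\bar n''|=r-1$, $|\bar m|=a$, $|\bar m'|=b-1$; morphisms are collections $f_l:M_l\to M'_l$ commuting with all $\pi_k(\bar n,l)$. Comodules over $(\mathbb V,\Delta)$: objects $\{P_n\}_{n\in\mathbb Z}$ with $\rho_k(\bar n,l):P_{\Sigma\bar n+l+(2-k)}\to\mathbb V_{\bar n}P_l$ such that $$\sum_{\bar z=(\bar n,\bar n',\bar n'')}(-1)^{pq+r+q\Sigma\bar n}(\mathbb V_{\bar n}\ast\delta_q(\bar n'))(\mathbb V_{\bar n''}P_l)\circ\rho_{p+1+r}(\bar n,\Sigma\bar n'+(2-q),\bar n'',l)=-\sum_{\bar z=(\bar m,\bar m')}(-1)^{ab+b\Sigma\bar m}\mathbb V_{\bar m}(\rho_b(\bar m',l))\circ\rho_{a+1}(\bar m,\Sigma\bar m'+l+(2-b));$$ morphisms are collections $g_l$ commuting with all $\rho_k(\bar n,l)$. Even (co)modules: $\pi_k=0$ (resp. $\rho_k=0$)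 for $k$ odd. $EM^e_{\mathbb U}$, $EM_e^{\mathbb V}$ are the categories of even modules, even comodules. An $\infty$-morphism of modules $\alpha:(M^1,\pi^1)\to(M^2,\pi^2)$: maps $\alpha_k(\bar n,l):\mathbb U_{\bar n}M^1_l\to M^2_{\Sigma\bar n+l+(1-k)}$ ($\bar n\in\mathbb Z^{k-1}$) with, for each $\bar z\in\mathbb Z^N$, $N\ge0$, $l$, $$\sum_{(\bar m,\bar m')}(-1)^{a+b\Sigma\bar m}\alpha_{a+1}(\bar m,\Sigma\bar m'+l+(2-b))\circ\mathbb U_{\bar m}(\pi^1_b(\bar m',l))+\sum_{(\bar n,\bar n',\bar n'')}(-1)^{a+bc+b\Sigma\bar n}\alpha_{a+1+c}(\bar n,\Sigma\bar n'+(2-b),\bar n'',l)\circ(\mathbb U_{\bar n}\ast\theta_b(\bar n')\ast\mathbb U_{\bar n''})(M^1_l)=\sum_{(\bar p,\bar p')}\pi^2_{a+1}(\bar p,\Sigma\bar p'+l+(1-b))\circ\mathbb U_{\bar p}(\alpha_b(\bar p',l)),$$ sums over partitions of $\bar z$ with $|\bar m|=a,|\bar m'|=b-1$; $|\bar n|=a,|\bar n'|=b\ge1,|\bar n''|=c-1$; $|\bar p|=a,|\bar p'|=b-1$. Composition: $(\beta\alpha)_k(\bar z,l)=\sum_{\bar z=(\bar n,\bar n')}\beta_{a+1}(\bar n,\Sigma\bar n'+l+(1-b))\circ\mathbb U_{\bar n}(\alpha_b(\bar n',l))$ with $|\bar n|=a$, $|\bar n'|=b-1$. An $\infty$-morphism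 of comodules $\alpha:(P^1,\rho^1)\to(P^2,\rho^2)$: maps $\alpha_k(\bar n,l):P^1_{\Sigma\bar n+l+(1-k)}\to\mathbb V_{\bar n}P^2_l$ with $$\sum_{(\bar m,\bar m')}(-1)^{ab+b\Sigma\bar m}\mathbb V_{\bar m}(\rho^2_b(\bar m',l))\circ\alpha_{a+1}(\bar m,\Sigma\bar m'+l+(2-b))+\sum_{(\bar n,\bar n',\bar n'')}(-1)^{c+ab+b\Sigma\bar n}(\mathbb V_{\bar n}\ast\delta_b(\bar n')\ast\mathbb V_{\bar n''})(P^2_l)\circ\alpha_{a+1+c}(\bar n,\Sigma\bar n'+(2-b),\bar n'',l)=\sum_{(\bar p,\bar p')}\mathbb V_{\bar p}(\alpha_b(\bar p',l))\circ\rho^1_{a+1}(\bar p,\Sigma\bar p'+l+(1-b)),$$ with dual composition. An $\infty$-morphism is odd if $\alpha_k=0$ for $k$ even. $\widetilde{EM}^{eo}_{\mathbb U}$ (resp. $\widetilde{EM}^{\mathbb V}_{eo}$) is the category of even modules (resp. comodules) with odd $\infty$-morphisms. *)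

(* Defs.v *)
From mathcomp Require Import all_boot all_order all_algebra.
From mathcomp Require Import boolp zify.
Set Implicit Arguments.
Unset Strict Implicit.
Unset Printing Implicit Defensive.
Import GRing.Theory.
Local Open Scope ring_scope.

Record category := Category {
  cob :> Type;
  chom : cob -> cob -> Type;
  cid : forall X, chom X X;
  ccomp : forall X Y Z, chom Y Z -> chom X Y -> chom X Z;
  ccompA : forall X Y Z W (h : chom Z W) (g : chom Y Z) (f : chom X Y),
    ccomp h (ccomp g f) = ccomp (ccomp h g) f;
  ccomp1m : forall X Y (f : chom X Y), ccomp (cid Y) f = f;
  ccompm1 : forall X Y (f : chom X Y), ccomp f (cid X) = f }.
Arguments cid {c} X.
Arguments ccomp {c X Y Z} _ _.

Record cfunctor (C D : category) := CFunctor {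
  cfob :> C -> D;
  cfmap : forall X Y : C, chom X Y -> chom (cfob X) (cfob Y);
  cfmap1 : forall X : C, cfmap (cid X) = cid (cfob X);
  cfmapM : forall (X Y Z : C) (g : chom Y Z) (f : chom X Y),
    cfmap (ccomp g f) = ccomp (cfmap g) (cfmap f) }.

Definition cfunctor_id (C : category) : cfunctor C C :=
  @CFunctor C C (fun X => X) (fun _ _ f => f)
    (fun _ => erefl) (fun _ _ _ _ _ => erefl).

Definition cfunctor_comp (C D E : category)
  (G : cfunctor D E) (F : cfunctor C D) : cfunctor C E.
Proof.
refine (@CFunctor C E (fun X => G (F X)) (fun _ _ f => cfmap G (cfmap F f)) _ _).
- by move=> X; rewrite !cfmap1.
- by move=> X Y Z g f; rewrite !cfmapM.
Defined.

(** Strict isomorphism (not mere equivalence): the two composites are equal to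
    the identity functors. *)
Definition cat_iso (C D : category) : Prop :=
  exists (F : cfunctor C D) (G : cfunctor D C),
    cfunctor_comp G F = cfunctor_id C /\ cfunctor_comp F G = cfunctor_id D.

Record lincat (K : fieldType) := LinCat {
  lob :> Type;
  hom : lob -> lob -> lmodType K;
  idm : forall X, hom X X;
  comp : forall X Y Z, hom Y Z -> hom X Y -> hom X Z;
  compA : forall X Y Z W (h : hom Z W) (g : hom Y Z) (f : hom X Y),
    comp h (comp g f) = comp (comp h g) f;
  comp1m : forall X Y (f : hom X Y), comp (idm Y) f = f;
  compm1 : forall X Y (f : hom X Y), comp f (idm X) = f;
  comp_linl : forall X Y Z (f : hom X Y), linear (fun g : hom Y Z => comp g f);
  comp_linr : forall X Y Z (g : hom Y Z), linear (fun f : hom X Y => comp g f) }.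
Arguments idm {K l} X.
Arguments comp {K l X Y Z} _ _.
Notation "g ∘ f" := (comp g f) (at level 40, left associativity).

Section LinCat.
Variables (K : fieldType) (C : lincat K).
Implicit Types X Y Z W : C.

Definition is_mono X Y (f : hom X Y) : Prop :=
  forall W (g h : hom W X), f ∘ g = f ∘ h -> g = h.
Definition is_epi X Y (f : hom X Y) : Prop :=
  forall W (g h : hom Y W), g ∘ f = h ∘ f -> g = h.
Definition is_kernel X Y N (f : hom X Y) (k : hom N X) : Prop :=
  f ∘ k = 0 /\ forall W (h : hom W X), f ∘ h = 0 -> exists! u : hom W N, k ∘ u = h.
Definition is_cokernel X Y Q (f : hom X Y) (c : hom Y Q) : Prop :=
  c ∘ f = 0 /\ forall W (h : hom Y W), h ∘ f = 0 -> exists! u : hom Q W, u ∘ c = h.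
Definition short_exact X Y Z (f : hom X Y) (g : hom Y Z) : Prop :=
  is_kernel g f /\ is_cokernel f g.

Record abelian : Prop := Abelian {
  ab_zero : exists Z, (forall X (f : hom X Z), f = 0) /\ (forall X (f : hom Z X), f = 0);
  ab_biprod : forall X Y, exists (S : C)
    (i1 : hom X S) (i2 : hom Y S) (p1 : hom S X) (p2 : hom S Y),
    [/\ p1 ∘ i1 = idm X, p2 ∘ i2 = idm Y, p1 ∘ i2 = 0, p2 ∘ i1 = 0
      & i1 ∘ p1 + i2 ∘ p2 = idm S];
  ab_ker : forall X Y (f : hom X Y), exists N (k : hom N X), is_kernel f k;
  ab_coker : forall X Y (f : hom X Y), exists Q (c : hom Y Q), is_cokernel f c;
  ab_mono : forall X Y (f : hom X Y), is_mono f ->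
    exists Z (g : hom Y Z), is_kernel g f;
  ab_epi : forall X Y (f : hom X Y), is_epi f ->
    exists W (g : hom W X), is_cokernel g f }.

Definition is_coproduct (I : Type) (D : I -> C) S (inj : forall i, hom (D i) S) : Prop :=
  forall W (f : forall i, hom (D i) W),
    exists! u : hom S W, forall i, u ∘ inj i = f i.

Record directed (J : Type) (le : J -> J -> Prop) : Prop := Directed {
  dir_refl : forall i, le i i;
  dir_trans : forall i j k, le i j -> le j k -> le i k;
  dir_inhab : exists i : J, True;
  dir_ub : forall i j, exists k, le i k /\ le j k }.

Record diagram (J : Type) (le : J -> J -> Prop) := Diagram {
  dob :> J -> C;
  dmap : forall i j, le i j -> hom (dob i) (dob j);
  dmap1 : forall i (e : le i i), dmap e = idm (dob i);
  dmapM : forall i j k (e : le i j) (e' : le j k) (e'' : le i k),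
    dmap e' ∘ dmap e = dmap e'' }.

Definition diag_morph (J : Type) (le : J -> J -> Prop) (D D' : diagram le)
    (a : forall i, hom (D i) (D' i)) : Prop :=
  forall i j (e : le i j), a j ∘ dmap D e = dmap D' e ∘ a i.

Definition is_colimit (J : Type) (le : J -> J -> Prop) (D : diagram le) L
    (c : forall i, hom (D i) L) : Prop :=
  (forall i j (e : le i j), c j ∘ dmap D e = c i) /\
  forall W (f : forall i, hom (D i) W),
    (forall i j (e : le i j), f j ∘ dmap D e = f i) ->
    exists! u : hom L W, forall i, u ∘ c i = f i.

(** Abelian, with all small coproducts (AB3), exact direct limits (AB5) and a
    generator.  The index types [I] and [J] live in a universe which is not
    constrained by that of the objects of [C]. *)
Record grothendieck : Prop := Grothendieck {
  gr_abelian : abelian;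
  gr_coprod : forall (I : Type) (D : I -> C),
    exists S (inj : forall i, hom (D i) S), is_coproduct inj;
  gr_ab5 : forall (J : Type) (le : J -> J -> Prop), directed le ->
    forall (D1 D2 D3 : diagram le)
      (a : forall i, hom (D1 i) (D2 i)) (b : forall i, hom (D2 i) (D3 i)),
    diag_morph a -> diag_morph b -> (forall i, short_exact (a i) (b i)) ->
    forall L1 L2 L3 (c1 : forall i, hom (D1 i) L1) (c2 : forall i, hom (D2 i) L2)
      (c3 : forall i, hom (D3 i) L3) (u : hom L1 L2) (v : hom L2 L3),
    is_colimit c1 -> is_colimit c2 -> is_colimit c3 ->
    (forall i, u ∘ c1 i = c2 i ∘ a i) -> (forall i, v ∘ c2 i = c3 i ∘ b i) ->
    short_exact u v;
  gr_generator : exists G, forall X Y (f g : hom X Y),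
    (forall h : hom G X, f ∘ h = g ∘ h) -> f = g }.

Definition idto X Y (e : X = Y) : hom X Y :=
  eq_rect X (fun Z => hom X Z) (idm X) Y e.

Definition icast (M : int -> C) i j (e : i = j) : hom (M i) (M j) :=
  idto (f_equal M e).

End LinCat.

Section Endofunctors.
Variables (K : fieldType) (C : lincat K).

(** Functors between K-linear categories are K-linear.  For [F] below this is
    what makes the comparison V ⊗ F(-) = F(V ⊗ -) available. *)
Record lfunctor := LFunctor {
  fob :> C -> C;
  fmap : forall X Y, hom X Y -> hom (fob X) (fob Y);
  fmap1 : forall X, fmap (idm X) = idm (fob X);
  fmapM : forall X Y Z (g : hom Y Z) (f : hom X Y), fmap (g ∘ f) = fmap g ∘ fmap f;
  fmap_lin : forall X Y, linear (@fmap X Y) }.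

Definition lfunctor_id : lfunctor.
Proof.
by refine (@LFunctor (fun X => X) (fun _ _ f => f) _ _ _) => // X Y a f g.
Defined.

Definition lfunctor_comp (F G : lfunctor) : lfunctor.
Proof.
refine (@LFunctor (fun X => F (G X)) (fun _ _ f => fmap F (fmap G f)) _ _ _).
- by move=> X; rewrite !fmap1.
- by move=> X Y Z g f; rewrite !fmapM.
- by move=> X Y a f g; rewrite !fmap_lin.
Defined.

Record nat_trans (F G : lfunctor) := NatTrans {
  napp :> forall X, hom (F X) (G X);
  nnat : forall X Y (f : hom X Y), napp Y ∘ fmap F f = fmap G f ∘ napp X }.

(** [L] is left adjoint to [R]. *)
Record adjunction (L R : lfunctor) := Adjunction {
  adjr : forall X Y, hom (L X) Y -> hom X (R Y);
  adjl : forall X Y, hom X (R Y) -> hom (L X) Y;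
  adjrK : forall X Y (f : hom (L X) Y), adjl (adjr f) = f;
  adjlK : forall X Y (g : hom X (R Y)), adjr (adjl g) = g;
  adjr_nat : forall X X' Y Y' (g : hom X' X) (f : hom (L X) Y) (h : hom Y Y'),
    adjr (h ∘ f ∘ fmap L g) = fmap R h ∘ adjr f ∘ g }.

Lemma adjl_nat L R (a : adjunction L R) X X' Y Y'
    (g : hom X' X) (f : hom X (R Y)) (h : hom Y Y') :
  adjl a (fmap R h ∘ f ∘ g) = h ∘ adjl a f ∘ fmap L g.
Proof. by rewrite -[f in LHS](adjlK a) -adjr_nat adjrK. Qed.

Lemma adjr_comp L R (a : adjunction L R) X Y Y' (f : hom (L X) Y) (h : hom Y Y') :
  adjr a (h ∘ f) = fmap R h ∘ adjr a f.
Proof.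
have := adjr_nat a (idm X) f h.
by rewrite fmap1 !compm1.
Qed.

Lemma adjr_pre L R (a : adjunction L R) X X' Y (g : hom X' X) (f : hom (L X) Y) :
  adjr a (f ∘ fmap L g) = adjr a f ∘ g.
Proof.
have := adjr_nat a g f (idm Y).
by rewrite fmap1 !comp1m.
Qed.

Lemma adjl_comp L R (a : adjunction L R) X Y Y' (f : hom X (R Y)) (h : hom Y Y') :
  adjl a (fmap R h ∘ f) = h ∘ adjl a f.
Proof. by rewrite -[f in LHS](adjlK a) -adjr_comp adjrK. Qed.

Lemma adjl_pre L R (a : adjunction L R) X X' Y (g : hom X' X) (f : hom X (R Y)) :
  adjl a (f ∘ g) = adjl a f ∘ fmap L g.
Proof. by rewrite -[f in LHS](adjlK a) -adjr_pre adjrK. Qed.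

Lemma adjr_lin L R (a : adjunction L R) X Y : linear (@adjr L R a X Y).
Proof.
move=> k f g.
have E (h : hom (L X) Y) : adjr a h = fmap R h ∘ adjr a (idm (L X)).
  by rewrite -adjr_comp compm1.
by rewrite (E (_ + _)) fmap_lin comp_linl -!E.
Qed.

Lemma adjl_lin L R (a : adjunction L R) X Y : linear (@adjl L R a X Y).
Proof.
by move=> k f g; rewrite -[f in LHS](adjlK a) -[g in LHS](adjlK a) -adjr_lin adjrK.
Qed.

Definition adjunction_id : adjunction lfunctor_id lfunctor_id.
Proof.
exact: (@Adjunction lfunctor_id lfunctor_id
  (fun _ _ f => f) (fun _ _ f => f) (fun _ _ _ => erefl) (fun _ _ _ => erefl)
  (fun _ _ _ _ _ _ _ => erefl)).
Defined.

(** The mate [R' -> R] of [eta : L -> L'], for [L -| R] and [L' -| R']. *)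
Definition mate L R L' R' (a : adjunction L R) (a' : adjunction L' R')
  (eta : nat_trans L L') : nat_trans R' R.
Proof.
refine (@NatTrans R' R (fun Y => adjr a (adjl a' (idm (R' Y)) ∘ eta (R' Y))) _).
move=> X Y f.
rewrite -adjr_comp -adjr_pre -!compA nnat !compA; congr (adjr a (_ ∘ _)).
by rewrite -adjl_pre -adjl_comp comp1m compm1.
Defined.

End Endofunctors.
Arguments adjr {K C L R} a {X Y} _.
Arguments adjl {K C L R} a {X Y} _.

Section Tensor.
Variables (K : fieldType) (C : lincat K).

(** Copowers: [hom (tens V X) Y] represents the linear maps [V -> hom X Y].
    The value of [tens_desc] on a map that is not linear is irrelevant. *)
Record copowers := Copowers {
  tens : lmodType K -> C -> C;
  tens_in : forall (V : lmodType K) X, V -> hom X (tens V X);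
  tens_in_lin : forall (V : lmodType K) X, linear (@tens_in V X);
  tens_desc : forall (V : lmodType K) X Y, (V -> hom X Y) -> hom (tens V X) Y;
  tens_descK : forall (V : lmodType K) X Y (f : V -> hom X Y),
    linear f -> forall v, tens_desc f ∘ tens_in X v = f v;
  tens_ext : forall (V : lmodType K) X Y (f g : hom (tens V X) Y),
    (forall v : V, f ∘ tens_in X v = g ∘ tens_in X v) -> f = g }.
Arguments tens_in c {V} X v.

Variable T : copowers.

Lemma tens_in_comp_lin (V : lmodType K) X Y (f : hom X Y) :
  linear (fun v : V => tens_in T Y v ∘ f).
Proof. by move=> k u v; rewrite tens_in_lin comp_linl. Qed.

Definition tens_fun (V : lmodType K) : lfunctor C.
Proof.
refine (@LFunctor K C (tens T V)
  (fun X Y f => tens_desc T (fun v : V => tens_in T Y v ∘ f)) _ _ _).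
- move=> X; apply: tens_ext => v.
  by rewrite tens_descK ?comp1m ?compm1 //; exact: tens_in_comp_lin.
- move=> X Y Z g f; apply: tens_ext => v.
  rewrite -compA !tens_descK; try exact: tens_in_comp_lin.
  by rewrite !compA tens_descK //; exact: tens_in_comp_lin.
- move=> X Y k f g; apply: tens_ext => v.
  rewrite comp_linl !tens_descK ?comp_linr //; exact: tens_in_comp_lin.
Defined.

(** [ihom V] is the functor Hom(V, -), right adjoint to V ⊗ (-). *)
Record internal_hom := InternalHom {
  ihom : lmodType K -> lfunctor C;
  ihom_adj : forall V, adjunction (tens_fun V) (ihom V) }.

Record nonunital_monad := NonunitalMonad {
  nufun :> lfunctor C;
  numul : nat_trans (lfunctor_comp nufun nufun) nufun;
  numulA : forall X,
    numul X ∘ numul (nufun X) = numul X ∘ fmap nufun (numul X) }.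

Lemma id_mul_nat X Y (f : hom X Y) :
  idm Y ∘ fmap (lfunctor_comp (lfunctor_id C) (lfunctor_id C)) f =
  fmap (lfunctor_id C) f ∘ idm X.
Proof. by rewrite comp1m compm1. Qed.

Definition nonunital_monad_id : nonunital_monad :=
  @NonunitalMonad (lfunctor_id C)
    (@NatTrans K C (lfunctor_comp (lfunctor_id C) (lfunctor_id C)) (lfunctor_id C)
       (fun X => idm X) id_mul_nat) (fun _ => erefl).

Variables (H : internal_hom) (F G : lfunctor C) (FG : adjunction F G).

Lemma adjr_in_lin (V : lmodType K) X Y (f : hom (tens T V (F X)) Y) :
  linear (fun v : V => adjr FG (f ∘ tens_in T (F X) v)).
Proof. by move=> k u v; rewrite tens_in_lin comp_linr adjr_lin. Qed.

Lemma adjl_in_lin (V : lmodType K) X Y (g : hom (tens T V X) (G Y)) :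
  linear (fun v : V => adjl FG (g ∘ tens_in T X v)).
Proof. by move=> k u v; rewrite tens_in_lin comp_linr adjl_lin. Qed.

(** The adjunction between V ⊗ F(-) and Hom(V, G(-)):
    C(V ⊗ F X, Y) = Lin(V, C(F X, Y)) = Lin(V, C(X, G Y)) = C(V ⊗ X, G Y)
                  = C(X, Hom(V, G Y)). *)
Definition tens_ihom_adj (V : lmodType K) :
  adjunction (lfunctor_comp (tens_fun V) F) (lfunctor_comp (ihom H V) G).
Proof.
refine (@Adjunction K C (lfunctor_comp (tens_fun V) F) (lfunctor_comp (ihom H V) G)
  (fun X Y f => adjr (ihom_adj H V)
     (tens_desc T (fun v : V => adjr FG (f ∘ tens_in T (F X) v))))
  (fun X Y g => tens_desc T (fun v : V =>
     adjl FG (adjl (ihom_adj H V) g ∘ tens_in T X v))) _ _ _).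
- move=> X Y f; apply: tens_ext => v.
  rewrite tens_descK; last exact: adjl_in_lin.
  by rewrite adjrK tens_descK ?adjrK //; exact: adjr_in_lin.
- move=> X Y g /=; rewrite -[RHS](adjlK (ihom_adj H V)); congr adjr.
  apply: tens_ext => v.
  rewrite tens_descK; last exact: adjr_in_lin.
  by rewrite tens_descK ?adjlK //; exact: adjl_in_lin.
- move=> X X' Y Y' g f h /=.
  rewrite -adjr_comp -adjr_pre; congr adjr.
  apply: tens_ext => v; rewrite tens_descK; last exact: adjr_in_lin.
  rewrite -!compA tens_descK; last exact: tens_in_comp_lin.
  rewrite tens_descK; last exact: tens_in_comp_lin.
  rewrite !compA -(compA (fmap G h)) tens_descK; last exact: adjr_in_lin.
  by rewrite -adjr_comp -adjr_pre !compA.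
Defined.

End Tensor.
Arguments tens_in {K C} c {V} X v.

Definition sumz (n : seq int) : int := \sum_(i <- n) i.

(** [k = size n]; operations of arity k have degree 2 - k. *)
Definition deg (n : seq int) : int := sumz n + (2 - (size n)%:Z).

(** Targets of module and comodule operations, and of ∞-morphisms; there
    [k = (size n).+1]. *)
Definition mdeg (n : seq int) (l : int) : int := sumz n + l + (2 - (size n).+1%:Z).
Definition adeg (n : seq int) (l : int) : int := sumz n + l + (1 - (size n).+1%:Z).

Lemma sumz_cat m n : sumz (m ++ n) = sumz m + sumz n.
Proof. exact: big_cat. Qed.

Lemma sumz_cons i n : sumz (i :: n) = i + sumz n.
Proof. exact: big_cons. Qed.

Definition degE := (size_cat, sumz_cat, sumz_cons).

Lemma deg_split z n n' n'' : n ++ n' ++ n'' = z ->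
  deg (n ++ deg n' :: n'') = sumz z + (3 - (size z)%:Z).
Proof.
move=> <-; rewrite /deg !degE /=; lia.
Qed.

Lemma mdeg_split3 z n n' n'' l : n ++ n' ++ n'' = z ->
  mdeg (n ++ deg n' :: n'') l = sumz z + l + (2 - (size z)%:Z).
Proof. by move=> <-; rewrite /mdeg /deg !degE /=; lia. Qed.

Lemma mdeg_split2 z m m' l : m ++ m' = z ->
  mdeg m (mdeg m' l) = sumz z + l + (2 - (size z)%:Z).
Proof. by move=> <-; rewrite /mdeg !degE; lia. Qed.

Lemma adeg_split3 z n n' n'' l : n ++ n' ++ n'' = z ->
  adeg (n ++ deg n' :: n'') l = sumz z + l + (1 - (size z)%:Z).
Proof. by move=> <-; rewrite /adeg /deg !degE /=; lia. Qed.

Lemma adeg_mdeg z m m' l : m ++ m' = z ->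
  adeg m (mdeg m' l) = sumz z + l + (1 - (size z)%:Z).
Proof. by move=> <-; rewrite /adeg /mdeg !degE; lia. Qed.

Lemma mdeg_adeg z m m' l : m ++ m' = z ->
  mdeg m (adeg m' l) = sumz z + l + (1 - (size z)%:Z).
Proof. by move=> <-; rewrite /adeg /mdeg !degE; lia. Qed.

Lemma adeg_adeg z n n' l : n ++ n' = z -> adeg n (adeg n' l) = adeg z l.
Proof. by move=> <-; rewrite /adeg !degE; lia. Qed.

Lemma adeg_nil l : l = adeg [::] l.
Proof. by rewrite /adeg /sumz big_nil add0r subrr addr0. Qed.

Lemma deg_rev n : deg (rev n) = deg n.
Proof.
rewrite /deg size_rev; congr (_ + _).
by elim: n => //= i n IH; rewrite rev_cons -cats1 !degE IH addrC /sumz big_nil addr0.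
Qed.

Lemma cat_assoc3 (z w n n' n'' : seq int) :
  n ++ w = z -> n' ++ n'' = w -> n ++ n' ++ n'' = z.
Proof. by move=> <- <-. Qed.

Section Sums.
Variable V : zmodType.

Definition sum2 z (t : forall m m' : seq int, m ++ m' = z -> V) : V :=
  \sum_(p < (size z).+1) t (take p z) (drop p z) (cat_take_drop p z).

(** Sum over all partitions z = (n, n', n'') with n' nonempty. *)
Definition sum3 z (t : forall n n' n'' : seq int, n ++ n' ++ n'' = z -> V) : V :=
  sum2 (fun n w (e : n ++ w = z) => sum2 (fun n' n'' (e' : n' ++ n'' = w) =>
    if nilp n' then 0 else t n n' n'' (cat_assoc3 e e'))).

End Sums.

Definition sg (K : fieldType) (e : int) : K := (-1) ^ e.
Arguments sg {K} e.

Section Ainf_algebras.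
Variable K : fieldType.

Fixpoint elts (A : int -> lmodType K) (n : seq int) : Type :=
  if n is a :: n' then (A a * elts A n')%type else unit.

Fixpoint multilinear (A : int -> lmodType K) (L : lmodType K) (n : seq int) :
    (elts A n -> L) -> Prop :=
  match n with
  | [::] => fun _ => True
  | a :: n' => fun g =>
      (forall w : elts A n', linear (fun v : A a => g (v, w))) /\
      (forall v : A a, multilinear (fun w : elts A n' => g (v, w)))
  end.

Fixpoint elts_split (A : int -> lmodType K) (n n' : seq int) :
    elts A (n ++ n') -> elts A n * elts A n' :=
  match n with
  | [::] => fun w => (tt, w)
  | a :: m => fun w => let: (x, y) := @elts_split A m n' w.2 in ((w.1, x), y)
  end.

(** The map 1^{⊗p} ⊗ m_q ⊗ 1^{⊗r} on tuples, without sign. *)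
Fixpoint elts_insert (A : int -> lmodType K) (mul : forall n, elts A n -> A (deg n))
    (n n' n'' : seq int) : elts A (n ++ n' ++ n'') -> elts A (n ++ deg n' :: n'') :=
  match n with
  | [::] => fun w => let: (x, y) := @elts_split A n' n'' w in (mul n' x, y)
  | a :: m => fun w => (w.1, @elts_insert A mul m n' n'' w.2)
  end.

(** Linear maps A_{n_1} ⊗ ... ⊗ A_{n_k} -> A_{Σn + 2 - k} are given as
    multilinear maps.  The operations have k >= 1, whence [amul_nil].  In the
    defining relation, (-1)^{qΣn} is the Koszul sign of
    1^{⊗p} ⊗ m_q ⊗ 1^{⊗r}, as m_q has degree 2 - q. *)
Record Ainf_algebra := AinfAlgebra {
  agr :> int -> lmodType K;
  amul : forall n, elts agr n -> agr (deg n);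
  amul_lin : forall n, multilinear (@amul n);
  amul_nil : forall w, @amul [::] w = 0;
  amul_rel : forall z (w : elts agr z),
    sum3 (fun n n' n'' (e : n ++ n' ++ n'' = z) =>
      let: p := (size n)%:Z in let: q := (size n')%:Z in let: r := (size n'')%:Z in
      sg (p + q * r + q * sumz n) *:
        eq_rect _ agr
          (amul (elts_insert amul (eq_rect _ (elts agr) w _ (esym e))))
          _ (deg_split e)) = 0 }.

Definition Ainf_even (A : Ainf_algebra) : Prop :=
  forall n (w : elts A n), odd (size n) -> amul w = 0.

End Ainf_algebras.

Section Iterated.
Variables (K : fieldType) (C : lincat K) (U : int -> lfunctor C).

Fixpoint seqob (n : seq int) (X : C) : C :=
  if n is a :: n' then U a (seqob n' X) else X.

Fixpoint seqmap (n : seq int) X Y (f : hom X Y) : hom (seqob n X) (seqob n Y) :=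
  if n is a :: n' then fmap (U a) (seqmap n' f) else f.

Definition seqfun (n : seq int) : lfunctor C.
Proof.
refine (@LFunctor K C (seqob n) (@seqmap n) _ _ _).
- by move=> X; elim: n => //= a n ->; rewrite fmap1.
- by move=> X Y Z g f; elim: n => //= a n ->; rewrite fmapM.
- by move=> X Y k f g; elim: n => //= a n ->; rewrite fmap_lin.
Defined.

(** U_{n_k} ∘ ... ∘ U_{n_1}. *)
Fixpoint revob (n : seq int) (X : C) : C :=
  if n is a :: n' then revob n' (U a X) else X.

Fixpoint revmap (n : seq int) X Y (f : hom X Y) : hom (revob n X) (revob n Y) :=
  if n is a :: n' then revmap n' (fmap (U a) f) else f.

Definition revfun (n : seq int) : lfunctor C.
Proof.
refine (@LFunctor K C (revob n) (@revmap n) _ _ _).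
- by elim: n => //= a n IH X; rewrite fmap1 IH.
- by elim: n => //= a n IH X Y Z g f; rewrite fmapM IH.
- by elim: n => //= a n IH X Y k f g; rewrite fmap_lin IH.
Defined.

Lemma seqob_cat n n' X : seqob (n ++ n') X = seqob n (seqob n' X).
Proof. by elim: n => //= a n ->. Qed.

Lemma revob_rev n X : revob n X = seqob (rev n) X.
Proof. by elim: n X => //= a n IH X; rewrite rev_cons -cats1 seqob_cat IH. Qed.

Lemma seqob_split n n' z (e : n ++ n' = z) X : seqob z X = seqob n (seqob n' X).
Proof. by rewrite -e seqob_cat. Qed.

Lemma seqob_split3 n n' n'' z (e : n ++ n' ++ n'' = z) X :
  seqob z X = seqob n (seqob n' (seqob n'' X)).
Proof. by rewrite -e !seqob_cat. Qed.

(** For z = (n, n'), the composite U_z X = U_n U_n' X -> U_n Y -> Z. *)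
Definition scomp n n' z (e : n ++ n' = z) X Y Z
    (f : hom (seqob n Y) Z) (g : hom (seqob n' X) Y) : hom (seqob z X) Z :=
  f ∘ seqmap n g ∘ idto (seqob_split e X).

(** For z = (n, n'), the composite Z -> U_n Y -> U_n U_n' X = U_z X. *)
Definition sccomp n n' z (e : n ++ n' = z) X Y Z
    (f : hom Z (seqob n Y)) (g : hom Y (seqob n' X)) : hom Z (seqob z X) :=
  idto (esym (seqob_split e X)) ∘ (seqmap n g ∘ f).

(** (U_n * θ(n') * U_n'') X : U_z X -> U_(n, deg n', n'') X, for z = (n, n', n''). *)
Definition whisker (theta : forall n, nat_trans (seqfun n) (U (deg n)))
    n n' n'' z (e : n ++ n' ++ n'' = z) X :
    hom (seqob z X) (seqob (n ++ deg n' :: n'') X) :=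
  idto (esym (seqob_cat n (deg n' :: n'') X)) ∘ seqmap n (theta n' (seqob n'' X))
    ∘ idto (seqob_split3 e X).

(** (U_n * δ(n') * U_n'') X : U_(n, deg n', n'') X -> U_z X, for z = (n, n', n''). *)
Definition cowhisker (delta : forall n, nat_trans (U (deg n)) (seqfun n))
    n n' n'' z (e : n ++ n' ++ n'' = z) X :
    hom (seqob (n ++ deg n' :: n'') X) (seqob z X) :=
  idto (esym (seqob_split3 e X)) ∘ seqmap n (delta n' (seqob n'' X))
    ∘ idto (seqob_cat n (deg n' :: n'') X).

(** Structure maps have arity k = [size n] >= 1: [theta [::]] and [delta [::]] do
    not occur in the relations. *)
Definition Ainf_monad (theta : forall n, nat_trans (seqfun n) (U (deg n))) : Prop :=
  forall z X, z <> [::] ->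
  sum3 (fun n n' n'' (e : n ++ n' ++ n'' = z) =>
    let: p := (size n)%:Z in let: q := (size n')%:Z in let: r := (size n'')%:Z in
    sg (p + q * r + q * sumz n) *:
      (icast (fun i => U i X) (deg_split e)
         ∘ theta (n ++ deg n' :: n'') X ∘ whisker theta e X)) = 0.

Definition Ainf_comonad (delta : forall n, nat_trans (U (deg n)) (seqfun n)) : Prop :=
  forall z X, z <> [::] ->
  sum3 (fun n n' n'' (e : n ++ n' ++ n'' = z) =>
    let: p := (size n)%:Z in let: q := (size n')%:Z in let: r := (size n'')%:Z in
    sg (p * q + r + q * sumz n) *:
      (cowhisker delta e X ∘ delta (n ++ deg n' :: n'') X
         ∘ icast (fun i => U i X) (esym (deg_split e)))) = 0.

End Iterated.

Section Modules.
Variables (K : fieldType) (C : lincat K) (U : int -> lfunctor C).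
Variable theta : forall n, nat_trans (seqfun U n) (U (deg n)).

(** [mact n l] is π_k(n, l) with k = [(size n).+1]. *)
Record even_module := EvenModule {
  mob :> int -> C;
  mact : forall n l, hom (seqob U n (mob l)) (mob (mdeg n l));
  mact_rel : forall z l,
    sum3 (fun n n' n'' (e : n ++ n' ++ n'' = z) =>
      let: p := (size n)%:Z in let: q := (size n')%:Z in
      let: r := (size n'').+1%:Z in
      sg (p + q * r + q * sumz n) *:
        (icast mob (mdeg_split3 l e)
           ∘ mact (n ++ deg n' :: n'') l ∘ whisker theta e (mob l)))
    = - sum2 (fun m m' (e : m ++ m' = z) =>
      let: a := (size m)%:Z in let: b := (size m').+1%:Z in
      sg (a + b * sumz m) *:
        (icast mob (mdeg_split2 l e) ∘ scomp e (mact m (mdeg m' l)) (mact m' l)));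
  mact_even : forall n l, odd (size n).+1 -> mact n l = 0 }.

Record mod_hom (M M' : even_module) := ModHom {
  mhom :> forall l, hom (M l) (M' l);
  mhom_act : forall n l,
    mhom (mdeg n l) ∘ mact M n l = mact M' n l ∘ seqmap U n (mhom l) }.

(** [alpha n l] is α_k(n, l) with k = [(size n).+1]. *)
Definition inf_morphism (M1 M2 : even_module)
    (alpha : forall n l, hom (seqob U n (M1 l)) (M2 (adeg n l))) : Prop :=
  forall z l,
    sum2 (fun m m' (e : m ++ m' = z) =>
      let: a := (size m)%:Z in let: b := (size m').+1%:Z in
      sg (a + b * sumz m) *:
        (icast M2 (adeg_mdeg l e) ∘ scomp e (alpha m (mdeg m' l)) (mact M1 m' l)))
    + sum3 (fun n n' n'' (e : n ++ n' ++ n'' = z) =>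
      let: a := (size n)%:Z in let: b := (size n')%:Z in
      let: c := (size n'').+1%:Z in
      sg (a + b * c + b * sumz n) *:
        (icast M2 (adeg_split3 l e)
           ∘ alpha (n ++ deg n' :: n'') l ∘ whisker theta e (M1 l)))
    = sum2 (fun p p' (e : p ++ p' = z) =>
        icast M2 (mdeg_adeg l e) ∘ scomp e (mact M2 p (adeg p' l)) (alpha p' l)).

Record odd_inf_morphism (M1 M2 : even_module) := OddInfMorphism {
  imap :> forall n l, hom (seqob U n (M1 l)) (M2 (adeg n l));
  imap_rel : inf_morphism imap;
  imap_odd : forall n l, ~~ odd (size n).+1 -> imap n l = 0 }.

Definition inf_id (M : even_module) n l : hom (seqob U n (M l)) (M (adeg n l)) :=
  match n with
  | [::] => icast M (adeg_nil l)
  | _ :: _ => 0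
  end.

Definition inf_comp (M1 M2 M3 : even_module)
    (beta : forall n l, hom (seqob U n (M2 l)) (M3 (adeg n l)))
    (alpha : forall n l, hom (seqob U n (M1 l)) (M2 (adeg n l))) z l :
    hom (seqob U z (M1 l)) (M3 (adeg z l)) :=
  sum2 (fun n n' (e : n ++ n' = z) =>
    icast M3 (adeg_adeg l e) ∘ scomp e (beta n (adeg n' l)) (alpha n' l)).

End Modules.

Section Comodules.
Variables (K : fieldType) (C : lincat K) (V : int -> lfunctor C).
Variable delta : forall n, nat_trans (V (deg n)) (seqfun V n).

(** [cact n l] is ρ_k(n, l) with k = [(size n).+1]. *)
Record even_comodule := EvenComodule {
  pob :> int -> C;
  cact : forall n l, hom (pob (mdeg n l)) (seqob V n (pob l));
  cact_rel : forall z l,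
    sum3 (fun n n' n'' (e : n ++ n' ++ n'' = z) =>
      let: p := (size n)%:Z in let: q := (size n')%:Z in
      let: r := (size n'').+1%:Z in
      sg (p * q + r + q * sumz n) *:
        (cowhisker delta e (pob l) ∘ cact (n ++ deg n' :: n'') l
           ∘ icast pob (esym (mdeg_split3 l e))))
    = - sum2 (fun m m' (e : m ++ m' = z) =>
      let: a := (size m)%:Z in let: b := (size m').+1%:Z in
      sg (a * b + b * sumz m) *:
        (sccomp e (cact m (mdeg m' l)) (cact m' l)
           ∘ icast pob (esym (mdeg_split2 l e))));
  cact_even : forall n l, odd (size n).+1 -> cact n l = 0 }.

Record comod_hom (P P' : even_comodule) := ComodHom {
  chmap :> forall l, hom (P l) (P' l);
  chmap_act : forall n l,
    cact P' n l ∘ chmap (mdeg n l) = seqmap V n (chmap l) ∘ cact P n l }.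

(** [alpha n l] is α_k(n, l) with k = [(size n).+1]. *)
Definition coinf_morphism (P1 P2 : even_comodule)
    (alpha : forall n l, hom (P1 (adeg n l)) (seqob V n (P2 l))) : Prop :=
  forall z l,
    sum2 (fun m m' (e : m ++ m' = z) =>
      let: a := (size m)%:Z in let: b := (size m').+1%:Z in
      sg (a * b + b * sumz m) *:
        (sccomp e (alpha m (mdeg m' l)) (cact P2 m' l)
           ∘ icast P1 (esym (adeg_mdeg l e))))
    + sum3 (fun n n' n'' (e : n ++ n' ++ n'' = z) =>
      let: a := (size n)%:Z in let: b := (size n')%:Z in
      let: c := (size n'').+1%:Z in
      sg (c + a * b + b * sumz n) *:
        (cowhisker delta e (P2 l) ∘ alpha (n ++ deg n' :: n'') l
           ∘ icast P1 (esym (adeg_split3 l e))))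
    = sum2 (fun p p' (e : p ++ p' = z) =>
        sccomp e (cact P1 p (adeg p' l)) (alpha p' l)
          ∘ icast P1 (esym (mdeg_adeg l e))).

Record odd_coinf_morphism (P1 P2 : even_comodule) := OddCoinfMorphism {
  cimap :> forall n l, hom (P1 (adeg n l)) (seqob V n (P2 l));
  cimap_rel : coinf_morphism cimap;
  cimap_odd : forall n l, ~~ odd (size n).+1 -> cimap n l = 0 }.

Definition coinf_id (P : even_comodule) n l : hom (P (adeg n l)) (seqob V n (P l)) :=
  match n with
  | [::] => icast P (esym (adeg_nil l))
  | _ :: _ => 0
  end.

Definition coinf_comp (P1 P2 P3 : even_comodule)
    (beta : forall n l, hom (P2 (adeg n l)) (seqob V n (P3 l)))
    (alpha : forall n l, hom (P1 (adeg n l)) (seqob V n (P2 l))) z l :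
    hom (P1 (adeg z l)) (seqob V z (P3 l)) :=
  sum2 (fun n n' (e : n ++ n' = z) =>
    sccomp e (alpha n (adeg n' l)) (beta n' l)
      ∘ icast P1 (esym (adeg_adeg l e))).

End Comodules.

Section SumLemmas.
Variable V : zmodType.

Lemma eq_sum2 z (t t' : forall m m' : seq int, m ++ m' = z -> V) :
  (forall m m' e, t m m' e = t' m m' e) -> sum2 t = sum2 t'.
Proof. by move=> E; apply: eq_bigr. Qed.

Lemma sum2_nil (t : forall m m' : seq int, m ++ m' = [::] -> V) :
  sum2 t = t [::] [::] erefl.
Proof. by rewrite /sum2 big_ord1; congr t; apply: Prop_irrelevance. Qed.

Lemma sum2_cons x z (t : forall m m' : seq int, m ++ m' = x :: z -> V) :
  sum2 t = t [::] (x :: z) erefl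
         + sum2 (fun m m' (e : m ++ m' = z) => t (x :: m) m' (f_equal (cons x) e)).
Proof.
rewrite /sum2 big_ord_recl /=; congr (_ + _).
  by congr t; apply: Prop_irrelevance.
by apply: eq_bigr => i _; congr t; apply: Prop_irrelevance.
Qed.

Lemma sum2D z (t t' : forall m m' : seq int, m ++ m' = z -> V) :
  sum2 (fun m m' e => t m m' e + t' m m' e) = sum2 t + sum2 t'.
Proof. exact: big_split. Qed.

Lemma sum2_0 z (t : forall m m' : seq int, m ++ m' = z -> V) :
  (forall m m' e, t m m' e = 0) -> sum2 t = 0.
Proof. by move=> E; apply: big1. Qed.

Lemma sum2_exchange z w
    (t : forall m m' : seq int, m ++ m' = z -> forall n n', n ++ n' = w -> V) :
  sum2 (fun m m' e => sum2 (fun n n' e' => t m m' e n n' e')) =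
  sum2 (fun n n' e' => sum2 (fun m m' e => t m m' e n n' e')).
Proof. exact: exchange_big. Qed.

Lemma sum2_assoc z (t : forall u v w : seq int, u ++ v ++ w = z -> V)
    (p1 : forall y w u v, y ++ w = z -> u ++ v = y -> u ++ v ++ w = z)
    (p2 : forall y w u v, u ++ y = z -> v ++ w = y -> u ++ v ++ w = z) :
  sum2 (fun y w e => sum2 (fun u v e' => t u v w (p1 y w u v e e'))) =
  sum2 (fun u y e => sum2 (fun v w e' => t u v w (p2 y w u v e e'))).
Proof.
elim: z t p1 p2 => [|x z IH] t p1 p2.
  by rewrite !sum2_nil; congr t; apply: Prop_irrelevance.
rewrite !sum2_cons.
transitivity (t [::] [::] (x :: z) erefl
  + sum2 (fun y w (e : y ++ w = z) => t [::] (x :: y) w (f_equal (cons x) e)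
     + sum2 (fun u v (e' : u ++ v = y) =>
         t (x :: u) v w (f_equal (cons x) (etrans (catA u v w) (etrans (f_equal (cat^~ w) e') e)))))).
  congr (_ + _); first by rewrite sum2_nil; congr t; apply: Prop_irrelevance.
  apply: eq_sum2 => m m' e; rewrite sum2_cons; congr (_ + _).
    by congr t; apply: Prop_irrelevance.
  by apply: eq_sum2 => u v e'; congr t; apply: Prop_irrelevance.
rewrite sum2D addrA; congr (_ + _).
  congr (_ + _); first by congr t; apply: Prop_irrelevance.
  by apply: eq_sum2 => m m' e; congr t; apply: Prop_irrelevance.
have q2 y w u v : u ++ y = z -> v ++ w = y -> u ++ v ++ w = z by move=> <- <-.
rewrite (IH (fun u v w e => t (x :: u) v w (f_equal (cons x) e)) _ q2).
by apply: eq_sum2 => m m' e; apply: eq_sum2 => u v e'; congr t; apply: Prop_irrelevance.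
Qed.

Lemma sum2_insert n s n'' (t : forall u v : seq int, u ++ v = n ++ s :: n'' -> V)
    (p1 : forall u n1, u ++ n1 = n -> u ++ n1 ++ s :: n'' = n ++ s :: n'')
    (p2 : forall w1 w2, w1 ++ w2 = n'' -> (n ++ s :: w1) ++ w2 = n ++ s :: n'') :
  sum2 t = sum2 (fun u n1 e => t u (n1 ++ s :: n'') (p1 u n1 e))
         + sum2 (fun w1 w2 e => t (n ++ s :: w1) w2 (p2 w1 w2 e)).
Proof.
elim: n t p1 p2 => [|x n IH] t p1 p2.
  rewrite sum2_nil /= sum2_cons; congr (_ + _); first by congr t; apply: Prop_irrelevance.
  by apply: eq_sum2 => m m' e; congr t; apply: Prop_irrelevance.
rewrite /= !sum2_cons.
have q1 u n1 : u ++ n1 = n -> u ++ n1 ++ s :: n'' = n ++ s :: n''.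
  by move=> <-; rewrite catA.
have q2 w1 w2 : w1 ++ w2 = n'' -> (n ++ s :: w1) ++ w2 = n ++ s :: n''.
  by move=> <-; rewrite -catA.
rewrite (IH _ q1 q2) addrA; congr (_ + _ + _); first by congr t; apply: Prop_irrelevance.
  by apply: eq_sum2 => m m' e; congr t; apply: Prop_irrelevance.
by apply: eq_sum2 => m m' e; congr t; apply: Prop_irrelevance.
Qed.

Lemma eq_sum3 z (t t' : forall n n' n'' : seq int, n ++ n' ++ n'' = z -> V) :
  (forall n n' n'' e, t n n' n'' e = t' n n' n'' e) -> sum3 t = sum3 t'.
Proof.
by move=> E; apply: eq_sum2 => n w e; apply: eq_sum2 => n' n'' e'; rewrite E.
Qed.

Lemma sum3_0 z (t : forall n n' n'' : seq int, n ++ n' ++ n'' = z -> V) :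
  (forall n n' n'' e, t n n' n'' e = 0) -> sum3 t = 0.
Proof.
by move=> E; apply: sum2_0 => n w e; apply: sum2_0 => n' n'' e'; rewrite E if_same.
Qed.

Lemma sum3_left z
    (t : forall u n1 n' n'' : seq int, u ++ n1 ++ n' ++ n'' = z -> V)
    (p1 : forall n n' n'' u n1, n ++ n' ++ n'' = z -> u ++ n1 = n -> u ++ n1 ++ n' ++ n'' = z)
    (p2 : forall u z' n1 n' n'', u ++ z' = z -> n1 ++ n' ++ n'' = z' -> u ++ n1 ++ n' ++ n'' = z) :
  sum3 (fun n n' n'' e => sum2 (fun u n1 e' => t u n1 n' n'' (p1 n n' n'' u n1 e e'))) =
  sum2 (fun u z' e => sum3 (fun n1 n' n'' e' => t u n1 n' n'' (p2 u z' n1 n' n'' e e'))).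
Proof.
have q u v w n' n'' : u ++ v ++ w = z -> n' ++ n'' = w -> u ++ v ++ n' ++ n'' = z.
  by move=> <- <-.
pose t' u v w (e : u ++ v ++ w = z) : V :=
  sum2 (fun n' n'' (e' : n' ++ n'' = w) =>
    if nilp n' then 0 else t u v n' n'' (q u v w n' n'' e e')).
have h1 y w u v : y ++ w = z -> u ++ v = y -> u ++ v ++ w = z by move=> <- <-; rewrite -!catA.
have h2 y w u v : u ++ y = z -> v ++ w = y -> u ++ v ++ w = z by move=> <- <-.
transitivity (sum2 (fun y w e => sum2 (fun u v e' => t' u v w (h1 y w u v e e')))).
  apply: eq_sum2 => n w e; rewrite sum2_exchange.
  apply: eq_sum2 => n' n'' e'; case: (nilp n'); first by rewrite sum2_0.
  by apply: eq_sum2 => u v e''; congr t; apply: Prop_irrelevance.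
rewrite (sum2_assoc t' h1 h2); apply: eq_sum2 => u y e; apply: eq_sum2 => v w e'.
apply: eq_sum2 => n' n'' e''; case: (nilp n') => //.
by congr t; apply: Prop_irrelevance.
Qed.

Lemma sum3_right z
    (t : forall n n' w1 w2 : seq int, n ++ n' ++ w1 ++ w2 = z -> V)
    (p1 : forall n n' n'' w1 w2, n ++ n' ++ n'' = z -> w1 ++ w2 = n'' -> n ++ n' ++ w1 ++ w2 = z)
    (p2 : forall y w2 n n' w1, y ++ w2 = z -> n ++ n' ++ w1 = y -> n ++ n' ++ w1 ++ w2 = z) :
  sum3 (fun n n' n'' e => sum2 (fun w1 w2 e' => t n n' w1 w2 (p1 n n' n'' w1 w2 e e'))) =
  sum2 (fun y w2 e => sum3 (fun n n' w1 e' => t n n' w1 w2 (p2 y w2 n n' w1 e e'))).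
Proof.
have h n n' v w1 w2 : n ++ v ++ w2 = z -> n' ++ w1 = v -> n ++ n' ++ w1 ++ w2 = z.
  by move=> <- <-; rewrite -!catA.
pose t' n v w2 (e : n ++ v ++ w2 = z) : V :=
  sum2 (fun n' w1 (e' : n' ++ w1 = v) =>
    if nilp n' then 0 else t n n' w1 w2 (h n n' v w1 w2 e e')).
have h1 y w u v : y ++ w = z -> u ++ v = y -> u ++ v ++ w = z by move=> <- <-; rewrite -!catA.
have h2 y w u v : u ++ y = z -> v ++ w = y -> u ++ v ++ w = z by move=> <- <-.
transitivity (sum2 (fun u y e => sum2 (fun v w e' => t' u v w (h2 y w u v e e')))).
  apply: eq_sum2 => n w e.
  have g1 y w2 n' w1 : y ++ w2 = w -> n' ++ w1 = y -> n' ++ w1 ++ w2 = w.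
    by move=> <- <-; rewrite -!catA.
  have g2 n'' w2 n' w1 : n' ++ n'' = w -> w1 ++ w2 = n'' -> n' ++ w1 ++ w2 = w.
    by move=> <- <-.
  have g n' w1 w2 : n' ++ w1 ++ w2 = w -> n ++ n' ++ w1 ++ w2 = z by move=> ->.
  pose t'' n' w1 w2 (e' : n' ++ w1 ++ w2 = w) : V :=
    if nilp n' then 0 else t n n' w1 w2 (g n' w1 w2 e').
  transitivity (sum2 (fun n' n'' e1 => sum2 (fun w1 w2 e2 =>
      t'' n' w1 w2 (g2 n'' w2 n' w1 e1 e2)))).
    apply: eq_sum2 => n' n'' e'; rewrite /t''; case: (nilp n'); first by rewrite sum2_0.
    by apply: eq_sum2 => w1 w2 e2; congr t; apply: Prop_irrelevance.
  rewrite -(sum2_assoc t'' g1); apply: eq_sum2 => y w2 e1.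
  apply: eq_sum2 => n' w1 e2; rewrite /t''; case: (nilp n') => //.
  by congr t; apply: Prop_irrelevance.
rewrite -(sum2_assoc t' h1); apply: eq_sum2 => y w e; apply: eq_sum2 => u v e'.
apply: eq_sum2 => n' n'' e''; case: (nilp n') => //.
by congr t; apply: Prop_irrelevance.
Qed.

Lemma sum3D z (t t' : forall n n' n'' : seq int, n ++ n' ++ n'' = z -> V) :
  sum3 (fun n n' n'' e => t n n' n'' e + t' n n' n'' e) = sum3 t + sum3 t'.
Proof.
rewrite /sum3 -sum2D; apply: eq_sum2 => n w e; rewrite -sum2D.
by apply: eq_sum2 => n' n'' e'; case: (nilp n'); rewrite ?addr0.
Qed.

End SumLemmas.

Section SumLinear.
Variables (K : fieldType) (V W : lmodType K) (f : V -> W) (f_lin : linear f).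

Lemma lin0 : f 0 = 0.
Proof. by have := f_lin (-1) 0 0; rewrite scaleN1r oppr0 addr0 scaleN1r addNr. Qed.

Lemma linD x y : f (x + y) = f x + f y.
Proof. by have := f_lin 1 x y; rewrite !scale1r. Qed.

Lemma linZ k x : f (k *: x) = k *: f x.
Proof. by have := f_lin k x 0; rewrite lin0 !addr0. Qed.

Lemma lin_sum2 z (t : forall m m' : seq int, m ++ m' = z -> V) :
  f (sum2 t) = sum2 (fun m m' e => f (t m m' e)).
Proof. exact: (big_morph f linD lin0). Qed.

Lemma lin_sum3 z (t : forall n n' n'' : seq int, n ++ n' ++ n'' = z -> V) :
  f (sum3 t) = sum3 (fun n n' n'' e => f (t n n' n'' e)).
Proof.
rewrite lin_sum2; apply: eq_sum2 => n w e; rewrite lin_sum2.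
by apply: eq_sum2 => n' n'' e'; case: (nilp n') => //; rewrite lin0.
Qed.

End SumLinear.

Section SumScale.
Variables (K : fieldType) (V : lmodType K) (k : K).

Lemma scale_lin : linear (fun x : V => k *: x).
Proof. by move=> c x y; rewrite scalerDr !scalerA mulrC. Qed.

Lemma sum2Z z (t : forall m m' : seq int, m ++ m' = z -> V) :
  k *: sum2 t = sum2 (fun m m' e => k *: t m m' e).
Proof. exact: (lin_sum2 scale_lin). Qed.

Lemma sum3Z z (t : forall n n' n'' : seq int, n ++ n' ++ n'' = z -> V) :
  k *: sum3 t = sum3 (fun n n' n'' e => k *: t n n' n'' e).
Proof. exact: (lin_sum3 scale_lin). Qed.

End SumScale.

(** The closure of (odd) ∞-morphisms under composition is proved for modules and
    comodules at once: [G n X Y] stands for [hom (U_n X) Y], resp.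
    [hom Y (V_n X)]. *)

Section Composition.
Variables (K : fieldType) (Ob : Type) (G : seq int -> Ob -> Ob -> lmodType K).

Definition ic (M : int -> Ob) n X i j (e : i = j) (x : G n X (M i)) : G n X (M j) :=
  eq_rect i (fun i => G n X (M i)) x j e.

Variable sc : forall n n' z, n ++ n' = z -> forall X Y Z, G n Y Z -> G n' X Y -> G z X Z.
Variable wh : forall n n' n'' z, n ++ n' ++ n'' = z ->
  forall X Z, G (n ++ deg n' :: n'') X Z -> G z X Z.
Variable uu : forall X, G [::] X X.

Hypothesis sc_linl : forall n n' z (e : n ++ n' = z) X Y Z (g : G n' X Y),
  linear (fun f : G n Y Z => sc e f g).
Hypothesis sc_linr : forall n n' z (e : n ++ n' = z) X Y Z (f : G n Y Z),
  linear (fun g : G n' X Y => sc e f g).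
Hypothesis scA : forall n1 n2 n3 m w z (e1 : n1 ++ n2 = m) (e2 : m ++ n3 = z)
    (e3 : n1 ++ w = z) (e4 : n2 ++ n3 = w) X Y Z T
    (f : G n1 Z T) (g : G n2 Y Z) (h : G n3 X Y),
  sc e2 (sc e1 f g) h = sc e3 f (sc e4 g h).
Hypothesis wh_lin : forall n n' n'' z (e : n ++ n' ++ n'' = z) X Z,
  linear (fun f : G (n ++ deg n' :: n'') X Z => wh e f).
Hypothesis wh_scl : forall u n1 n n' n'' z z' (e : n ++ n' ++ n'' = z)
    (e1 : u ++ (n1 ++ deg n' :: n'') = n ++ deg n' :: n'') (e0 : u ++ n1 = n)
    (e2 : u ++ z' = z) (e3 : n1 ++ n' ++ n'' = z') X Y Z
    (f : G u Y Z) (g : G (n1 ++ deg n' :: n'') X Y),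
  wh e (sc e1 f g) = sc e2 f (wh e3 g).
Hypothesis wh_scr : forall n n' n'' w1 w2 z z' (e : n ++ n' ++ n'' = z)
    (e1 : (n ++ deg n' :: w1) ++ w2 = n ++ deg n' :: n'') (e0 : w1 ++ w2 = n'')
    (e2 : z' ++ w2 = z) (e3 : n ++ n' ++ w1 = z') X Y Z
    (f : G (n ++ deg n' :: w1) Y Z) (g : G w2 X Y),
  wh e (sc e1 f g) = sc e2 (wh e3 f) g.
Hypothesis sc_ul : forall z (e : [::] ++ z = z) X Y (f : G z X Y), sc e (uu Y) f = f.
Hypothesis sc_ur : forall z (e : z ++ [::] = z) X Y (f : G z X Y), sc e f (uu X) = f.

Lemma ic_id (M : int -> Ob) n X i (e : i = i) (x : G n X (M i)) : ic e x = x.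
Proof. by rewrite (Prop_irrelevance e erefl). Qed.

Lemma ic_ic (M : int -> Ob) n X i j k (e : i = j) (e' : j = k) (x : G n X (M i)) :
  ic e' (ic e x) = ic (etrans e e') x.
Proof. by case: k / e'; case: j / e. Qed.

Lemma ic_irr (M : int -> Ob) n X i j (e e' : i = j) (x : G n X (M i)) : ic e x = ic e' x.
Proof. by rewrite (Prop_irrelevance e e'). Qed.

Lemma ic_lin (M : int -> Ob) n X i j (e : i = j) : linear (@ic M n X i j e).
Proof. by case: j / e. Qed.

Lemma sc_ic (M : int -> Ob) n n' z (h : n ++ n' = z) X Y i j (e : i = j)
    (f : G n Y (M i)) (g : G n' X Y) : sc h (ic e f) g = ic e (sc h f g).
Proof. by case: j / e. Qed.

Lemma wh_ic (M : int -> Ob) n n' n'' z (h : n ++ n' ++ n'' = z) X i j (e : i = j)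
    (f : G (n ++ deg n' :: n'') X (M i)) : wh h (ic e f) = ic e (wh h f).
Proof. by case: j / e. Qed.

Section Families.
Variables (d : seq int -> int -> int) (M M' : int -> Ob).
Variable f : forall n l, G n (M l) (M' (d n l)).

Lemma sc_ic_r n n' z (h : n ++ n' = z) X i j (e : i = j) (g : G n' X (M i)) :
  sc h (f n j) (ic e g) = ic (f_equal (d n) e) (sc h (f n i) g).
Proof. by case: j / e. Qed.

End Families.

Definition tt_deg z l : int := sumz z + l + (1 - (size z)%:Z).

Lemma tt_adegl u z' z l : u ++ z' = z -> adeg u (tt_deg z' l) = tt_deg z l.
Proof. by move=> <-; rewrite /adeg /tt_deg !degE; lia. Qed.

Lemma tt_adegr y w z l : y ++ w = z -> tt_deg y (adeg w l) = tt_deg z l.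
Proof. by move=> <-; rewrite /adeg /tt_deg !degE; lia. Qed.

Section Relation.
Variables (s1 : seq int -> seq int -> K) (s2 : seq int -> seq int -> seq int -> K).
Hypothesis Hs1 : forall m m', ~~ odd (size m) -> odd (size m') -> s1 m m' = 1.
Hypothesis Hs2l : forall u n1 n' n'', ~~ odd (size u) ->
  s2 (u ++ n1) n' n'' = (if odd (size n') then sg (sumz u) else 1) * s2 n1 n' n''.
Hypothesis Hs2r : forall n n' w1 w2, ~~ odd (size w2) ->
  s2 n n' (w1 ++ w2) = s2 n n' w1.

Definition fam (d : seq int -> int -> int) (M M' : int -> Ob) :=
  forall n l, G n (M l) (M' (d n l)).

Definition lhs1 (M1 M2 : int -> Ob) (pi1 : fam mdeg M1 M1) (alpha : fam adeg M1 M2) z l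
    : G z (M1 l) (M2 (tt_deg z l)) :=
  sum2 (fun m m' (e : m ++ m' = z) =>
    s1 m m' *: ic (adeg_mdeg l e) (sc e (alpha m (mdeg m' l)) (pi1 m' l))).

Definition lhs2 (M1 M2 : int -> Ob) (alpha : fam adeg M1 M2) z l
    : G z (M1 l) (M2 (tt_deg z l)) :=
  sum3 (fun n n' n'' (e : n ++ n' ++ n'' = z) =>
    s2 n n' n'' *: ic (adeg_split3 l e) (wh e (alpha (n ++ deg n' :: n'') l))).

Definition rhs (M1 M2 : int -> Ob) (pi2 : fam mdeg M2 M2) (alpha : fam adeg M1 M2) z l
    : G z (M1 l) (M2 (tt_deg z l)) :=
  sum2 (fun p p' (e : p ++ p' = z) =>
    ic (mdeg_adeg l e) (sc e (pi2 p (adeg p' l)) (alpha p' l))).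

Definition fcomp (M1 M2 M3 : int -> Ob) (beta : fam adeg M2 M3) (alpha : fam adeg M1 M2)
    : fam adeg M1 M3 := fun z l =>
  sum2 (fun n n' (e : n ++ n' = z) =>
    ic (adeg_adeg l e) (sc e (beta n (adeg n' l)) (alpha n' l))).

Definition fid (M : int -> Ob) : fam adeg M M := fun n l =>
  match n with
  | [::] => ic (adeg_nil l) (uu (M l))
  | _ :: _ => 0
  end.

Definition is_odd (M1 M2 : int -> Ob) (alpha : fam adeg M1 M2) : Prop :=
  forall n l, odd (size n) -> alpha n l = 0.
Definition is_even (M1 : int -> Ob) (pi1 : fam mdeg M1 M1) : Prop :=
  forall n l, ~~ odd (size n) -> pi1 n l = 0.

Lemma sc0l n n' z (e : n ++ n' = z) X Y Z (g : G n' X Y) : sc e (0 : G n Y Z) g = 0.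
Proof. exact: (lin0 (sc_linl e g)). Qed.
Lemma sc0r n n' z (e : n ++ n' = z) X Y Z (f : G n Y Z) : sc e f (0 : G n' X Y) = 0.
Proof. exact: (lin0 (sc_linr e f)). Qed.
Lemma ic0 (M : int -> Ob) n X i j (e : i = j) : ic e (0 : G n X (M i)) = 0.
Proof. exact: (lin0 (ic_lin e)). Qed.
Lemma wh0 n n' n'' z (e : n ++ n' ++ n'' = z) X Z :
  wh e (0 : G (n ++ deg n' :: n'') X Z) = 0.
Proof. exact: (lin0 (wh_lin (Z := Z) e)). Qed.

Lemma fcompA (M1 M2 M3 M4 : int -> Ob) (gamma : fam adeg M3 M4)
    (beta : fam adeg M2 M3) (alpha : fam adeg M1 M2) z l :
  fcomp gamma (fcomp beta alpha) z l = fcomp (fcomp gamma beta) alpha z l.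
Proof.
have h u v w : u ++ v ++ w = z -> adeg u (adeg v (adeg w l)) = adeg z l.
  by move=> <-; rewrite /adeg !degE; lia.
pose t u v w (e : u ++ v ++ w = z) :=
  ic (h u v w e) (sc e (gamma u (adeg v (adeg w l)))
                    (sc erefl (beta v (adeg w l)) (alpha w l))).
have p1 y w u v : y ++ w = z -> u ++ v = y -> u ++ v ++ w = z by move=> <- <-; rewrite catA.
have p2 y w u v : u ++ y = z -> v ++ w = y -> u ++ v ++ w = z by move=> <- <-.
have := sum2_assoc t p1 p2; rewrite /t => E.
transitivity (sum2 (fun u y e => sum2 (fun v w e' => t u v w (p2 y w u v e e')))).
  apply: eq_sum2 => u y e; rewrite (lin_sum2 (sc_linr _ _)) (lin_sum2 (ic_lin _)).
  apply: eq_sum2 => v w e'; case: y / e' e => e.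
  rewrite /t sc_ic_r ic_ic (Prop_irrelevance (p2 _ _ _ _ _ _) e).
  exact: ic_irr.
rewrite -E; apply: eq_sum2 => y w e; rewrite (lin_sum2 (sc_linl _ _)) (lin_sum2 (ic_lin _)).
apply: eq_sum2 => u v e'.
rewrite sc_ic ic_ic (scA _ _ (p1 y w u v e e') erefl).
exact: ic_irr.
Qed.

Lemma fcomp1f (M1 M2 : int -> Ob) (alpha : fam adeg M1 M2) z l :
  fcomp (@fid M2) alpha z l = alpha z l.
Proof.
rewrite /fcomp; case: z => [|x z].
  by rewrite sum2_nil /= sc_ic sc_ul ic_ic ic_id.
rewrite sum2_cons /= sc_ic sc_ul ic_ic ic_id sum2_0 ?addr0 //.
by move=> m m' e; rewrite sc0l ic0.
Qed.

Lemma sum2_last (V : zmodType) z (t : forall m m' : seq int, m ++ m' = z -> V) :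
  (forall m x m' e, t m (x :: m') e = 0) -> sum2 t = t z [::] (cats0 z).
Proof.
elim: z t => [|x z IH] t t0.
  by rewrite sum2_nil; congr t; apply: Prop_irrelevance.
rewrite sum2_cons t0 add0r IH; last by move=> *; apply: t0.
by congr t; apply: Prop_irrelevance.
Qed.

Lemma fcompf1 (M1 M2 : int -> Ob) (alpha : fam adeg M1 M2) z l :
  fcomp alpha (@fid M1) z l = alpha z l.
Proof.
rewrite /fcomp sum2_last; last by move=> m x m' e; rewrite sc0r ic0.
by rewrite /= sc_ic_r sc_ur ic_ic ic_id.
Qed.

Lemma fid_odd (M : int -> Ob) : is_odd (@fid M).
Proof. by case. Qed.

Lemma fcomp_odd (M1 M2 M3 : int -> Ob) (beta : fam adeg M2 M3) (alpha : fam adeg M1 M2) :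
  is_odd beta -> is_odd alpha -> is_odd (fcomp beta alpha).
Proof.
move=> ob oa n l on; apply: sum2_0 => m m' e.
have: odd (size (m ++ m')) by rewrite e.
rewrite size_cat oddD; case: (boolP (odd (size m))) => om on'.
  by rewrite ob // sc0l ic0.
by rewrite oa // sc0r ic0.
Qed.

Lemma fid_rel (M : int -> Ob) (pi1 : fam mdeg M M) z l :
  is_even pi1 -> lhs1 pi1 (@fid M) z l + lhs2 (@fid M) z l = rhs pi1 (@fid M) z l.
Proof.
move=> ev.
have -> : lhs2 (@fid M) z l = 0.
  apply: sum3_0 => n n' n'' e.
  have -> : @fid M (n ++ deg n' :: n'') l = 0 by case: n e.
  by rewrite wh0 ic0 scaler0.
rewrite addr0 /rhs sum2_last; last by move=> m x m' e; rewrite sc0r ic0.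
rewrite /= sc_ic_r sc_ur ic_ic /lhs1.
transitivity (sum2 (fun m m' (e : m ++ m' = z) =>
  ic (adeg_mdeg l e) (sc e (@fid M m (mdeg m' l)) (pi1 m' l)))).
  apply: eq_sum2 => -[|x m] m' e; last by rewrite /= sc0l ic0 scaler0.
  case: (boolP (odd (size m'))) => om; first by rewrite Hs1 // scale1r.
  by rewrite ev // sc0r ic0 scaler0.
case: z => [|x z].
  by rewrite sum2_nil /= sc_ic sc_ul ic_ic; apply: ic_irr.
rewrite sum2_cons /= sc_ic sc_ul ic_ic sum2_0 ?addr0; first exact: ic_irr.
by move=> m m' e; rewrite sc0l ic0.
Qed.

Section Closure.
Variables (M1 M2 M3 : int -> Ob).
Variables (pi1 : fam mdeg M1 M1) (pi2 : fam mdeg M2 M2) (pi3 : fam mdeg M3 M3).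
Variables (beta : fam adeg M2 M3) (alpha : fam adeg M1 M2).
Hypotheses (ev1 : is_even pi1) (ev2 : is_even pi2) (ev3 : is_even pi3).
Hypotheses (ob : is_odd beta) (oa : is_odd alpha).
Hypothesis rb : forall z l, lhs1 pi2 beta z l + lhs2 beta z l = rhs pi3 beta z l.
Hypothesis ra : forall z l, lhs1 pi1 alpha z l + lhs2 alpha z l = rhs pi2 alpha z l.

Let P u z' z l (e : u ++ z' = z) (x : G z' (M1 l) (M2 (tt_deg z' l)))
  : G z (M1 l) (M3 (tt_deg z l)) :=
  ic (tt_adegl l e) (sc e (beta u (tt_deg z' l)) x).
Let Q y w z l (e : y ++ w = z) (x : G y (M2 (adeg w l)) (M3 (tt_deg y (adeg w l))))
  : G z (M1 l) (M3 (tt_deg z l)) :=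
  ic (tt_adegr l e) (sc e x (alpha w l)).

Let P_lin u z' z l (e : u ++ z' = z) : linear (@P u z' z l e).
Proof. by move=> k x y; rewrite /P sc_linr ic_lin. Qed.
Let Q_lin y w z l (e : y ++ w = z) : linear (@Q y w z l e).
Proof. by move=> k x x'; rewrite /Q sc_linl ic_lin. Qed.

Let p1 (z y w u v : seq int) : y ++ w = z -> u ++ v = y -> u ++ v ++ w = z.
Proof. by move=> <- <-; rewrite catA. Qed.
Let p2 (z y w u v : seq int) : u ++ y = z -> v ++ w = y -> u ++ v ++ w = z.
Proof. by move=> <- <-. Qed.

Lemma lhs1_fcomp z l : lhs1 pi1 (fcomp beta alpha) z l =
  sum2 (fun u z' (e : u ++ z' = z) => P e
    (sum2 (fun v m' (e' : v ++ m' = z') => s1 (u ++ v) m' *: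
      ic (adeg_mdeg l e') (sc e' (alpha v (mdeg m' l)) (pi1 m' l))))).
Proof.
have h u v w : u ++ v ++ w = z -> adeg u (adeg v (mdeg w l)) = tt_deg z l.
  by move=> <-; rewrite /adeg /mdeg /tt_deg !degE; lia.
pose t u v w (e : u ++ v ++ w = z) := s1 (u ++ v) w *:
  ic (h u v w e) (sc e (beta u (adeg v (mdeg w l)))
                    (sc erefl (alpha v (mdeg w l)) (pi1 w l))).
transitivity (sum2 (fun y w e => sum2 (fun u v e' => t u v w (p1 e e')))).
  rewrite /lhs1 /fcomp; apply: eq_sum2 => y w e.
  rewrite (lin_sum2 (sc_linl _ _)) (lin_sum2 (ic_lin _)) sum2Z.
  apply: eq_sum2 => u v e'; rewrite /t (_ : s1 (u ++ v) w = s1 y w) ?e' //; congr (_ *: _).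
  rewrite sc_ic ic_ic (scA _ _ (p1 e e') erefl).
  exact: ic_irr.
rewrite (sum2_assoc t _ (@p2 z)); apply: eq_sum2 => u y e.
rewrite (lin_sum2 (P_lin _)); apply: eq_sum2 => v w e'.
rewrite (linZ (P_lin _)) /t /P; congr (_ *: _).
case: y / e' e => e; rewrite sc_ic_r ic_ic (Prop_irrelevance (p2 _ _) e).
exact: ic_irr.
Qed.

Lemma lhs2_fcomp z l : lhs2 (fcomp beta alpha) z l =
  sum2 (fun u z' (e : u ++ z' = z) => P e
    (sum3 (fun n1 n' n'' (e' : n1 ++ n' ++ n'' = z') => s2 (u ++ n1) n' n'' *:
      ic (adeg_split3 l e') (wh e' (alpha (n1 ++ deg n' :: n'') l)))))
  + sum2 (fun y w (e : y ++ w = z) => Q e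
    (sum3 (fun n n' w1 (e' : n ++ n' ++ w1 = y) => s2 n n' (w1 ++ w) *:
      ic (adeg_split3 (adeg w l) e') (wh e' (beta (n ++ deg n' :: w1) (adeg w l)))))).
Proof.
have q1 s (n n'' u n1 : seq int) : u ++ n1 = n -> u ++ n1 ++ s :: n'' = n ++ s :: n''.
  by move=> <-; rewrite catA.
have q2 s (n n'' w1 w2 : seq int) : w1 ++ w2 = n'' -> (n ++ s :: w1) ++ w2 = n ++ s :: n''.
  by move=> <-; rewrite -catA.
have hl u n1 n' n'' : u ++ n1 ++ n' ++ n'' = z ->
    adeg u (adeg (n1 ++ deg n' :: n'') l) = tt_deg z l.
  by move=> <-; rewrite /adeg /deg /tt_deg !degE /=; lia.
have hr n n' w1 w2 : n ++ n' ++ w1 ++ w2 = z ->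
    adeg (n ++ deg n' :: w1) (adeg w2 l) = tt_deg z l.
  by move=> <-; rewrite /adeg /deg /tt_deg !degE /=; lia.
have r4 n n' w1 w2 : n ++ n' ++ w1 ++ w2 = z -> (n ++ n' ++ w1) ++ w2 = z.
  by move=> <-; rewrite -!catA.
pose tl u n1 n' n'' (e : u ++ n1 ++ n' ++ n'' = z) := s2 (u ++ n1) n' n'' *:
  ic (hl _ _ _ _ e) (sc e (beta u (adeg (n1 ++ deg n' :: n'') l))
     (wh erefl (alpha (n1 ++ deg n' :: n'') l))).
pose tr n n' w1 w2 (e : n ++ n' ++ w1 ++ w2 = z) := s2 n n' (w1 ++ w2) *:
  ic (hr _ _ _ _ e) (sc (r4 _ _ _ _ e)
     (wh erefl (beta (n ++ deg n' :: w1) (adeg w2 l))) (alpha w2 l)).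
have a1 n n' n'' u n1 : n ++ n' ++ n'' = z -> u ++ n1 = n -> u ++ n1 ++ n' ++ n'' = z.
  by move=> <- <-; rewrite -!catA.
have a2 u z' n1 n' n'' : u ++ z' = z -> n1 ++ n' ++ n'' = z' -> u ++ n1 ++ n' ++ n'' = z.
  by move=> <- <-.
have b1 n n' n'' w1 w2 : n ++ n' ++ n'' = z -> w1 ++ w2 = n'' -> n ++ n' ++ w1 ++ w2 = z.
  by move=> <- <-.
have b2 y w2 n n' w1 : y ++ w2 = z -> n ++ n' ++ w1 = y -> n ++ n' ++ w1 ++ w2 = z.
  by move=> <- <-; rewrite -!catA.
transitivity (sum3 (fun n n' n'' (e : n ++ n' ++ n'' = z) =>
   sum2 (fun u n1 e' => tl u n1 n' n'' (a1 _ _ _ _ _ e e')) +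
   sum2 (fun w1 w2 e' => tr n n' w1 w2 (b1 _ _ _ _ _ e e')))).
  apply: eq_sum3 => n n' n'' e.
  rewrite /fcomp (sum2_insert _ (q1 (deg n') n n'') (q2 (deg n') n n'')).
  rewrite (linD (wh_lin e (Z := _))) (linD (ic_lin _)) scalerDr.
  rewrite !(lin_sum2 (wh_lin e (Z := _))) !(lin_sum2 (ic_lin _)) !sum2Z.
  congr (_ + _).
    apply: eq_sum2 => u n1 e'; rewrite /tl (_ : s2 (u ++ n1) n' n'' = s2 n n' n'') ?e' //; congr (_ *: _).
    rewrite wh_ic ic_ic (wh_scl e _ e' (a1 _ _ _ _ _ e e') erefl).
    exact: ic_irr.
  apply: eq_sum2 => w1 w2 e'; rewrite /tr (_ : s2 n n' (w1 ++ w2) = s2 n n' n'') ?e' //; congr (_ *: _).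
  rewrite wh_ic ic_ic (wh_scr e _ e' (r4 _ _ _ _ (b1 _ _ _ _ _ e e')) erefl).
  exact: ic_irr.
rewrite sum3D (sum3_left tl _ a2) (sum3_right tr _ b2); congr (_ + _).
  apply: eq_sum2 => u z' e; rewrite (lin_sum3 (P_lin _)).
  apply: eq_sum3 => n1 n' n'' e'; rewrite (linZ (P_lin _)) /tl /P; congr (_ *: _).
  case: z' / e' e => e; rewrite sc_ic_r ic_ic (Prop_irrelevance (a2 _ _ _ _ _ _ _) e).
  exact: ic_irr.
apply: eq_sum2 => y w e; rewrite (lin_sum3 (Q_lin _)).
apply: eq_sum3 => n n' w1 e'; rewrite (linZ (Q_lin _)) /tr /Q; congr (_ *: _).
case: y / e' e => e; rewrite sc_ic ic_ic (Prop_irrelevance (r4 _ _ _ _ _) e).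
exact: ic_irr.
Qed.

Lemma left_part u z' z l (e : u ++ z' = z) :
  P e (sum2 (fun v m' (e' : v ++ m' = z') => s1 (u ++ v) m' *:
      ic (adeg_mdeg l e') (sc e' (alpha v (mdeg m' l)) (pi1 m' l))))
  + P e (sum3 (fun n1 n' n'' (e' : n1 ++ n' ++ n'' = z') => s2 (u ++ n1) n' n'' *:
      ic (adeg_split3 l e') (wh e' (alpha (n1 ++ deg n' :: n'') l))))
  = P e (rhs pi2 alpha z' l).
Proof.
case: (boolP (odd (size u))) => ou.
  by rewrite /P ob // !sc0l !ic0 addr0.
rewrite -(linD (P_lin _)); congr P.
pose c : K := if odd (size z').+1 then sg (sumz u) else 1.
have -> : sum2 (fun v m' (e' : v ++ m' = z') => s1 (u ++ v) m' *:
      ic (adeg_mdeg l e') (sc e' (alpha v (mdeg m' l)) (pi1 m' l)))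
    = c *: lhs1 pi1 alpha z' l.
  rewrite /lhs1 sum2Z.
  apply: eq_sum2 => v m' e'.
  case: (boolP (odd (size v))) => ov; first by rewrite oa // sc0l ic0 !scaler0.
  case: (boolP (odd (size m'))) => om; last by rewrite ev1 // sc0r ic0 !scaler0.
  have -> : c = 1 by rewrite /c -e' size_cat /= oddD (negbTE ov) om.
  by rewrite !Hs1 ?scale1r // size_cat oddD (negbTE ov) (negbTE ou).
have -> : sum3 (fun n1 n' n'' (e' : n1 ++ n' ++ n'' = z') => s2 (u ++ n1) n' n'' *:
      ic (adeg_split3 l e') (wh e' (alpha (n1 ++ deg n' :: n'') l)))
    = c *: lhs2 alpha z' l.
  rewrite /lhs2 sum3Z; apply: eq_sum3 => n1 n' n'' e'.
  rewrite Hs2l // -scalerA.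
  case: (boolP (odd (size (n1 ++ deg n' :: n'')))) => os.
    by rewrite oa // wh0 ic0 !scaler0.
  congr (_ *: _).
  have -> : odd (size n') = odd (size z').+1; last by [].
  rewrite -e' !size_cat /= !oddD.
  move: os; rewrite size_cat /= oddD /=.
  by case: (odd (size n1)); case: (odd (size n'')); case: (odd (size n')).
rewrite -scalerDr ra /rhs sum2Z.
apply: eq_sum2 => p p' e'.
case: (boolP (odd (size p'))) => op'; first by rewrite oa // sc0r ic0 scaler0.
case: (boolP (odd (size p))) => op; last by rewrite ev2 // sc0l ic0 scaler0.
have -> : c = 1 by rewrite /c -e' size_cat /= oddD op (negbTE op').
by rewrite scale1r.
Qed.

Lemma middle_part z l :
  sum2 (fun u z' (e : u ++ z' = z) => P e (rhs pi2 alpha z' l)) =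
  sum2 (fun y w (e : y ++ w = z) => Q e (lhs1 pi2 beta y (adeg w l))).
Proof.
have h u v w : u ++ v ++ w = z -> adeg u (mdeg v (adeg w l)) = tt_deg z l.
  by move=> <-; rewrite /adeg /mdeg /tt_deg !degE; lia.
pose t u v w (e : u ++ v ++ w = z) :=
  ic (h u v w e) (sc e (beta u (mdeg v (adeg w l)))
                    (sc erefl (pi2 v (adeg w l)) (alpha w l))).
transitivity (sum2 (fun u y e => sum2 (fun v w e' => t u v w (@p2 z y w u v e e')))).
  apply: eq_sum2 => u y e; rewrite (lin_sum2 (P_lin _)).
  apply: eq_sum2 => v w e'; rewrite /t /P; case: y / e' e => e.
  rewrite sc_ic_r ic_ic (Prop_irrelevance (p2 _ _) e).
  exact: ic_irr.
rewrite -(sum2_assoc t (@p1 z)); apply: eq_sum2 => y w e.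
rewrite (lin_sum2 (Q_lin _)); apply: eq_sum2 => u v e'.
transitivity (Q e (ic (adeg_mdeg (adeg w l) e')
    (sc e' (beta u (mdeg v (adeg w l))) (pi2 v (adeg w l))))).
  rewrite /t /Q sc_ic ic_ic (scA _ _ (p1 e e') erefl).
  exact: ic_irr.
congr Q.
case: (boolP (odd (size u))) => ou; first by rewrite ob // sc0l ic0 scaler0.
case: (boolP (odd (size v))) => ov; last by rewrite ev2 // sc0r ic0 scaler0.
by rewrite Hs1 // scale1r.
Qed.

Lemma right_part y w z l (e : y ++ w = z) :
  Q e (lhs1 pi2 beta y (adeg w l))
  + Q e (sum3 (fun n n' w1 (e' : n ++ n' ++ w1 = y) => s2 n n' (w1 ++ w) *:
      ic (adeg_split3 (adeg w l) e') (wh e' (beta (n ++ deg n' :: w1) (adeg w l)))))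
  = Q e (rhs pi3 beta y (adeg w l)).
Proof.
case: (boolP (odd (size w))) => ow.
  by rewrite /Q oa // !sc0r !ic0 addr0.
rewrite -(linD (Q_lin _)) -rb; congr (Q _ (_ + _)).
by apply: eq_sum3 => n n' w1 e'; rewrite Hs2r.
Qed.

Lemma rhs_fcomp z l :
  sum2 (fun y w (e : y ++ w = z) => Q e (rhs pi3 beta y (adeg w l))) =
  rhs pi3 (fcomp beta alpha) z l.
Proof.
have h u v w : u ++ v ++ w = z -> mdeg u (adeg v (adeg w l)) = tt_deg z l.
  by move=> <-; rewrite /adeg /mdeg /tt_deg !degE; lia.
pose t u v w (e : u ++ v ++ w = z) :=
  ic (h u v w e) (sc e (pi3 u (adeg v (adeg w l)))
                    (sc erefl (beta v (adeg w l)) (alpha w l))).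
transitivity (sum2 (fun u y e => sum2 (fun v w e' => t u v w (@p2 z y w u v e e')))).
  rewrite -(sum2_assoc t (@p1 z)); apply: eq_sum2 => y w e.
  rewrite (lin_sum2 (Q_lin _)); apply: eq_sum2 => u v e'.
  rewrite /t /Q sc_ic ic_ic (scA _ _ (p1 e e') erefl).
  exact: ic_irr.
apply: eq_sum2 => u y e; rewrite (lin_sum2 (sc_linr _ _)) (lin_sum2 (ic_lin _)).
apply: eq_sum2 => v w e'; case: y / e' e => e.
rewrite /t sc_ic_r ic_ic (Prop_irrelevance (p2 _ _) e).
exact: ic_irr.
Qed.

Lemma fcomp_rel z l :
  lhs1 pi1 (fcomp beta alpha) z l + lhs2 (fcomp beta alpha) z l
  = rhs pi3 (fcomp beta alpha) z l.
Proof.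
rewrite lhs1_fcomp lhs2_fcomp addrA -sum2D.
rewrite (eq_sum2 (fun u z' e => @left_part u z' z l e)) middle_part -sum2D.
by rewrite (eq_sum2 (fun y w e => @right_part y w z l e)) rhs_fcomp.
Qed.

End Closure.
End Relation.
End Composition.

Section Signs.
Variable K : fieldType.

Lemma sgD (a b : int) : sg (a + b) = sg a * sg b :> K.
Proof. by rewrite /sg expfzDr // oppr_eq0 oner_eq0. Qed.

Lemma sg_nat (a : nat) : sg a%:Z = (if odd a then -1 else 1) :> K.
Proof. by rewrite /sg -exprnP -signr_odd; case: (odd a). Qed.

Lemma sg_natM (a : nat) (x : int) : sg (a%:Z * x) = (if odd a then sg x else 1) :> K.
Proof. by rewrite /sg -exprz_exp -/(sg a%:Z) sg_nat; case: (odd a); rewrite ?exp1rz. Qed.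

End Signs.

Section Idto.
Variables (K : fieldType) (C : lincat K).
Implicit Types X Y Z : C.

Lemma idto_irr X Y (e e' : X = Y) : idto e = idto e'.
Proof. by rewrite (Prop_irrelevance e e'). Qed.

Lemma idto_id X (e : X = X) : idto e = idm X.
Proof. by rewrite (Prop_irrelevance e erefl). Qed.

Lemma idto_comp X Y Z (e : X = Y) (e' : Y = Z) : idto e' ∘ idto e = idto (etrans e e').
Proof. by case: Z / e'; rewrite comp1m. Qed.

Lemma fmap_idto (F : lfunctor C) X Y (e : X = Y) (e' : F X = F Y) :
  fmap F (idto e) = idto e'.
Proof. by case: Y / e e' => e'; rewrite fmap1 idto_id. Qed.

Lemma nat_idto (a b : C -> C) (t : forall X, hom (a X) (b X)) X Y (e : X = Y)
    (ea : a X = a Y) (eb : b X = b Y) : t Y ∘ idto ea = idto eb ∘ t X.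
Proof. by case: Y / e ea eb => ea eb; rewrite !idto_id compm1 comp1m. Qed.

Variable U : int -> lfunctor C.

Lemma seqmap1 n X : seqmap U n (idm X) = idm (seqob U n X).
Proof. exact: (fmap1 (seqfun U n)). Qed.

Lemma seqmapM n X Y Z (g : hom Y Z) (f : hom X Y) :
  seqmap U n (g ∘ f) = seqmap U n g ∘ seqmap U n f.
Proof. exact: (fmapM (seqfun U n)). Qed.

Lemma seqmap_lin n X Y : linear (@seqmap K C U n X Y).
Proof. exact: (fmap_lin (seqfun U n)). Qed.

Lemma seqmap_idto n X Y (e : X = Y) (e' : seqob U n X = seqob U n Y) :
  seqmap U n (idto e) = idto e'.
Proof. exact: (@fmap_idto (seqfun U n)). Qed.

Lemma seqmap_cat n n' m (e : n ++ n' = m) X Y (f : hom X Y) eX eY :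
  idto (Y := seqob U n (seqob U n' Y)) eY ∘ seqmap U m f
  = seqmap U n (seqmap U n' f) ∘ idto (X := seqob U m X) eX.
Proof.
case: m / e eX eY; elim: n => [|a n IH] /= eX eY; first by rewrite !idto_id comp1m compm1.
have e Z : seqob U (n ++ n') Z = seqob U n (seqob U n' Z) by apply: seqob_cat.
by rewrite -(fmap_idto (F := U a) (e Y)) -(fmap_idto (F := U a) (e X)) -!fmapM IH.
Qed.

Lemma seqmap_cat' n n' m (e : n ++ n' = m) X Y (f : hom X Y) eX eY :
  seqmap U m f ∘ idto (X := seqob U n (seqob U n' X)) eX
  = idto (Y := seqob U m Y) eY ∘ seqmap U n (seqmap U n' f).
Proof.
have := seqmap_cat e f (esym eX) (esym eY) => E.
have: idto eY ∘ (idto (esym eY) ∘ seqmap U m f) ∘ idto eX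
    = idto eY ∘ (seqmap U n (seqmap U n' f) ∘ idto (esym eX)) ∘ idto eX by rewrite E.
by rewrite !compA -(compA _ (idto (esym eX))) !idto_comp !idto_id comp1m compm1.
Qed.

End Idto.

Section ModuleSystem.
Variables (K : fieldType) (C : lincat K) (U : int -> lfunctor C).
Variable theta : forall n, nat_trans (seqfun U n) (U (deg n)).

Let G (n : seq int) (X Y : C) : lmodType K := hom (seqob U n X) Y.
Let wh n n' n'' z (e : n ++ n' ++ n'' = z) X Z (f : G (n ++ deg n' :: n'') X Z) : G z X Z :=
  f ∘ whisker theta e X.

Lemma scomp_linl n n' z (e : n ++ n' = z) X Y Z (g : hom (seqob U n' X) Y) :
  linear (fun f : hom (seqob U n Y) Z => scomp e f g).
Proof. by move=> k f f'; rewrite /scomp !comp_linl. Qed.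

Lemma scomp_linr n n' z (e : n ++ n' = z) X Y Z (f : hom (seqob U n Y) Z) :
  linear (fun g : hom (seqob U n' X) Y => scomp e f g).
Proof. by move=> k g g'; rewrite /scomp seqmap_lin comp_linr comp_linl. Qed.

Lemma scompA n1 n2 n3 m w z (e1 : n1 ++ n2 = m) (e2 : m ++ n3 = z)
    (e3 : n1 ++ w = z) (e4 : n2 ++ n3 = w) X Y Z T
    (f : hom (seqob U n1 Z) T) (g : hom (seqob U n2 Y) Z) (h : hom (seqob U n3 X) Y) :
  scomp e2 (scomp e1 f g) h = scomp e3 f (scomp e4 g h).
Proof.
rewrite /scomp !seqmapM.
have eX : seqob U m (seqob U n3 X) = seqob U n1 (seqob U n2 (seqob U n3 X)).
  exact: seqob_split.
rewrite -!compA; congr (_ ∘ (_ ∘ _)).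
rewrite compA (seqmap_cat e1 h eX) -!compA; congr (_ ∘ _).
have eW : seqob U n1 (seqob U w X) = seqob U n1 (seqob U n2 (seqob U n3 X)).
  by congr seqob; apply: seqob_split.
by rewrite (seqmap_idto (U := U) _ eW) !idto_comp; apply: idto_irr.
Qed.

Lemma whisker_nat n n' n'' z (e : n ++ n' ++ n'' = z) X Y (g : hom X Y) :
  whisker theta e Y ∘ seqmap U z g = seqmap U (n ++ deg n' :: n'') g ∘ whisker theta e X.
Proof.
rewrite /whisker !compA.
rewrite (seqmap_cat' erefl g _ (esym (seqob_cat U n (deg n' :: n'') Y))).
rewrite -!compA; congr (_ ∘ _).
have e' Z : seqob U z Z = seqob U n (seqob U (n' ++ n'') Z) by exact: seqob_split.
have e'' Z : seqob U n (seqob U (n' ++ n'') Z) = seqob U n (seqob U n' (seqob U n'' Z)).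
  by rewrite seqob_cat.
have eE Z : idto (seqob_split3 U e Z) = idto (e'' Z) ∘ idto (e' Z).
  by rewrite idto_comp; apply: idto_irr.
rewrite !eE -(compA _ _ (seqmap U z g)) (seqmap_cat e g (e' X)) !compA.
have e1 Z : seqob U (n' ++ n'') Z = seqob U n' (seqob U n'' Z) by exact: seqob_cat.
rewrite -!(seqmap_idto (U := U) (e1 _)) -!seqmapM -!compA.
congr (seqmap U n _ ∘ _).
rewrite (seqmap_cat erefl g (e1 X)) !compA; congr (_ ∘ _).
exact: (nnat (theta n') (seqmap U n'' g)).
Qed.

Lemma whisker_catl u n1 n n' n'' z z' (e : n ++ n' ++ n'' = z) (e0 : u ++ n1 = n)
    (e3 : n1 ++ n' ++ n'' = z') X
    (eX : seqob U (n ++ deg n' :: n'') X = seqob U u (seqob U (n1 ++ deg n' :: n'') X))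
    (eX' : seqob U z X = seqob U u (seqob U z' X)) :
  idto eX ∘ whisker theta e X = seqmap U u (whisker theta e3 X) ∘ idto eX'.
Proof.
rewrite /whisker !seqmapM !compA idto_comp.
have h Y : seqob U n Y = seqob U u (seqob U n1 Y) by exact: seqob_split.
have -> : idto (etrans (esym (seqob_cat U n (deg n' :: n'') X)) eX) =
    idto (f_equal (seqob U u) (esym (seqob_cat U n1 (deg n' :: n'') X)))
      ∘ idto (h (U (deg n') (seqob U n'' X))).
  by rewrite idto_comp; apply: idto_irr.
rewrite -!compA; congr (_ ∘ _); first by symmetry; apply: seqmap_idto.
rewrite compA (seqmap_cat e0 _ (h _)) -compA.
congr (_ ∘ _).
rewrite (seqmap_idto (U := U) _ (f_equal (seqob U u) (seqob_split3 U e3 X))) !idto_comp.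
exact: idto_irr.
Qed.

Lemma whisker_catr n n' n'' w1 w2 z z' (e : n ++ n' ++ n'' = z) (e0 : w1 ++ w2 = n'')
    (e3 : n ++ n' ++ w1 = z') X
    (eX : seqob U (n ++ deg n' :: n'') X = seqob U (n ++ deg n' :: w1) (seqob U w2 X))
    (eX' : seqob U z X = seqob U z' (seqob U w2 X)) :
  idto eX ∘ whisker theta e X = whisker theta e3 (seqob U w2 X) ∘ idto eX'.
Proof.
have h : seqob U n'' X = seqob U w1 (seqob U w2 X) by exact: seqob_split.
rewrite /whisker !compA idto_comp.
have -> : idto (etrans (esym (seqob_cat U n (deg n' :: n'') X)) eX) =
    idto (esym (seqob_cat U n (deg n' :: w1) (seqob U w2 X)))
      ∘ idto (f_equal (fun Y => seqob U n (U (deg n') Y)) h).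
  by rewrite idto_comp; apply: idto_irr.
rewrite -!compA; congr (_ ∘ _); rewrite compA.
rewrite -(@nat_idto K C (fun Y => seqob U n (seqob U n' Y))
  (fun Y => seqob U n (U (deg n') Y)) (fun Y => seqmap U n (theta n' Y)) _ _ h
  (f_equal (fun Y => seqob U n (seqob U n' Y)) h)).
by rewrite -!compA !idto_comp; congr (_ ∘ _); apply: idto_irr.
Qed.

Lemma wh_scompl u n1 n n' n'' z z' (e : n ++ n' ++ n'' = z)
    (e1 : u ++ (n1 ++ deg n' :: n'') = n ++ deg n' :: n'') (e0 : u ++ n1 = n)
    (e2 : u ++ z' = z) (e3 : n1 ++ n' ++ n'' = z') X Y Z
    (f : hom (seqob U u Y) Z) (g : hom (seqob U (n1 ++ deg n' :: n'') X) Y) :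
  scomp e1 f g ∘ whisker theta e X = scomp e2 f (g ∘ whisker theta e3 X).
Proof.
rewrite /scomp -!compA (whisker_catl e e0 e3 _ (seqob_split U e2 X)).
by rewrite seqmapM -!compA.
Qed.

Lemma wh_scompr n n' n'' w1 w2 z z' (e : n ++ n' ++ n'' = z)
    (e1 : (n ++ deg n' :: w1) ++ w2 = n ++ deg n' :: n'') (e0 : w1 ++ w2 = n'')
    (e2 : z' ++ w2 = z) (e3 : n ++ n' ++ w1 = z') X Y Z
    (f : hom (seqob U (n ++ deg n' :: w1) Y) Z) (g : hom (seqob U w2 X) Y) :
  scomp e1 f g ∘ whisker theta e X = scomp e2 (f ∘ whisker theta e3 Y) g.
Proof.
rewrite /scomp -[LHS]compA (whisker_catr e e0 e3 _ (seqob_split U e2 X)) [LHS]compA.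
by congr (_ ∘ _); rewrite -[LHS]compA -[RHS]compA whisker_nat.
Qed.

Lemma scomp_ul z (e : [::] ++ z = z) X Y (f : hom (seqob U z X) Y) :
  @scomp K C U [::] z z e X Y Y (idm Y) f = f.
Proof. by rewrite /scomp /= idto_id comp1m compm1. Qed.

Lemma scomp_ur z (e : z ++ [::] = z) X Y (f : hom (seqob U z X) Y) :
  @scomp K C U z [::] z e X X Y f (idm X) = f.
Proof. by rewrite /scomp /= idto_id seqmap1 !compm1. Qed.

Lemma icE (M : int -> C) n X i j (e : i = j) (x : hom (seqob U n X) (M i)) :
  icast M e ∘ x = ic (G := G) e x.
Proof. by case: j / e; rewrite /icast idto_id comp1m. Qed.

Let sc n n' z (e : n ++ n' = z) X Y Z (f : G n Y Z) (g : G n' X Y) : G z X Z :=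
  scomp e f g.
Let uu X : G [::] X X := idm X.

Lemma wh_linear n n' n'' z (e : n ++ n' ++ n'' = z) X Z :
  linear (fun f : G (n ++ deg n' :: n'') X Z => wh e f).
Proof. exact: comp_linl. Qed.

Definition msign1 (m m' : seq int) : K :=
  sg ((size m)%:Z + (size m').+1%:Z * sumz m).
Definition msign2 (n n' n'' : seq int) : K :=
  sg ((size n)%:Z + (size n')%:Z * (size n'').+1%:Z + (size n')%:Z * sumz n).

Lemma msign1E m m' : ~~ odd (size m) -> odd (size m') -> msign1 m m' = 1.
Proof. by move=> om om'; rewrite /msign1 sgD sg_nat sg_natM /= om' (negbTE om) mulr1. Qed.

Lemma msign2l u n1 n' n'' : ~~ odd (size u) ->
  msign2 (u ++ n1) n' n'' = (if odd (size n') then sg (sumz u) else 1) * msign2 n1 n' n''.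
Proof.
move=> ou; rewrite /msign2 size_cat sumz_cat PoszD mulrDr.
have -> : (size u)%:Z + (size n1)%:Z + (size n')%:Z * (size n'').+1%:Z
    + ((size n')%:Z * sumz u + (size n')%:Z * sumz n1)
  = (size u)%:Z + ((size n')%:Z * sumz u + ((size n1)%:Z
      + (size n')%:Z * (size n'').+1%:Z + (size n')%:Z * sumz n1)) by lia.
by rewrite [LHS]sgD sg_nat (negbTE ou) mul1r [LHS]sgD sg_natM.
Qed.

Lemma msign2r n n' w1 w2 : ~~ odd (size w2) -> msign2 n n' (w1 ++ w2) = msign2 n n' w1.
Proof.
move=> ow; rewrite /msign2 size_cat.
have -> : (size n)%:Z + (size n')%:Z * (size w1 + size w2).+1%:Z + (size n')%:Z * sumz n
  = (size w2)%:Z * (size n')%:Z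
    + ((size n)%:Z + (size n')%:Z * (size w1).+1%:Z + (size n')%:Z * sumz n) by lia.
by rewrite [LHS]sgD sg_natM (negbTE ow) mul1r.
Qed.

Lemma inf_morphismE (M1 M2 : even_module theta)
    (alpha : forall n l, hom (seqob U n (M1 l)) (M2 (adeg n l))) :
  inf_morphism alpha <-> forall z l,
    lhs1 (@sc) msign1 (mact M1 : fam G mdeg M1 M1) (alpha : fam G adeg M1 M2) z l
    + lhs2 (@wh) msign2 (alpha : fam G adeg M1 M2) z l
    = rhs (@sc) (mact M2 : fam G mdeg M2 M2) (alpha : fam G adeg M1 M2) z l.
Proof.
have E1 z l : lhs1 (@sc) msign1 (mact M1 : fam G mdeg M1 M1)
    (alpha : fam G adeg M1 M2) z l =
  sum2 (fun m m' (e : m ++ m' = z) =>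
      sg ((size m)%:Z + (size m').+1%:Z * sumz m) *:
        (icast M2 (adeg_mdeg l e) ∘ scomp e (alpha m (mdeg m' l)) (mact M1 m' l))).
  by apply: eq_sum2 => m m' e; rewrite icE.
have E2 z l : lhs2 (@wh) msign2 (alpha : fam G adeg M1 M2) z l =
  sum3 (fun n n' n'' (e : n ++ n' ++ n'' = z) =>
      sg ((size n)%:Z + (size n')%:Z * (size n'').+1%:Z + (size n')%:Z * sumz n) *:
        (icast M2 (adeg_split3 l e)
           ∘ alpha (n ++ deg n' :: n'') l ∘ whisker theta e (M1 l))).
  by apply: eq_sum3 => n n' n'' e; rewrite -compA icE.
have E3 z l : rhs (@sc) (mact M2 : fam G mdeg M2 M2) (alpha : fam G adeg M1 M2) z l =
  sum2 (fun p p' (e : p ++ p' = z) =>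
        icast M2 (mdeg_adeg l e) ∘ scomp e (mact M2 p (adeg p' l)) (alpha p' l)).
  by apply: eq_sum2 => m m' e; rewrite icE.
by split=> h z l; have := h z l; rewrite E1 E2 E3.
Qed.

Lemma inf_compE (M1 M2 M3 : even_module theta)
    (beta : forall n l, hom (seqob U n (M2 l)) (M3 (adeg n l)))
    (alpha : forall n l, hom (seqob U n (M1 l)) (M2 (adeg n l))) :
  inf_comp beta alpha = fcomp (@sc) (beta : fam G adeg M2 M3) (alpha : fam G adeg M1 M2).
Proof.
apply/functional_extensionality_dep => z; apply/functional_extensionality_dep => l.
by apply: eq_sum2 => m m' e; rewrite icE.
Qed.

Lemma inf_idE (M : even_module theta) : @inf_id _ _ _ _ M = fid (@uu) M.
Proof.
apply/functional_extensionality_dep => z; apply/functional_extensionality_dep => l; case: z => //=.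
by rewrite -icE compm1.
Qed.

Lemma mact_is_even (M : even_module theta) : is_even (mact M : fam G mdeg M M).
Proof. by move=> n l on; apply: mact_even. Qed.

Lemma imap_is_odd (M1 M2 : even_module theta) (f : odd_inf_morphism M1 M2) :
  is_odd (imap f : fam G adeg M1 M2).
Proof. by move=> n l on; apply: imap_odd; rewrite /= on. Qed.

Lemma eq_odd_inf (M1 M2 : even_module theta) (f g : odd_inf_morphism M1 M2) :
  imap f = imap g -> f = g.
Proof.
case: f g => [f f1 f2] [g g1 g2] /= E; move: f1 f2 g1 g2; rewrite E => f1 f2 g1 g2.
by rewrite (Prop_irrelevance f1 g1) (Prop_irrelevance f2 g2).
Qed.

Definition odd_inf_id (M : even_module theta) : odd_inf_morphism M M.
Proof.
apply: (@OddInfMorphism _ _ _ _ _ _ (@inf_id _ _ _ _ M)).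
- apply/inf_morphismE => z l; rewrite inf_idE; apply: fid_rel.
  + exact: scomp_linl.
  + exact: scomp_linr.
  + exact: wh_linear.
  + exact: scomp_ul.
  + exact: scomp_ur.
  + exact: msign1E.
  + exact: mact_is_even.
- by case.
Defined.

Definition odd_inf_comp (M1 M2 M3 : even_module theta)
  (g : odd_inf_morphism M2 M3) (f : odd_inf_morphism M1 M2) : odd_inf_morphism M1 M3.
Proof.
apply: (@OddInfMorphism _ _ _ _ _ _ (inf_comp g f)).
- apply/inf_morphismE => z l; rewrite inf_compE; apply: fcomp_rel.
  + exact: scomp_linl.
  + exact: scomp_linr.
  + exact: scompA.
  + exact: wh_linear.
  + exact: wh_scompl.
  + exact: wh_scompr.
  + exact: msign1E.
  + exact: msign2l.
  + exact: msign2r.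
  + exact: mact_is_even.
  + exact: mact_is_even.
  + exact: imap_is_odd.
  + exact: imap_is_odd.
  + by apply/inf_morphismE; apply: imap_rel.
  + by apply/inf_morphismE; apply: imap_rel.
- move=> n l /= /negPn on; rewrite inf_compE; apply: fcomp_odd => //.
  + exact: scomp_linl.
  + exact: scomp_linr.
  + exact: imap_is_odd.
  + exact: imap_is_odd.
Defined.

Definition EMeo_mod : category.
Proof.
refine (@Category (even_module theta) (@odd_inf_morphism K C U theta) odd_inf_id
  odd_inf_comp _ _ _).
- move=> X Y Z W h g f; apply: eq_odd_inf => /=; rewrite !inf_compE.
  apply/functional_extensionality_dep => z; apply/functional_extensionality_dep => l; apply: fcompA.
  + exact: scomp_linl.
  + exact: scomp_linr.
  + exact: scompA.
- move=> X Y f; apply: eq_odd_inf => /=; rewrite inf_compE inf_idE.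
  apply/functional_extensionality_dep => z; apply/functional_extensionality_dep => l; apply: fcomp1f.
  + exact: scomp_linl.
  + exact: scomp_ul.
- move=> X Y f; apply: eq_odd_inf => /=; rewrite inf_compE inf_idE.
  apply/functional_extensionality_dep => z; apply/functional_extensionality_dep => l; apply: fcompf1.
  + exact: scomp_linr.
  + exact: scomp_ur.
Defined.

Lemma eq_mod_hom (M M' : even_module theta) (f g : mod_hom M M') :
  mhom f = mhom g -> f = g.
Proof.
case: f g => [f f1] [g g1] /= E; move: f1 g1; rewrite E => f1 g1.
by rewrite (Prop_irrelevance f1 g1).
Qed.

Definition mod_id (M : even_module theta) : mod_hom M M.
Proof.
refine (@ModHom _ _ _ _ M M (fun l => idm (M l)) _).
by move=> n l; rewrite seqmap1 comp1m compm1.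
Defined.

Definition mod_comp (M1 M2 M3 : even_module theta)
  (g : mod_hom M2 M3) (f : mod_hom M1 M2) : mod_hom M1 M3.
Proof.
refine (@ModHom _ _ _ _ M1 M3 (fun l => g l ∘ f l) _).
by move=> n l; rewrite -compA mhom_act compA mhom_act seqmapM compA.
Defined.

Definition EMe_mod : category.
Proof.
refine (@Category (even_module theta) (@mod_hom K C U theta) mod_id mod_comp _ _ _).
- move=> X Y Z W h g f; apply: eq_mod_hom.
  by apply/functional_extensionality_dep => l /=; rewrite compA.
- move=> X Y f; apply: eq_mod_hom.
  by apply/functional_extensionality_dep => l /=; rewrite comp1m.
- move=> X Y f; apply: eq_mod_hom.
  by apply/functional_extensionality_dep => l /=; rewrite compm1.
Defined.

End ModuleSystem.

Section ComoduleSystem.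
Variables (K : fieldType) (C : lincat K) (V : int -> lfunctor C).
Variable delta : forall n, nat_trans (V (deg n)) (seqfun V n).

Let G (n : seq int) (X Y : C) : lmodType K := hom Y (seqob V n X).
Let wh n n' n'' z (e : n ++ n' ++ n'' = z) X Z (f : G (n ++ deg n' :: n'') X Z) : G z X Z :=
  cowhisker delta e X ∘ f.

Lemma sccomp_linl n n' z (e : n ++ n' = z) X Y Z (g : hom Y (seqob V n' X)) :
  linear (fun f : hom Z (seqob V n Y) => sccomp e f g).
Proof. by move=> k f f'; rewrite /sccomp !comp_linr. Qed.

Lemma sccomp_linr n n' z (e : n ++ n' = z) X Y Z (f : hom Z (seqob V n Y)) :
  linear (fun g : hom Y (seqob V n' X) => sccomp e f g).
Proof. by move=> k g g'; rewrite /sccomp seqmap_lin comp_linl comp_linr. Qed.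

Lemma sccompA n1 n2 n3 m w z (e1 : n1 ++ n2 = m) (e2 : m ++ n3 = z)
    (e3 : n1 ++ w = z) (e4 : n2 ++ n3 = w) X Y Z T
    (f : hom T (seqob V n1 Z)) (g : hom Z (seqob V n2 Y)) (h : hom Y (seqob V n3 X)) :
  sccomp e2 (sccomp e1 f g) h = sccomp e3 f (sccomp e4 g h).
Proof.
rewrite /sccomp !seqmapM.
have eX : seqob V m (seqob V n3 X) = seqob V n1 (seqob V n2 (seqob V n3 X)).
  exact: seqob_split.
rewrite !compA; congr (_ ∘ _ ∘ _).
rewrite -[LHS]compA (seqmap_cat' e1 h _ (esym eX)) [LHS]compA; congr (_ ∘ _).
have eW : seqob V n1 (seqob V w X) = seqob V n1 (seqob V n2 (seqob V n3 X)).
  by congr seqob; apply: seqob_split.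
by rewrite (seqmap_idto (U := V) _ (esym eW)) !idto_comp; apply: idto_irr.
Qed.

Lemma cowhisker_nat n n' n'' z (e : n ++ n' ++ n'' = z) X Y (g : hom X Y) :
  seqmap V z g ∘ cowhisker delta e X = cowhisker delta e Y ∘ seqmap V (n ++ deg n' :: n'') g.
Proof.
rewrite /cowhisker -[RHS]compA.
rewrite (seqmap_cat erefl g (seqob_cat V n (deg n' :: n'') X)) !compA; congr (_ ∘ _).
have e' Z : seqob V z Z = seqob V n (seqob V (n' ++ n'') Z) by exact: seqob_split.
have e'' Z : seqob V n (seqob V (n' ++ n'') Z) = seqob V n (seqob V n' (seqob V n'' Z)).
  by rewrite seqob_cat.
have eE Z : idto (esym (seqob_split3 V e Z)) = idto (esym (e' Z)) ∘ idto (esym (e'' Z)).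
  by rewrite idto_comp; apply: idto_irr.
rewrite !eE !compA (seqmap_cat' e g _ (esym (e' Y))).
have e1 Z : seqob V (n' ++ n'') Z = seqob V n' (seqob V n'' Z) by exact: seqob_cat.
rewrite -!(seqmap_idto (U := V) (esym (e1 _))) -!compA -!seqmapM.
congr (_ ∘ seqmap V n _).
rewrite compA (seqmap_cat' erefl g _ (esym (e1 Y))) -compA; congr (_ ∘ _).
by rewrite -(nnat (delta n') (seqmap V n'' g)).
Qed.

Lemma cowhisker_catl u n1 n n' n'' z z' (e : n ++ n' ++ n'' = z) (e0 : u ++ n1 = n)
    (e3 : n1 ++ n' ++ n'' = z') X
    (eX : seqob V u (seqob V (n1 ++ deg n' :: n'') X) = seqob V (n ++ deg n' :: n'') X)
    (eX' : seqob V u (seqob V z' X) = seqob V z X) :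
  cowhisker delta e X ∘ idto eX = idto eX' ∘ seqmap V u (cowhisker delta e3 X).
Proof.
rewrite /cowhisker !seqmapM !compA -[LHS]compA idto_comp.
have h Y : seqob V n Y = seqob V u (seqob V n1 Y) by exact: seqob_split.
have -> : idto (etrans eX (seqob_cat V n (deg n' :: n'') X)) =
    idto (esym (h (V (deg n') (seqob V n'' X))))
      ∘ idto (f_equal (seqob V u) (seqob_cat V n1 (deg n' :: n'') X)).
  by rewrite idto_comp; apply: idto_irr.
rewrite [LHS]compA; congr (_ ∘ _); last by symmetry; apply: seqmap_idto.
rewrite -[LHS]compA (seqmap_cat' e0 _ _ (esym (h _))) compA.
congr (_ ∘ _).
rewrite (seqmap_idto (U := V) _ (f_equal (seqob V u) (esym (seqob_split3 V e3 X)))) !idto_comp.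
exact: idto_irr.
Qed.

Lemma cowhisker_catr n n' n'' w1 w2 z z' (e : n ++ n' ++ n'' = z) (e0 : w1 ++ w2 = n'')
    (e3 : n ++ n' ++ w1 = z') X
    (eX : seqob V (n ++ deg n' :: w1) (seqob V w2 X) = seqob V (n ++ deg n' :: n'') X)
    (eX' : seqob V z' (seqob V w2 X) = seqob V z X) :
  cowhisker delta e X ∘ idto eX = idto eX' ∘ cowhisker delta e3 (seqob V w2 X).
Proof.
have h : seqob V w1 (seqob V w2 X) = seqob V n'' X by symmetry; exact: seqob_split.
rewrite /cowhisker !compA -[LHS]compA [in LHS]idto_comp.
have -> : idto (etrans eX (seqob_cat V n (deg n' :: n'') X)) =
    idto (f_equal (fun Y => seqob V n (V (deg n') Y)) h)
      ∘ idto (seqob_cat V n (deg n' :: w1) (seqob V w2 X)).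
  by rewrite idto_comp; apply: idto_irr.
rewrite [LHS]compA; congr (_ ∘ _); rewrite -[LHS]compA.
rewrite (@nat_idto K C (fun Y => seqob V n (V (deg n') Y))
  (fun Y => seqob V n (seqob V n' Y)) (fun Y => seqmap V n (delta n' Y)) _ _ h
  _ (f_equal (fun Y => seqob V n (seqob V n' Y)) h)).
by rewrite !compA !idto_comp; congr (_ ∘ _); apply: idto_irr.
Qed.

Lemma wh_sccompl u n1 n n' n'' z z' (e : n ++ n' ++ n'' = z)
    (e1 : u ++ (n1 ++ deg n' :: n'') = n ++ deg n' :: n'') (e0 : u ++ n1 = n)
    (e2 : u ++ z' = z) (e3 : n1 ++ n' ++ n'' = z') X Y Z
    (f : hom Z (seqob V u Y)) (g : hom Y (seqob V (n1 ++ deg n' :: n'') X)) :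
  cowhisker delta e X ∘ sccomp e1 f g = sccomp e2 f (cowhisker delta e3 X ∘ g).
Proof.
rewrite /sccomp [LHS]compA (cowhisker_catl e e0 e3 _ (esym (seqob_split V e2 X))).
by rewrite seqmapM -[LHS]compA; congr (_ ∘ _); rewrite compA.
Qed.

Lemma wh_sccompr n n' n'' w1 w2 z z' (e : n ++ n' ++ n'' = z)
    (e1 : (n ++ deg n' :: w1) ++ w2 = n ++ deg n' :: n'') (e0 : w1 ++ w2 = n'')
    (e2 : z' ++ w2 = z) (e3 : n ++ n' ++ w1 = z') X Y Z
    (f : hom Z (seqob V (n ++ deg n' :: w1) Y)) (g : hom Y (seqob V w2 X)) :
  cowhisker delta e X ∘ sccomp e1 f g = sccomp e2 (cowhisker delta e3 Y ∘ f) g.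
Proof.
rewrite /sccomp [LHS]compA (cowhisker_catr e e0 e3 _ (esym (seqob_split V e2 X))).
by rewrite -[LHS]compA; congr (_ ∘ _); rewrite [LHS]compA [RHS]compA cowhisker_nat.
Qed.

Lemma sccomp_ul z (e : [::] ++ z = z) X Y (f : hom Y (seqob V z X)) :
  @sccomp K C V [::] z z e X Y Y (idm Y) f = f.
Proof. by rewrite /sccomp /= idto_id comp1m compm1. Qed.

Lemma sccomp_ur z (e : z ++ [::] = z) X Y (f : hom Y (seqob V z X)) :
  @sccomp K C V z [::] z e X X Y f (idm X) = f.
Proof. by rewrite /sccomp /= idto_id seqmap1 !comp1m. Qed.

Lemma cicE (M : int -> C) n X i j (e : i = j) (x : hom (M i) (seqob V n X)) :
  x ∘ icast M (esym e) = ic (G := G) e x.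
Proof. by case: j / e; rewrite /icast idto_id compm1. Qed.

Let sc n n' z (e : n ++ n' = z) X Y Z (f : G n Y Z) (g : G n' X Y) : G z X Z :=
  sccomp e f g.
Let uu X : G [::] X X := idm X.

Lemma cowh_linear n n' n'' z (e : n ++ n' ++ n'' = z) X Z :
  linear (fun f : G (n ++ deg n' :: n'') X Z => wh e f).
Proof. exact: comp_linr. Qed.

Definition csign1 (m m' : seq int) : K :=
  sg ((size m)%:Z * (size m').+1%:Z + (size m').+1%:Z * sumz m).
Definition csign2 (n n' n'' : seq int) : K :=
  sg ((size n'').+1%:Z + (size n)%:Z * (size n')%:Z + (size n')%:Z * sumz n).

Lemma csign1E m m' : ~~ odd (size m) -> odd (size m') -> csign1 m m' = 1.
Proof.
by move=> om om'; rewrite /csign1 sgD !sg_natM /= om' (negbTE om) mulr1.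
Qed.

Lemma csign2l u n1 n' n'' : ~~ odd (size u) ->
  csign2 (u ++ n1) n' n'' = (if odd (size n') then sg (sumz u) else 1) * csign2 n1 n' n''.
Proof.
move=> ou; rewrite /csign2 size_cat sumz_cat.
have -> : (size n'').+1%:Z + (size u + size n1)%:Z * (size n')%:Z
    + (size n')%:Z * (sumz u + sumz n1)
  = (size u)%:Z * (size n')%:Z + ((size n')%:Z * sumz u + ((size n'').+1%:Z
      + (size n1)%:Z * (size n')%:Z + (size n')%:Z * sumz n1)) by lia.
by rewrite [LHS]sgD sg_natM (negbTE ou) mul1r [LHS]sgD sg_natM.
Qed.

Lemma csign2r n n' w1 w2 : ~~ odd (size w2) -> csign2 n n' (w1 ++ w2) = csign2 n n' w1.
Proof.
move=> ow; rewrite /csign2 size_cat.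
have -> : (size w1 + size w2).+1%:Z + (size n)%:Z * (size n')%:Z + (size n')%:Z * sumz n
  = (size w2)%:Z
    + ((size w1).+1%:Z + (size n)%:Z * (size n')%:Z + (size n')%:Z * sumz n) by lia.
by rewrite [LHS]sgD sg_nat (negbTE ow) mul1r.
Qed.

(** In the general setting of the composition lemmas, a morphism P1 -> P2 of
    comodules goes from P2 to P1. *)
Lemma coinf_morphismE (P1 P2 : even_comodule delta)
    (alpha : forall n l, hom (P1 (adeg n l)) (seqob V n (P2 l))) :
  coinf_morphism alpha <-> forall z l,
    lhs1 (@sc) csign1 (cact P2 : fam G mdeg P2 P2) (alpha : fam G adeg P2 P1) z l
    + lhs2 (@wh) csign2 (alpha : fam G adeg P2 P1) z l
    = rhs (@sc) (cact P1 : fam G mdeg P1 P1) (alpha : fam G adeg P2 P1) z l.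
Proof.
have E1 z l : lhs1 (@sc) csign1 (cact P2 : fam G mdeg P2 P2)
    (alpha : fam G adeg P2 P1) z l =
  sum2 (fun m m' (e : m ++ m' = z) =>
      sg ((size m)%:Z * (size m').+1%:Z + (size m').+1%:Z * sumz m) *:
        (sccomp e (alpha m (mdeg m' l)) (cact P2 m' l)
           ∘ icast P1 (esym (adeg_mdeg l e)))).
  by apply: eq_sum2 => m m' e; rewrite cicE.
have E2 z l : lhs2 (@wh) csign2 (alpha : fam G adeg P2 P1) z l =
  sum3 (fun n n' n'' (e : n ++ n' ++ n'' = z) =>
      sg ((size n'').+1%:Z + (size n)%:Z * (size n')%:Z + (size n')%:Z * sumz n) *:
        (cowhisker delta e (P2 l) ∘ alpha (n ++ deg n' :: n'') l
           ∘ icast P1 (esym (adeg_split3 l e)))).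
  by apply: eq_sum3 => n n' n'' e; rewrite cicE.
have E3 z l : rhs (@sc) (cact P1 : fam G mdeg P1 P1) (alpha : fam G adeg P2 P1) z l =
  sum2 (fun p p' (e : p ++ p' = z) =>
        sccomp e (cact P1 p (adeg p' l)) (alpha p' l)
          ∘ icast P1 (esym (mdeg_adeg l e))).
  by apply: eq_sum2 => m m' e; rewrite cicE.
by split=> h z l; have := h z l; rewrite E1 E2 E3.
Qed.

Lemma coinf_compE (P1 P2 P3 : even_comodule delta)
    (beta : forall n l, hom (P2 (adeg n l)) (seqob V n (P3 l)))
    (alpha : forall n l, hom (P1 (adeg n l)) (seqob V n (P2 l))) :
  coinf_comp beta alpha = fcomp (@sc) (alpha : fam G adeg P2 P1) (beta : fam G adeg P3 P2).
Proof.
apply/functional_extensionality_dep => z; apply/functional_extensionality_dep => l.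
by apply: eq_sum2 => m m' e; rewrite cicE.
Qed.

Lemma coinf_idE (P : even_comodule delta) : @coinf_id _ _ _ _ P = fid (@uu) P.
Proof.
apply/functional_extensionality_dep => z; apply/functional_extensionality_dep => l.
case: z => //=.
by rewrite -cicE comp1m.
Qed.

Lemma cact_is_even (P : even_comodule delta) : is_even (cact P : fam G mdeg P P).
Proof. by move=> n l on; apply: cact_even. Qed.

Lemma cimap_is_odd (P1 P2 : even_comodule delta) (f : odd_coinf_morphism P1 P2) :
  is_odd (cimap f : fam G adeg P2 P1).
Proof. by move=> n l on; apply: cimap_odd; rewrite /= on. Qed.

Lemma eq_odd_coinf (P1 P2 : even_comodule delta) (f g : odd_coinf_morphism P1 P2) :
  cimap f = cimap g -> f = g.
Proof.
case: f g => [f f1 f2] [g g1 g2] /= E; move: f1 f2 g1 g2; rewrite E => f1 f2 g1 g2.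
by rewrite (Prop_irrelevance f1 g1) (Prop_irrelevance f2 g2).
Qed.

Definition odd_coinf_id (P : even_comodule delta) : odd_coinf_morphism P P.
Proof.
apply: (@OddCoinfMorphism _ _ _ _ _ _ (@coinf_id _ _ _ _ P)).
- apply/coinf_morphismE => z l; rewrite coinf_idE; apply: fid_rel.
  + exact: sccomp_linl.
  + exact: sccomp_linr.
  + exact: cowh_linear.
  + exact: sccomp_ul.
  + exact: sccomp_ur.
  + exact: csign1E.
  + exact: cact_is_even.
- by case.
Defined.

Definition odd_coinf_comp (P1 P2 P3 : even_comodule delta)
  (g : odd_coinf_morphism P2 P3) (f : odd_coinf_morphism P1 P2) : odd_coinf_morphism P1 P3.
Proof.
apply: (@OddCoinfMorphism _ _ _ _ _ _ (coinf_comp g f)).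
- apply/coinf_morphismE => z l; rewrite coinf_compE; apply: fcomp_rel.
  + exact: sccomp_linl.
  + exact: sccomp_linr.
  + exact: sccompA.
  + exact: cowh_linear.
  + exact: wh_sccompl.
  + exact: wh_sccompr.
  + exact: csign1E.
  + exact: csign2l.
  + exact: csign2r.
  + exact: cact_is_even.
  + exact: cact_is_even.
  + exact: cimap_is_odd.
  + exact: cimap_is_odd.
  + by apply/coinf_morphismE; apply: cimap_rel.
  + by apply/coinf_morphismE; apply: cimap_rel.
- move=> n l /= /negPn on; rewrite coinf_compE; apply: fcomp_odd => //.
  + exact: sccomp_linl.
  + exact: sccomp_linr.
  + exact: cimap_is_odd.
  + exact: cimap_is_odd.
Defined.

Definition EMeo_comod : category.
Proof.
refine (@Category (even_comodule delta) (@odd_coinf_morphism K C V delta) odd_coinf_id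
  odd_coinf_comp _ _ _).
- move=> X Y Z W h g f; apply: eq_odd_coinf => /=; rewrite !coinf_compE.
  apply/functional_extensionality_dep => z; apply/functional_extensionality_dep => l.
  symmetry; apply: fcompA.
  + exact: sccomp_linl.
  + exact: sccomp_linr.
  + exact: sccompA.
- move=> X Y f; apply: eq_odd_coinf => /=; rewrite coinf_compE coinf_idE.
  apply/functional_extensionality_dep => z; apply/functional_extensionality_dep => l.
  apply: fcompf1.
  + exact: sccomp_linr.
  + exact: sccomp_ur.
- move=> X Y f; apply: eq_odd_coinf => /=; rewrite coinf_compE coinf_idE.
  apply/functional_extensionality_dep => z; apply/functional_extensionality_dep => l.
  apply: fcomp1f.
  + exact: sccomp_linl.
  + exact: sccomp_ul.
Defined.

Lemma eq_comod_hom (P P' : even_comodule delta) (f g : comod_hom P P') :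
  chmap f = chmap g -> f = g.
Proof.
case: f g => [f f1] [g g1] /= E; move: f1 g1; rewrite E => f1 g1.
by rewrite (Prop_irrelevance f1 g1).
Qed.

Definition comod_id (P : even_comodule delta) : comod_hom P P.
Proof.
refine (@ComodHom _ _ _ _ P P (fun l => idm (P l)) _).
by move=> n l; rewrite seqmap1 comp1m compm1.
Defined.

Definition comod_comp (P1 P2 P3 : even_comodule delta)
  (g : comod_hom P2 P3) (f : comod_hom P1 P2) : comod_hom P1 P3.
Proof.
refine (@ComodHom _ _ _ _ P1 P3 (fun l => g l ∘ f l) _).
by move=> n l; rewrite compA chmap_act -compA chmap_act seqmapM compA.
Defined.

Definition EMe_comod : category.
Proof.
refine (@Category (even_comodule delta) (@comod_hom K C V delta) comod_id comod_comp
  _ _ _).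
- move=> X Y Z W h g f; apply: eq_comod_hom.
  by apply/functional_extensionality_dep => l /=; rewrite compA.
- move=> X Y f; apply: eq_comod_hom.
  by apply/functional_extensionality_dep => l /=; rewrite comp1m.
- move=> X Y f; apply: eq_comod_hom.
  by apply/functional_extensionality_dep => l /=; rewrite compm1.
Defined.

End ComoduleSystem.

Section AdjointComonad.
Variables (K : fieldType) (C : lincat K) (U V : int -> lfunctor C).
Variable adj : forall n, adjunction (U n) (V n).

Fixpoint seq_adjr n X Y : hom (revob U n X) Y -> hom X (seqob V n Y) :=
  match n with
  | [::] => fun f => f
  | a :: n' => fun f => adjr (adj a) (@seq_adjr n' (U a X) Y f)
  end.

Fixpoint seq_adjl n X Y : hom X (seqob V n Y) -> hom (revob U n X) Y :=
  match n with
  | [::] => fun f => f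
  | a :: n' => fun f => @seq_adjl n' (U a X) Y (adjl (adj a) f)
  end.

Definition seq_adj n : adjunction (revfun U n) (seqfun V n).
Proof.
refine (@Adjunction K C (revfun U n) (seqfun V n) (@seq_adjr n) (@seq_adjl n) _ _ _).
- by elim: n => //= a n IH X Y f; rewrite adjrK IH.
- by elim: n => //= a n IH X Y f; rewrite IH adjlK.
- by elim: n => //= a n IH X X' Y Y' g f h; rewrite IH adjr_nat.
Defined.

Variable theta : forall n, nat_trans (seqfun U n) (U (deg n)).

Lemma revmap_rev n X Y (f : hom X Y) :
  idto (revob_rev U n Y) ∘ revmap U n f = seqmap U (rev n) f ∘ idto (revob_rev U n X).
Proof.
elim: n X Y f => [|a n IH] X Y f; first by rewrite !idto_id comp1m compm1.
have h Z : seqob U (rev (a :: n)) Z = seqob U (rev n) (U a Z).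
  by rewrite rev_cons -cats1 seqob_cat.
have E Z : idto (revob_rev U (a :: n) Z) = idto (esym (h Z)) ∘ idto (revob_rev U n (U a Z)).
  by rewrite idto_comp; apply: idto_irr.
have e : rev n ++ [:: a] = rev (a :: n) by rewrite rev_cons cats1.
rewrite !E -[LHS]compA (IH _ _ (fmap (U a) f)) [LHS]compA [RHS]compA; congr (_ ∘ _).
by rewrite (seqmap_cat' e f _ (esym (h Y))).
Qed.

Definition theta_op n : nat_trans (revfun U n) (U (deg n)).
Proof.
refine (@NatTrans K C (revfun U n) (U (deg n)) (fun X =>
  icast (fun i => U i X) (deg_rev n) ∘ theta (rev n) X ∘ idto (revob_rev U n X)) _).
move=> X Y f.
rewrite -[LHS]compA (revmap_rev n f) [LHS]compA [RHS]compA; congr (_ ∘ _).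
rewrite -[LHS]compA (nnat (theta (rev n)) f) [LHS]compA [RHS]compA; congr (_ ∘ _).
by rewrite /icast; case: (deg n) / (deg_rev n); rewrite /= comp1m compm1.
Defined.

(** δ_k(n) is the mate of θ_k(n^op). *)
Definition adj_delta n : nat_trans (V (deg n)) (seqfun V n) :=
  mate (seq_adj n) (adj (deg n)) (theta_op n).

End AdjointComonad.

Section TensorMonad.
Variables (K : fieldType) (C : lincat K) (T : copowers C) (H : internal_hom T).
Variables (A : Ainf_algebra K) (F : nonunital_monad C).
Variables (G : lfunctor C) (FG : adjunction F G).

Definition U_AF (n : int) : lfunctor C := lfunctor_comp (tens_fun T (A n)) F.
Definition V_AG (n : int) : lfunctor C := lfunctor_comp (ihom H (A n)) G.

Fixpoint iterob (k : nat) (X : C) : C := if k is k'.+1 then F (iterob k' X) else X.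

Fixpoint itermap (k : nat) X Y (f : hom X Y) : hom (iterob k X) (iterob k Y) :=
  if k is k'.+1 then fmap F (itermap k' f) else f.

Fixpoint numul_iter (k : nat) X : hom (iterob k.+1 X) (F X) :=
  if k is k'.+1 then numul F X ∘ fmap F (numul_iter k' X) else idm (F X).

Lemma numul_iter_nat k X Y (f : hom X Y) :
  numul_iter k Y ∘ itermap k.+1 f = fmap F f ∘ numul_iter k X.
Proof.
elim: k => [|k IH]; first by rewrite comp1m compm1.
rewrite -[LHS]compA -(fmapM F (numul_iter k Y) (itermap k.+1 f)) IH fmapM [LHS]compA.
by rewrite (nnat (numul F) f) -[LHS]compA.
Qed.

(** A multilinear family of maps F^k X -> Y indexed by A_{n_1} × ... × A_{n_k}
    induces A_{n_1} ⊗ F(A_{n_2} ⊗ F(... X)) -> Y; this uses that F, being a left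
    adjoint, commutes with copowers. *)
Fixpoint tens_ind (n : seq int) X Y :
    (elts A n -> hom (iterob (size n) X) Y) -> hom (seqob U_AF n X) Y :=
  match n with
  | [::] => fun g => g tt
  | a :: n' => fun g => tens_desc T (fun v : A a =>
      adjl FG (@tens_ind n' X (G Y) (fun w => adjr FG (g (v, w)))))
  end.

(** F^k X -> A_{n_1} ⊗ F(A_{n_2} ⊗ F(... X)) given by elements of the A_{n_i}. *)
Fixpoint tens_seq_in (n : seq int) X :
    elts A n -> hom (iterob (size n) X) (seqob U_AF n X) :=
  match n with
  | [::] => fun _ => idm X
  | a :: n' => fun w => tens_in T (F (seqob U_AF n' X)) w.1
                          ∘ fmap F (@tens_seq_in n' X w.2)
  end.

Lemma multilinear_comp (L L' : lmodType K) (h : L -> L') n (g : elts A n -> L) :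
  linear h -> multilinear g -> multilinear (fun w => h (g w)).
Proof.
move=> hl; elim: n g => //= a n IH g [g1 g2]; split.
  by move=> w k u v; rewrite g1 hl.
by move=> v; apply: IH.
Qed.

Lemma tens_ind_lin n (W : lmodType K) X Y
    (g : W -> elts A n -> hom (iterob (size n) X) Y) :
  (forall w, linear (fun v => g v w)) -> (forall v, multilinear (g v)) ->
  linear (fun v => tens_ind (g v)).
Proof.
elim: n W X Y g => [|a n IH] W X Y g gl gm; first by move=> k u v /=; rewrite gl.
have lin_in v : linear (fun x : A a =>
    adjl FG (tens_ind (fun w => adjr FG (g v (x, w))))).
  move=> k x y; rewrite -adjl_lin; congr adjl.
  apply: (IH _ _ _ (fun x w => adjr FG (g v (x, w)))).
    by move=> w c x' y'; have [-> _] := gm v; rewrite adjr_lin.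
  move=> x'; apply: multilinear_comp; first exact: adjr_lin.
  by have [_] := gm v; apply.
move=> k u v; apply: tens_ext => x /=.
rewrite comp_linl !tens_descK //.
rewrite -adjl_lin; congr adjl.
apply: (IH _ _ _ (fun v w => adjr FG (g v (x, w)))).
  by move=> w c u' v'; rewrite gl adjr_lin.
move=> v'; apply: multilinear_comp; first exact: adjr_lin.
by have [_] := gm v'; apply.
Qed.

Lemma tens_indK n X Y (g : elts A n -> hom (iterob (size n) X) Y) :
  multilinear g -> forall w, tens_ind g ∘ tens_seq_in X w = g w.
Proof.
elim: n X Y g => [|a n IH] X Y g gm; first by case; rewrite /= compm1.
case=> v w; have [g1 g2] := gm.
rewrite /= compA tens_descK.
  rewrite -adjl_pre IH ?adjrK //.
  by apply: multilinear_comp; [exact: adjr_lin | exact: g2].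
move=> k x y; rewrite -adjl_lin; congr adjl.
apply: (tens_ind_lin (g := fun x w => adjr FG (g (x, w)))).
  by move=> w' c x' y'; rewrite g1 adjr_lin.
by move=> x'; apply: multilinear_comp; [exact: adjr_lin | exact: g2].
Qed.

Lemma tens_seq_ext n X Y (f g : hom (seqob U_AF n X) Y) :
  (forall w, f ∘ tens_seq_in X w = g ∘ tens_seq_in X w) -> f = g.
Proof.
elim: n X Y f g => [|a n IH] X Y f g E; first by have := E tt; rewrite /= !compm1.
apply: tens_ext => v.
rewrite -[LHS](adjrK FG) -[RHS](adjrK FG); congr adjl; apply: IH => w.
by rewrite -!adjr_pre -!compA; congr adjr; exact: (E (v, w)).
Qed.

Lemma tens_seq_in_nat n X Y (f : hom X Y) w :
  seqmap U_AF n f ∘ tens_seq_in X w = tens_seq_in Y w ∘ itermap (size n) f.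
Proof.
elim: n w => [|a n IH] w; first by rewrite /= comp1m compm1.
rewrite /= compA tens_descK; last exact: tens_in_comp_lin.
by rewrite -!compA -!fmapM IH.
Qed.

Definition theta_AF_app (n : seq int) X : hom (seqob U_AF n X) (U_AF (deg n) X) :=
  match n with
  | [::] => 0
  | a :: n' => @tens_ind (a :: n') X (U_AF (deg (a :: n')) X)
      (fun w => tens_in T (F X) (amul w) ∘ numul_iter (size n') X)
  end.

Lemma theta_AF_appE a n X w :
  theta_AF_app (a :: n) X ∘ tens_seq_in X w
  = tens_in T (F X) (amul w) ∘ numul_iter (size n) X.
Proof.
apply: tens_indK.
apply: (multilinear_comp (h := fun x => tens_in T (F X) x ∘ numul_iter (size n) X)).
  exact: tens_in_comp_lin.
exact: amul_lin.
Qed.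

Definition theta_AF (n : seq int) : nat_trans (seqfun U_AF n) (U_AF (deg n)).
Proof.
refine (@NatTrans K C (seqfun U_AF n) (U_AF (deg n)) (theta_AF_app n) _).
case: n => [|a n] X Y f.
  by rewrite (lin0 (comp_linl _)) (lin0 (comp_linr _)).
apply: tens_seq_ext => w; rewrite -compA tens_seq_in_nat compA theta_AF_appE.
rewrite -[LHS]compA (numul_iter_nat (size n) f) -[RHS]compA theta_AF_appE.
rewrite [RHS]compA tens_descK ?compA //.
exact: tens_in_comp_lin.
Defined.

Definition delta_AG : forall n, nat_trans (V_AG (deg n)) (seqfun V_AG n) :=
  adj_delta (fun n => tens_ihom_adj H FG (A n)) theta_AF.

End TensorMonad.

Section HomComonad.
Variables (K : fieldType) (C : lincat K) (T : copowers C) (H : internal_hom T).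
Variable A : Ainf_algebra K.

Definition V_A (n : int) : lfunctor C := ihom H (A n).

Definition delta_AId : forall n, nat_trans (V_AG H A (lfunctor_id C) (deg n))
    (seqfun (V_AG H A (lfunctor_id C)) n) :=
  delta_AG H A (F := nonunital_monad_id C) (adjunction_id C).

(** The functors [V_A n] and [V_AG H A (lfunctor_id C) n]
    have the same action on objects and on morphisms, but different proofs of the
    functor laws. *)
Definition delta_A n : nat_trans (V_A (deg n)) (seqfun V_A n) :=
  @NatTrans K C (V_A (deg n)) (seqfun V_A n)
    (fun X => delta_AId n X) (fun X Y f => nnat (delta_AId n) f).

End HomComonad.

(* Main.v *)
From mathcomp Require Import all_boot all_order all_algebra.
From mathcomp Require Import boolp zify.
Require Import Defs.
Set Implicit Arguments.
Unset Strict Implicit.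
Unset Printing Implicit Defensive.
Import GRing.Theory.
Local Open Scope ring_scope.

(** Transposing along the composite of the adjunctions U_n -| V_n turns maps
    U_(n^op) X -> Y into maps X -> V_n Y.  It exchanges the two ways of composing
    and turns whiskering by θ(n^op) into whiskering by its mate δ(n).  Hence it
    carries each relation for the reversed tuple n^op to the dual relation for n;
    by evenness only terms with q even survive, and on these the two families of
    signs correspond.  On modules, M_l is sent to P_l = M_(-l),
    since π(n^op) : U_(n^op) M_(-j) -> M_(-l) transposes to M_(-j) -> V_n M_(-l)
    with j = Σn + l + 2 - k.  The relation for A ⊗ F(-) is checked on elements of
    the A_i, where it becomes the A_∞-relation together with associativity of the
    multiplication of F. *)

(** * Sums over partitions of a reversed tuple *)

Section SumReversal.
Variable V : zmodType.

Lemma rev_split (z m m' : seq int) : m ++ m' = rev z -> rev m' ++ rev m = z.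
Proof. by move=> e; rewrite -rev_cat e revK. Qed.

Lemma rev_split3 (z n n' n'' : seq int) :
  n ++ n' ++ n'' = rev z -> rev n'' ++ rev n' ++ rev n = z.
Proof. by move=> e; rewrite catA -!rev_cat e revK. Qed.

(** Cutting [rev z] after i entries cuts [z] before its last i entries, so the two sums differ by
    the change of index from i to |z| - i. *)
Lemma sum2_rev z (t : forall m m' : seq int, m ++ m' = z -> V) :
  sum2 t = sum2 (fun m m' (e : m ++ m' = rev z) => t (rev m') (rev m) (rev_split e)).
Proof.
have tE a b c d e e' : a = c -> b = d -> t a b e = t c d e'.
  by move=> ac bd; subst c d; congr t; apply: Prop_irrelevance.
rewrite /sum2 size_rev (reindex_inj rev_ord_inj); apply: eq_bigr => i _ /=.
have ile : (i <= size z)%N by rewrite -ltnS.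
rewrite subSS; apply: tE; rewrite ?drop_rev ?take_rev ?revK //.
Qed.

(** Reversal exchanges first and last blocks, so the double sum is re-bracketed by [sum2_assoc] to
    split off the last block first; the two nested cuts are then reversed one after the other. *)
Lemma sum3_rev z (t : forall n n' n'' : seq int, n ++ n' ++ n'' = z -> V) :
  sum3 t = sum3 (fun n n' n'' (e : n ++ n' ++ n'' = rev z) =>
    t (rev n'') (rev n') (rev n) (rev_split3 e)).
Proof.
pose s u v w e := if nilp v then 0 else t u v w e.
have p1 (y w u v : seq int) : y ++ w = z -> u ++ v = y -> u ++ v ++ w = z.
  by move=> <- <-; rewrite catA.
have p2 (y w u v : seq int) : u ++ y = z -> v ++ w = y -> u ++ v ++ w = z.
  by move=> <- <-.
have sE a b c a' b' c' e e' : a = a' -> b = b' -> c = c' -> s a b c e = s a' b' c' e'.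
  by move=> aa bb cc; subst a' b' c'; congr s; apply: Prop_irrelevance.
transitivity (sum2 (fun u y e => sum2 (fun v w e' => s u v w (p2 y w u v e e')))).
  apply: eq_sum2 => u y e; apply: eq_sum2 => v w e'.
  by rewrite /s (Prop_irrelevance (p2 _ _ _ _ _ _) (cat_assoc3 e e')).
rewrite -(sum2_assoc s p1 p2) sum2_rev; apply: eq_sum2 => u y e.
(* Reversing the inner cut leaves a sum over [rev (rev y)]; [sum2_eq] transports it to [y]. *)
have sum2_eq (x x' : seq int) (h : x = x') (r : forall m m' : seq int, m ++ m' = x' -> V) :
    sum2 r = sum2 (fun m m' (e : m ++ m' = x) => r m m' (etrans e h)).
  by case: x' / h r => r; apply: eq_sum2 => m m' e'; congr r; apply: Prop_irrelevance.
rewrite sum2_rev (sum2_eq _ _ (esym (revK y))); apply: eq_sum2 => v w e'.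
have -> : nilp v = nilp (rev v) by rewrite /nilp size_rev.
exact: sE.
Qed.

(** The form in which two-block sums are compared with their duals: [e'] is arbitrary, so termwise
    arguments never meet the particular proof built by [rev_split]. *)
Lemma eq_sum2_rev z (t : forall m m' : seq int, m ++ m' = z -> V)
    (t' : forall m m' : seq int, m ++ m' = rev z -> V) :
  (forall m m' e e', t m m' e = t' (rev m') (rev m) e') -> sum2 t = sum2 t'.
Proof.
move=> tt'; rewrite sum2_rev; apply: eq_sum2 => m m' e.
have e' : rev (rev m) ++ rev (rev m') = rev z by rewrite !revK.
rewrite (tt' _ _ _ e'); move: e'; rewrite !revK => e'.
by congr t'; apply: Prop_irrelevance.
Qed.

Lemma eq_sum3_rev z (t : forall n n' n'' : seq int, n ++ n' ++ n'' = z -> V)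
    (t' : forall n n' n'' : seq int, n ++ n' ++ n'' = rev z -> V) :
  (forall n n' n'' e e', t n n' n'' e = t' (rev n'') (rev n') (rev n) e') ->
  sum3 t = sum3 t'.
Proof.
move=> tt'; rewrite sum3_rev; apply: eq_sum3 => n n' n'' e.
have e' : rev (rev n) ++ rev (rev n') ++ rev (rev n'') = rev z by rewrite !revK.
rewrite (tt' _ _ _ _ e'); move: e'; rewrite !revK => e'.
by congr t'; apply: Prop_irrelevance.
Qed.

End SumReversal.

(** * Transposition along composite adjunctions *)

Section Transpose.
Variables (K : fieldType) (C : lincat K) (U V : int -> lfunctor C).
Variable adj : forall n, adjunction (U n) (V n).
Implicit Types X Y Z : C.

Lemma revob_eq n w (e : rev n = w) X : revob U n X = seqob U w X.
Proof. by rewrite revob_rev e. Qed.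

(** [w] is kept apart from [rev n] because [rev (n ++ n')] and [rev n' ++ rev n] are equal but not
    convertible; the proof [e] absorbs the difference. *)
Definition transpose n w (e : rev n = w) X Y (f : hom (seqob U w X) Y) :
    hom X (seqob V n Y) :=
  adjr (seq_adj adj n) (f ∘ idto (revob_eq e X)).

Definition untranspose n w (e : rev n = w) X Y (g : hom X (seqob V n Y)) :
    hom (seqob U w X) Y :=
  adjl (seq_adj adj n) g ∘ idto (esym (revob_eq e X)).

Lemma transposeK n w (e : rev n = w) X Y (f : hom (seqob U w X) Y) :
  untranspose e (transpose e f) = f.
Proof.
by rewrite /untranspose /transpose adjrK -compA idto_comp idto_id compm1.
Qed.

Lemma untransposeK n w (e : rev n = w) X Y (g : hom X (seqob V n Y)) :
  transpose e (untranspose e g) = g.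
Proof.
by rewrite /untranspose /transpose -[_ ∘ _ ∘ _]compA idto_comp idto_id compm1 adjlK.
Qed.

Lemma transpose_lin n w (e : rev n = w) X Y : linear (@transpose n w e X Y).
Proof. by move=> k f g; rewrite /transpose comp_linl adjr_lin. Qed.

Lemma transpose0 n w (e : rev n = w) X Y : transpose e (0 : hom (seqob U w X) Y) = 0.
Proof. exact: (lin0 (@transpose_lin n w e X Y)). Qed.

Lemma transpose_comp n w (e : rev n = w) X Y Y' (f : hom (seqob U w X) Y) (h : hom Y Y') :
  transpose e (h ∘ f) = seqmap V n h ∘ transpose e f.
Proof. by rewrite /transpose -compA adjr_comp. Qed.

Lemma revmap_eq n w (e : rev n = w) X Y (f : hom X Y) :
  seqmap U w f ∘ idto (revob_eq e X) = idto (revob_eq e Y) ∘ revmap U n f.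
Proof.
case: w / e; have := revmap_rev U n f.
rewrite (idto_irr _ (revob_eq erefl X)) (idto_irr (revob_rev U n Y) (revob_eq erefl Y)).
by move=> ->.
Qed.

Lemma transpose_pre n w (e : rev n = w) X X' Y (f : hom (seqob U w X) Y) (g : hom X' X) :
  transpose e (f ∘ seqmap U w g) = transpose e f ∘ g.
Proof. by rewrite /transpose -compA revmap_eq compA -(adjr_pre (seq_adj adj n)). Qed.

Lemma revob_cat m m' X : revob U (m ++ m') X = revob U m' (revob U m X).
Proof. by elim: m X => //= a m IH X. Qed.

Lemma seq_adjr_cat m m' X Y (f : hom (revob U m' (revob U m X)) Y) :
  seq_adjr adj (n := m ++ m') (f ∘ idto (revob_cat m m' X))
  = idto (esym (seqob_cat V m m' Y)) ∘ seq_adjr adj (seq_adjr adj f).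
Proof.
elim: m X f => [|a m IH] X f /=; first by rewrite !idto_id comp1m compm1.
rewrite (idto_irr _ (revob_cat m m' (U a X))) IH adjr_comp.
by rewrite (fmap_idto (F := V a) _ (esym (seqob_cat V (a :: m) m' Y))).
Qed.

(** The adjunction for [m ++ m'] transposes along [m'] first: naturality in the source turns [f]
    after U(g) into the transpose of [f] after [g]. Transposing along [m] then applies V_m to the
    transpose of [f]. *)
Lemma transpose_scomp m m' z u u' w (e : m ++ m' = z) (e' : u' ++ u = w)
    (em : rev m = u) (em' : rev m' = u') (ez : rev z = w) X Y Z
    (f : hom (seqob U u' Y) Z) (g : hom (seqob U u X) Y) :
  transpose ez (scomp e' f g) = sccomp e (transpose em g) (transpose em' f).
Proof.
case: z / e ez => ez.
have h : revob U m' (revob U m X) = seqob U u' (seqob U u X).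
  by rewrite (revob_eq em') (revob_eq em).
have -> : transpose ez (scomp e' f g)
   = adjr (seq_adj adj (m ++ m')) (f ∘ seqmap U u' g ∘ idto h ∘ idto (revob_cat m m' X)).
  apply: (f_equal (@adjr K C _ _ (seq_adj adj (m ++ m')) X Z)).
  rewrite /scomp -!compA !idto_comp; congr (_ ∘ (_ ∘ _)); exact: idto_irr.
rewrite [LHS]seq_adjr_cat /sccomp; congr (_ ∘ _).
  exact: idto_irr.
have -> : f ∘ seqmap U u' g ∘ idto h
    = f ∘ idto (revob_eq em' Y) ∘ revmap U m' (g ∘ idto (revob_eq em X)).
  rewrite -[RHS]compA -revmap_eq seqmapM -!compA; congr (_ ∘ (_ ∘ _)).
  have h' : seqob U u' (revob U m X) = seqob U u' (seqob U u X).
    by rewrite (revob_eq em).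
  rewrite (seqmap_idto (U := U) _ h') idto_comp; exact: idto_irr.
apply: etrans (f_equal (adjr (seq_adj adj m))
  (adjr_pre (seq_adj adj m') (g ∘ idto (revob_eq em X)) (f ∘ idto (revob_eq em' Y)))) _.
exact: (adjr_comp (seq_adj adj m)).
Qed.

Variable theta : forall n, nat_trans (seqfun U n) (U (deg n)).
Let delta := adj_delta adj theta.

(** [w] and [D] are left free so that later uses can absorb the casts between the degrees of a tuple
    and of its reversal. *)
Lemma deltaE n w (e : rev n = w) D (h : D = deg n) (h' : deg w = D) X :
  delta n X ∘ icast (fun i => V i X) h
  = transpose e (adjl (adj D) (idm (V D X)) ∘ icast (fun i => U i (V D X)) h'
                   ∘ theta w (V D X)).
Proof.
subst D w; rewrite /icast compm1 /transpose.
apply: (f_equal (@adjr K C _ _ (seq_adj adj n) _ _)).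
by rewrite (Prop_irrelevance h' (deg_rev n)) (idto_irr (revob_eq _ _) (revob_rev U n _)) !compA.
Qed.

(** The characteristic property of a mate: [transpose e1 (idm _)] is the unit, and naturality of θ
    with a triangle identity cancels it against the counit inside [delta]. *)
Lemma theta_transpose n w (e : rev n = w) (e1 : rev [:: deg n] = [:: deg w]) X :
  transpose e (theta w X) = delta n (U (deg w) X) ∘ transpose e1 (idm (U (deg w) X)).
Proof.
have h' : deg w = deg n by rewrite -e deg_rev.
have -> : delta n (U (deg w) X)
    = delta n (U (deg w) X) ∘ icast (fun i => V i (U (deg w) X)) erefl.
  by rewrite /icast compm1.
rewrite (deltaE e erefl h') -transpose_pre; congr (transpose _ _).
move: (theta w) h' e1; move: (deg w) => D t h'; subst D => e1.
rewrite -[RHS]compA (nnat t) compA /icast compm1.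
have -> : transpose e1 (idm (U (deg n) X)) = adjr (adj (deg n)) (idm (U (deg n) X)).
  by rewrite /transpose /= idto_id compm1.
by rewrite -adjl_pre comp1m adjrK comp1m.
Qed.

Lemma whisker_nil n z (e : [::] ++ n ++ [::] = z) (ez : n = z) X :
  whisker theta e X
  = theta n X ∘ idto (f_equal (fun w => seqob U w X) (esym ez)).
Proof.
case: z / ez e => e; rewrite /whisker /= compm1 !idto_id comp1m.
exact: compm1.
Qed.

Lemma cowhisker_nil n z (e : [::] ++ n ++ [::] = z) (ez : n = z) X :
  cowhisker delta e X
  = idto (f_equal (fun w => seqob V w X) ez) ∘ delta n X.
Proof.
case: z / ez e => e; rewrite /cowhisker /= comp1m !idto_id compm1.
exact: comp1m.
Qed.

(* By naturality it suffices to treat an identity [f], which is an iterated [scomp]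
   of identities; whiskering then only hits the middle factor. *)
Lemma transpose_whisker n n' n'' z z' (e : n ++ n' ++ n'' = z)
    (e' : rev n'' ++ rev n' ++ rev n = z')
    (eN : rev (n ++ deg n' :: n'') = rev n'' ++ deg (rev n') :: rev n)
    (ez : rev z = z') X Y
    (f : hom (seqob U (rev n'' ++ deg (rev n') :: rev n) X) Y) :
  transpose ez (f ∘ whisker theta e' X) = cowhisker delta e Y ∘ transpose eN f.
Proof.
pose W := seqob U (rev n) X.
pose D : C := U (deg (rev n')) W.
pose S := seqob U (rev n'') D.
have e1 : rev n'' ++ ([::] ++ deg (rev n') :: rev n) = rev n'' ++ deg (rev n') :: rev n by [].
have e2 : ([::] ++ deg (rev n') :: [::]) ++ rev n = [::] ++ deg (rev n') :: rev n by [].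
pose iD : hom (seqob U ([::] ++ deg (rev n') :: [::]) W) D := idm D.
pose c := scomp e1 (idm S) (scomp e2 iD (idm W)).
have h : seqob U (rev n'' ++ deg (rev n') :: rev n) X = S by exact: seqob_cat.
have cE : idto h = c.
  rewrite /c /scomp /iD !comp1m seqmap1 comp1m /= !idto_id.
  by rewrite seqmap1 comp1m; apply: idto_irr.
have -> : f = f ∘ idto (esym h) ∘ c.
  by rewrite -cE -compA idto_comp idto_id compm1.
move: (f ∘ _) => {}f; rewrite -compA !(transpose_comp _ _ f) [RHS]compA.
rewrite -(cowhisker_nat _ e f) -[RHS]compA.
congr (_ ∘ _).
have e3 : rev n'' ++ (rev n' ++ rev n) = z' by [].
have -> : c ∘ whisker theta e' X
    = scomp e3 (idm S) (scomp (erefl (rev n' ++ rev n)) (theta (rev n') W) (idm W)).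
  rewrite /c (wh_scompl theta e' e1 (cats0 _) e3 (erefl : [::] ++ rev n' ++ rev n = _)).
  congr scomp.
  have e6 : [::] ++ rev n' ++ [::] = rev n' by rewrite cats0.
  rewrite (wh_scompr theta (n := [::]) (w1 := [::]) _ e2 erefl erefl e6) (whisker_nil e6 erefl).
  by rewrite comp1m /= compm1.
have eA : (n ++ n') ++ n'' = z by rewrite -catA.
have eB : rev (n ++ n') = rev n' ++ rev n by rewrite rev_cat.
rewrite (transpose_scomp eA e3 eB erefl ez).
rewrite (transpose_scomp erefl erefl erefl erefl eB).
have eC : (n ++ deg n' :: [::]) ++ n'' = n ++ deg n' :: n'' by rewrite -catA.
have eD : rev (n ++ deg n' :: [::]) = deg (rev n') :: rev n by rewrite rev_cat deg_rev.
have e7 : rev [:: deg n'] = [:: deg (rev n')] by rewrite deg_rev.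
rewrite (transpose_scomp eC e1 eD erefl eN).
rewrite (transpose_scomp erefl e2 erefl e7 eD).
have e8 : n ++ n' ++ [::] = n ++ n' by rewrite cats0.
have e9 : [::] ++ n' ++ [::] = n' by rewrite cats0.
rewrite (wh_sccompr delta e eC erefl eA e8).
rewrite (wh_sccompl delta (n1 := [::]) e8 erefl (cats0 _) erefl e9).
congr sccomp; congr sccomp.
rewrite (cowhisker_nil e9 erefl) comp1m.
exact: theta_transpose.
Qed.

End Transpose.

(** * Evenness, signs and the comonad of mates *)

Section EvenSigns.
Variable K : fieldType.

Lemma sg_evenl (q : nat) (x : int) : ~~ odd q -> sg (q%:Z * x) = 1 :> K.
Proof. by move=> oq; rewrite sg_natM (negbTE oq). Qed.

Lemma sg_evenr (q : nat) (x : int) : ~~ odd q -> sg (x * q%:Z) = 1 :> K.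
Proof. by rewrite mulrC; apply: sg_evenl. Qed.

End EvenSigns.

Section AdjointSystems.
Variables (K : fieldType) (C : lincat K) (U V : int -> lfunctor C).
Variable adj : forall n, adjunction (U n) (V n).
Variable theta : forall n, nat_trans (seqfun U n) (U (deg n)).
Let delta := adj_delta adj theta.
Hypothesis theta_even : forall n X, odd (size n) -> theta n X = 0.

Lemma delta_even n X : odd (size n) -> delta n X = 0.
Proof.
move=> on; have h : deg (rev n) = deg n by rewrite deg_rev.
have := deltaE adj theta (erefl (rev n)) erefl h X.
rewrite {1}/icast compm1 => ->.
by rewrite theta_even ?size_rev // (lin0 (comp_linr _)) transpose0.
Qed.

Lemma whisker_even n n' n'' z (e : n ++ n' ++ n'' = z) X :
  odd (size n') -> whisker theta e X = 0.
Proof.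
move=> on; rewrite /whisker theta_even // (lin0 (@seqmap_lin _ _ _ _ _ _)).
by rewrite (lin0 (comp_linr _)) (lin0 (comp_linl _)).
Qed.

Lemma cowhisker_even n n' n'' z (e : n ++ n' ++ n'' = z) X :
  odd (size n') -> cowhisker delta e X = 0.
Proof.
move=> on; rewrite /cowhisker delta_even // (lin0 (@seqmap_lin _ _ _ _ _ _)).
by rewrite (lin0 (comp_linr _)) (lin0 (comp_linl _)).
Qed.

Lemma rev_insert n n' n'' :
  rev (n ++ deg n' :: n'') = rev n'' ++ deg (rev n') :: rev n.
Proof. by rewrite rev_cat rev_cons cat_rcons deg_rev. Qed.

Lemma sumz_rev n : sumz (rev n) = sumz n.
Proof. by have := deg_rev n; rewrite /deg size_rev => /addIr. Qed.

(* With everything even, the signs of the monad relation for [rev z] and of the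
   comonad relation for [z] agree on the nonzero terms. *)
Lemma Ainf_comonad_adj : Ainf_monad theta -> Ainf_comonad delta.
Proof.
move=> mon z X z0.
pose D := sumz z + (3 - (size z)%:Z).
have DE : sumz (rev z) + (3 - (size (rev z))%:Z) = D by rewrite sumz_rev size_rev.
have rz0 : rev z <> [::] by move=> h; apply: z0; rewrite -[z]revK h.
(* A mate is the transpose of θ followed by the counit, with θ taken at [V D X]. So the monad
   relation is used at that object, and [ph] composes with the counit and transposes. *)
pose ph (f : hom (seqob U (rev z) (V D X)) _) := transpose adj (erefl (rev z))
  (adjl (adj D) (idm (V D X)) ∘ (icast (fun i => U i (V D X)) DE ∘ f)).
have ph_lin : linear ph.
  by move=> k f g; rewrite /ph comp_linr comp_linr transpose_lin.
have := f_equal ph (mon (rev z) (V D X) rz0).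
rewrite (lin0 ph_lin) => <-; rewrite (lin_sum3 ph_lin).
apply: eq_sum3_rev => n n' n'' e e'; rewrite (linZ ph_lin) !size_rev.
have [on|on] := boolP (odd (size n')).
  rewrite cowhisker_even // whisker_even ?size_rev //.
  by rewrite (lin0 (comp_linr _)) (lin0 ph_lin) !(lin0 (comp_linl _)) !scaler0.
(* As q is even, both signs reduce to (-1)^|n''|: the last block here is the first one of the
   reversed partition. *)
congr (_ *: _).
  by rewrite !sgD !(sg_evenl _ _ on) (sg_evenr _ _ on) !mulr1 mul1r.
have h' : deg (rev n'' ++ deg (rev n') :: rev n) = D by rewrite (deg_split e').
rewrite -[LHS]compA (deltaE adj theta (rev_insert n n' n'') _ h').
rewrite -(transpose_whisker adj theta e e' _ (erefl (rev z))) /ph.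
congr (transpose _ _ _); move: (whisker theta e' _) => wk.
rewrite -[LHS]compA -[LHS]compA; congr (_ ∘ _).
rewrite -[icast _ _ ∘ _ ∘ wk]compA [RHS]compA /icast idto_comp.
by congr (_ ∘ _); apply: idto_irr.
Qed.

End AdjointSystems.

(** * The monad relation for A ⊗ F(-) *)

Section TensorMonadRelation.
Variables (K : fieldType) (C : lincat K) (T : copowers C).
Variables (A : Ainf_algebra K) (F : nonunital_monad C).
Variables (G : lfunctor C) (FG : adjunction F G).

Let U := U_AF T A F.
Let theta := theta_AF T A FG.

(** Empty middle blocks have to be excluded from termwise comparisons, since [insert_map] would
    insert the junk value 0 of [numul_pow] there. *)
Lemma eq_sum3_nonnil (W : zmodType) z (t t' : forall n n' n'' : seq int, n ++ n' ++ n'' = z -> W) :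
  (forall n n' n'' e, ~~ nilp n' -> t n n' n'' e = t' n n' n'' e) -> sum3 t = sum3 t'.
Proof.
move=> E; apply: eq_sum2 => n w e; apply: eq_sum2 => n' n'' e'.
by case: (boolP (nilp n')) => // nn; rewrite E.
Qed.

(* The junk value 0 at [k = 0] matches [theta_AF_app [::] = 0]. *)
Definition numul_pow k X : hom (iterob F k X) (F X) :=
  if k is k'.+1 then numul_iter F k' X else 0.

Lemma numul_powS k X : (0 < k)%N ->
  numul_pow k.+1 X = numul F X ∘ fmap F (numul_pow k X).
Proof. by case: k. Qed.

Lemma numul_pow_nat k X Y (f : hom X Y) :
  numul_pow k Y ∘ itermap F k f = fmap F f ∘ numul_pow k X.
Proof.
case: k => [|k]; last exact: numul_iter_nat.
by rewrite /= (lin0 (comp_linl _)) (lin0 (comp_linr _)).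
Qed.

Lemma iterob_cat p q X : iterob F (p + q) X = iterob F p (iterob F q X).
Proof. by elim: p => //= p ->. Qed.

(** One use of associativity, then naturality of the multiplication at the shorter iterate. *)
Lemma numul_iter_mul q X :
  numul_iter F q X ∘ numul F (iterob F q X) = numul F X ∘ fmap F (numul_iter F q X).
Proof.
elim: q => [|q IH] /=; first by rewrite comp1m fmap1 compm1.
rewrite fmapM compA -numulA -[LHS]compA -[RHS]compA; congr (_ ∘ _).
by rewrite -(nnat (numul F)).
Qed.

(** General associativity, by removing the outermost factor: [numul_iter_mul] moves its
    multiplication past the product of the inner factors. *)
Lemma numul_iterD p q X (h : iterob F (p + q).+1 X = iterob F p.+1 (iterob F q X)) :
  numul_iter F q X ∘ numul_iter F p (iterob F q X) ∘ idto h = numul_iter F (p + q) X.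
Proof.
elim: p h => [|p IH] h; first by rewrite /= idto_id !compm1.
have h' : iterob F (p + q).+1 X = iterob F p.+1 (iterob F q X).
  exact: (iterob_cat p.+1).
rewrite /= [X in X ∘ _]compA numul_iter_mul -(fmap_idto (F := F) h') -!compA -!fmapM.
by rewrite compA IH.
Qed.

(** The F-part of a whiskered operation, namely F^p applied to a q-fold multiplication;
    [elts_insert] is the corresponding A-part. *)
Fixpoint insert_map (n n' n'' : seq int) X :
    hom (iterob F (size (n ++ n' ++ n'')) X) (iterob F (size (n ++ deg n' :: n'')) X) :=
  match n with
  | [::] => numul_pow (size n') (iterob F (size n'') X)
     ∘ idto (etrans (f_equal (iterob F ^~ X) (size_cat n' n'')) (iterob_cat _ _ X))
  | _ :: m => fmap F (insert_map m n' n'' X)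
  end.

(** This makes the F-parts of all terms in the monad relation equal, so that they factor out and
    leave the A_∞-relation. *)
Lemma insert_mapE n n' n'' X : ~~ nilp n' ->
  numul_pow (size (n ++ deg n' :: n'')) X ∘ insert_map n n' n'' X
  = numul_pow (size (n ++ n' ++ n'')) X.
Proof.
move=> n'0; elim: n => [|a n IH].
  case: n' n'0 => // b n' _; rewrite compA /=.
  move: (etrans _ _) => /=; rewrite size_cat => h; exact: numul_iterD.
rewrite [size _]/= [size (_ :: _ ++ _)]/= !numul_powS; last first.
- by rewrite size_cat /= addnS.
- by rewrite !size_cat addnCA ltn_addr // lt0n.
by rewrite -[LHS]compA -fmapM IH.
Qed.

Lemma tens_seq_in_cat n' n'' X (w : elts A (n' ++ n''))
    (h : iterob F (size (n' ++ n'')) X = iterob F (size n') (iterob F (size n'') X)) :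
  idto (seqob_cat U n' n'' X) ∘ tens_seq_in T F X w
  = tens_seq_in T F (seqob U n'' X) (elts_split w).1
     ∘ itermap F (size n') (tens_seq_in T F X (elts_split w).2) ∘ idto h.
Proof.
elim: n' w h => [|a n' IH] w h.
  by rewrite /= !idto_id !comp1m !compm1.
have h' : iterob F (size (n' ++ n'')) X = iterob F (size n') (iterob F (size n'') X).
  by rewrite size_cat iterob_cat.
rewrite -(fmap_idto (F := U a) (seqob_cat U n' n'' X)) -(fmap_idto (F := F) h').
rewrite /= compA tens_descK; last exact: tens_in_comp_lin.
have := IH w.2 h'; case: (elts_split w.2) => x y /= E.
by rewrite -!compA -!fmapM E compA.
Qed.

Lemma theta_AF_in n X (w : elts A n) :
  theta n X ∘ tens_seq_in T F X w = tens_in T (F X) (amul w) ∘ numul_pow (size n) X.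
Proof.
case: n w => [|a n] w; last exact: theta_AF_appE.
by rewrite (lin0 (comp_linl _)) (lin0 (comp_linr _)).
Qed.

(** On elements, whiskering acts separately on A and on F. The induction on [n] removes the outer
    functor; in the base case the elements are split in two and θ is evaluated on the first part. *)
Lemma whisker_tens_seq_in n n' n'' (e : n ++ n' ++ n'' = n ++ n' ++ n'') X
    (w : elts A (n ++ n' ++ n'')) :
  whisker theta e X ∘ tens_seq_in T F X w
  = tens_seq_in T F X (elts_insert (@amul K A) w) ∘ insert_map n n' n'' X.
Proof.
elim: n e w => [|a n IH] e w.
  rewrite /whisker [idto (esym _)]idto_id comp1m.
  have -> : idto (seqob_split3 U e X) = idto (seqob_cat U n' n'' X) by apply: idto_irr.
  have h : iterob F (size (n' ++ n'')) X = iterob F (size n') (iterob F (size n'') X).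
    by rewrite size_cat iterob_cat.
  rewrite -compA (tens_seq_in_cat (n' := n') _ h) /=.
  rewrite (idto_irr (etrans _ _) h).
  case: (@elts_split _ A n' n'' w) => x y /=.
  rewrite [LHS]compA [X in X ∘ _ = _]compA.
  have -> := theta_AF_in (seqob U n'' X) x.
  by rewrite -[X in X ∘ _ = _]compA numul_pow_nat !compA.
have e0 : n ++ n' ++ n'' = n ++ n' ++ n'' by [].
(* The prefix split off is the one-letter word [[:: a]], for which both casts are identities. *)
have := @whisker_catl _ _ _ theta [:: a] n _ n' n'' _ _ e erefl e0 X erefl erefl.
rewrite comp1m compm1 => ->.
rewrite /= compA tens_descK; last exact: tens_in_comp_lin.
by rewrite -compA -fmapM (IH e0) fmapM compA.
Qed.

Lemma icast_tens_in X i j (E : i = j) (x : A i) :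
  icast (fun i => U i X) E ∘ tens_in T (F X) x = tens_in T (F X) (eq_rect i (agr A) x j E).
Proof. by case: j / E; rewrite /icast idto_id comp1m. Qed.

Lemma theta_whisker_in n n' n'' z (e : n ++ n' ++ n'' = z) X (w : elts A z) :
  ~~ nilp n' ->
  icast (fun i => U i X) (deg_split e) ∘ theta (n ++ deg n' :: n'') X
    ∘ whisker theta e X ∘ tens_seq_in T F X w
  = tens_in T (F X) (eq_rect _ (agr A)
      (amul (elts_insert (@amul K A) (eq_rect _ (elts A) w _ (esym e)))) _ (deg_split e))
    ∘ numul_pow (size z) X.
Proof.
case: z / e w => w n'0; rewrite -icast_tens_in.
rewrite -[LHS]compA whisker_tens_seq_in [LHS]compA.
rewrite -[_ ∘ tens_seq_in _ _ _ _]compA theta_AF_in [icast _ _ ∘ (_ ∘ _)]compA.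
by rewrite -[LHS]compA insert_mapE.
Qed.

Lemma theta_AF_monad : Ainf_monad theta.
Proof.
move=> z X _; apply: (tens_seq_ext FG) => w.
rewrite (lin0 (comp_linl _)) (lin_sum3 (comp_linl _)).
(* [h] is linear, so it carries the A_∞-relation evaluated at [w] to the monad relation restricted
   along [w]. *)
pose h (x : A (sumz z + (3 - (size z)%:Z))) := tens_in T (F X) x ∘ numul_pow (size z) X.
have h_lin : linear h by exact: tens_in_comp_lin.
rewrite -(lin0 h_lin) -(amul_rel w) (lin_sum3 h_lin).
apply: eq_sum3_nonnil => n n' n'' e n'0.
by rewrite (linZ (comp_linl _)) (linZ h_lin) theta_whisker_in.
Qed.

Lemma theta_AF_even n X : Ainf_even A -> odd (size n) -> theta n X = 0.
Proof.
move=> hA on; apply: (tens_seq_ext FG) => w.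
rewrite theta_AF_in hA // (lin0 (tens_in_lin _ _)).
by rewrite !(lin0 (comp_linl _)).
Qed.

End TensorMonadRelation.

(** * A criterion for strict isomorphism of categories *)

Section CatIsoCriterion.

(** Equality of functors compares morphisms whose endpoints are only propositionally equal, hence
    this transport in both endpoints. *)
Definition hcast (C : category) (X X' Y Y' : C) (e : X = X') (e' : Y = Y')
    (f : chom X Y) : chom X' Y' :=
  eq_rect _ (fun Z => chom Z Y') (eq_rect _ (fun Z => chom X Z) f _ e') _ e.

Lemma hcast_id (C : category) (X Y : C) (e : X = X) (e' : Y = Y) (f : chom X Y) :
  hcast e e' f = f.
Proof. by rewrite (Prop_irrelevance e erefl) (Prop_irrelevance e' erefl). Qed.

Lemma hcast_cid (C : category) (X X' : C) (e e' : X = X') : hcast e e' (cid X) = cid X'.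
Proof. by subst X'; rewrite hcast_id. Qed.

Lemma hcast_comp (C : category) (X Y Z X' Y' Z' : C) (eX : X = X') (eY : Y = Y')
    (eZ : Z = Z') (g : chom Y Z) (f : chom X Y) :
  hcast eX eZ (ccomp g f) = ccomp (hcast eY eZ g) (hcast eX eY f).
Proof. by case: X' / eX; case: Y' / eY; case: Z' / eZ. Qed.

Lemma hcast_hcast (C : category) (X Y X' Y' X'' Y'' : C) (e1 : X = X') (e2 : X' = X'')
    (e1' : Y = Y') (e2' : Y' = Y'') (f : chom X Y) :
  hcast e2 e2' (hcast e1 e1' f) = hcast (etrans e1 e2) (etrans e1' e2') f.
Proof. by case: X'' / e2; case: Y'' / e2'. Qed.

Lemma cfmap_hcast (C D : category) (F : cfunctor C D) (X X' Y Y' : C) (e : X = X')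
    (e' : Y = Y') (f : chom X Y) :
  cfmap F (hcast e e' f) = hcast (f_equal F e) (f_equal F e') (cfmap F f).
Proof. by case: X' / e; case: Y' / e'. Qed.

Lemma cfunctor_eq (C D : category) (F F' : cfunctor C D) (E : forall X, F X = F' X) :
  (forall X Y (f : chom X Y), hcast (E X) (E Y) (cfmap F f) = cfmap F' f) -> F = F'.
Proof.
case: F F' E => [o m m1 mM] [o' m' m1' mM'] /= E.
have oo : o = o' by apply/functional_extensionality_dep.
subst o' => mm'.
have mE : m = m'.
  do 3![apply/functional_extensionality_dep => ?]; rewrite -mm'.
  by rewrite hcast_id.
by subst m'; congr CFunctor; exact: Prop_irrelevance.
Qed.

(** The inverse is obtained by choice, on objects from surjectivity and on morphisms from fullness;
    its functor laws follow from faithfulness. No inverse construction from comodules to modules is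
    then needed. *)
Lemma cat_iso_bij (C D : category) (F : cfunctor C D) :
  (forall X X', F X = F X' -> X = X') -> (forall Y, exists X, F X = Y) ->
  (forall X Y (f f' : chom X Y), cfmap F f = cfmap F f' -> f = f') ->
  (forall X Y (g : chom (F X) (F Y)), exists f, cfmap F f = g) ->
  cat_iso C D.
Proof.
move=> Finj Fsurj faith full.
have [o oK] := choice Fsurj.
(* The morphism is first transported to the images of the chosen objects, where fullness applies. *)
pose m X Y (g : chom X Y) :=
  sval (boolp.cid (full _ _ (hcast (esym (oK X)) (esym (oK Y)) g))).
have mE X Y (g : chom X Y) : cfmap F (m X Y g) = hcast (esym (oK X)) (esym (oK Y)) g.
  by rewrite /m; case: boolp.cid.
have m1 X : m X X (cid X) = cid (o X) by apply: faith; rewrite mE hcast_cid cfmap1.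
have mM X Y Z (g : chom Y Z) (f : chom X Y) :
    m X Z (ccomp g f) = ccomp (m Y Z g) (m X Y f).
  by apply: faith; rewrite cfmapM !mE (hcast_comp _ (esym (oK Y))).
pose H := CFunctor m1 mM; exists F, H; split.
  have E X : cfunctor_comp H F X = cfunctor_id C X by apply: Finj; exact: oK.
  apply: (cfunctor_eq (E := E)) => X Y f.
  by apply: faith; rewrite cfmap_hcast mE hcast_hcast hcast_id.
have E X : cfunctor_comp F H X = cfunctor_id D X by exact: oK.
apply: (cfunctor_eq (E := E)) => X Y f.
by rewrite [cfmap _ f]mE hcast_hcast hcast_id.
Qed.

End CatIsoCriterion.

(** * Reindexing dependent families along an involution *)

Section InvolutiveReindexing.
Variables (I : Type) (s : I -> I) (T T' : I -> Type).
Variable b : forall i, T (s i) -> T' i.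
Hypothesis sK : involutive s.

Lemma involutive_reindex_inj (f f' : forall i, T i) : (forall i, injective (@b i)) ->
  (forall i, b (f (s i)) = b (f' (s i))) -> forall i, f i = f' i.
Proof. by move=> b_inj ff' i; rewrite -(sK i); apply: b_inj. Qed.

Lemma involutive_reindex_surj (g : forall i, T' i) : (forall i y, exists x, @b i x = y) ->
  exists f : forall i, T i, forall i, b (f (s i)) = g i.
Proof.
move=> b_surj.
(* The index [i] equals [s (s i)] only propositionally, so the value at [i] is required to fit every
   [j] with [i = s j]; the only such [j] is [s i]. *)
have pre i : exists x : T i, forall j (e : i = s j), b (eq_rect i T x (s j) e) = g j.
  rewrite -(sK i); have [x bx] := b_surj (s i) (g (s i)); exists x => j e.
  have ij : j = s i by rewrite -(sK j) -e sK.
  by subst j; rewrite (Prop_irrelevance e erefl).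
exists (fun i => sval (boolp.cid (pre i))) => i.
by case: boolp.cid => x /= /(_ i erefl).
Qed.

End InvolutiveReindexing.

(** The sum and the shift 2 - k cancel. Hence reversing [n] and replacing [l] by [- mdeg n l] is an
    involution on indices, the one relating modules to comodules. *)
Lemma mdeg_op n l : mdeg (rev n) (- mdeg n l) = - l.
Proof. by rewrite /mdeg sumz_rev size_rev; lia. Qed.

Lemma adeg_op n l : adeg (rev n) (- adeg n l) = - l.
Proof. by rewrite /adeg sumz_rev size_rev; lia. Qed.

(** * Dual families of structure maps *)

Section DualFamilies.
Variables (K : fieldType) (C : lincat K) (U V : int -> lfunctor C).
Variable adj : forall n, adjunction (U n) (V n).
Variable theta : forall n, nat_trans (seqfun U n) (U (deg n)).
Let delta := adj_delta adj theta.

Definition opp_fam (M : int -> C) (l : int) : C := M (- l).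

Lemma opp_fam_inj : injective opp_fam.
Proof.
move=> M M' E; apply/functional_extensionality_dep => l.
by rewrite -[l]opprK; exact: (f_equal (fun N => N (- l)) E).
Qed.

Lemma opp_fam_surj P : exists M, opp_fam M = P.
Proof.
by exists (opp_fam P); apply/functional_extensionality_dep => l; rewrite /opp_fam opprK.
Qed.

Lemma icast_icast (M : int -> C) i j k (e : i = j) (e' : j = k) :
  icast M e' ∘ icast M e = icast M (etrans e e').
Proof. by rewrite /icast idto_comp; apply: idto_irr. Qed.

Lemma icast_irr (M : int -> C) i j (e e' : i = j) : icast M e = icast M e'.
Proof. exact: idto_irr. Qed.

Lemma icast_id (M : int -> C) i (e : i = i) : icast M e = idm (M i).
Proof. exact: idto_id. Qed.

Lemma icast_inj (M : int -> C) i j (e : i = j) X (f g : hom X (M i)) :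
  icast M e ∘ f = icast M e ∘ g -> f = g.
Proof. by case: j / e; rewrite icast_id !comp1m. Qed.

Lemma transpose_inj n w (e : rev n = w) X Y :
  injective (@transpose K C U V adj n w e X Y).
Proof. exact: can_inj (@transposeK _ _ _ _ adj _ _ e _ _). Qed.

Section Family.
Variable d : seq int -> int -> int.
Hypothesis d_op : forall n l, d (rev n) (- d n l) = - l.

(** The index change is an involution, hence onto; statements about a family can be checked at the
    indices that its dual reads. *)
Lemma dual_index_ind (P : seq int -> int -> Prop) :
  (forall n l, P (rev n) (- d n l)) -> forall n l, P n l.
Proof. by move=> h n l; have := h (rev n) (- d n l); rewrite revK d_op opprK. Qed.

Section Dual.
Variables M M' : int -> C.

(* The dual of maps [U_n M_l -> M'_(d n l)] with respect to [M_(-l)] and [M'_(-l)]: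
   negating the indices is what makes the degrees match. *)
Definition dual (f : forall n l, hom (seqob U n (M l)) (M' (d n l))) n l :
    hom (opp_fam M (d n l)) (seqob V n (opp_fam M' l)) :=
  transpose adj (erefl (rev n)) (icast M' (d_op n l) ∘ f (rev n) (- d n l)).

Lemma dualE (f : forall n l, hom (seqob U n (M l)) (M' (d n l))) n w (e : rev n = w) l k
    (h : k = d n l) (h' : d w (- k) = - l) :
  dual f n l ∘ icast (opp_fam M) h = transpose adj e (icast M' h' ∘ f w (- k)).
Proof.
subst k w; rewrite icast_id compm1 /dual.
by rewrite (icast_irr _ h' (d_op n l)).
Qed.

Lemma dual_inj (f g : forall n l, hom (seqob U n (M l)) (M' (d n l))) :
  dual f = dual g -> f = g.
Proof.
move=> fg; apply/functional_extensionality_dep => n.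
apply/functional_extensionality_dep => l; move: n l.
apply: dual_index_ind => n l.
have := f_equal (fun h => h n l) fg.
by move=> /transpose_inj; apply: (@icast_inj M' _ _ (d_op n l)).
Qed.

Lemma dual_surj (g : forall n l, hom (opp_fam M (d n l)) (seqob V n (opp_fam M' l))) :
  exists f, dual f = g.
Proof.
(* Pairs (n, l) serve as the single index of the reindexing lemma; at each index a preimage is given
   by [untranspose]. *)
pose s (i : seq int * int) := (rev i.1, - d i.1 i.2).
have sK : involutive s by case=> n l; rewrite /s /= revK d_op opprK.
pose T (i : seq int * int) : Type := hom (seqob U i.1 (M i.2)) (M' (d i.1 i.2)).
pose T' (i : seq int * int) : Type :=
  hom (opp_fam M (d i.1 i.2)) (seqob V i.1 (opp_fam M' i.2)).
pose b i (x : T (s i)) : T' i :=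
  transpose adj (erefl (rev i.1)) (icast M' (d_op i.1 i.2) ∘ x).
have [|f fE] := @involutive_reindex_surj _ s T T' b sK (fun i => g i.1 i.2).
  move=> [n l] y; exists (icast M' (esym (d_op n l)) ∘ untranspose adj (erefl (rev n)) y).
  by rewrite /b /= compA icast_icast icast_id comp1m untransposeK.
exists (fun n l => f (n, l)).
apply/functional_extensionality_dep => n; apply/functional_extensionality_dep => l.
exact: (fE (n, l)).
Qed.

(** Transfers evenness of actions and oddness of ∞-morphisms in both directions. *)
Lemma dual_eq0 (f : forall n l, hom (seqob U n (M l)) (M' (d n l))) n l :
  dual f n l = 0 <-> f (rev n) (- d n l) = 0.
Proof.
split=> h; last by rewrite /dual h (lin0 (comp_linr _)) transpose0.
apply: (@icast_inj M' _ _ (d_op n l)); rewrite (lin0 (comp_linr _)).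
by apply: (transpose_inj (e := erefl)); rewrite [LHS]h transpose0.
Qed.

Lemma dual_whisker (f : forall n l, hom (seqob U n (M l)) (M' (d n l)))
    n n' n'' z l k (e : n ++ n' ++ n'' = z) (e' : rev n'' ++ rev n' ++ rev n = rev z)
    (h : k = d (n ++ deg n' :: n'') l)
    (h' : d (rev n'' ++ deg (rev n') :: rev n) (- k) = - l) :
  cowhisker delta e (opp_fam M' l) ∘ dual f (n ++ deg n' :: n'') l ∘ icast (opp_fam M) h
  = transpose adj (erefl (rev z))
      (icast M' h' ∘ f (rev n'' ++ deg (rev n') :: rev n) (- k)
         ∘ whisker theta e' (M (- k))).
Proof.
by rewrite -[LHS]compA (dualE f (rev_insert n n' n'') h h') -transpose_whisker.
Qed.

End Dual.
End Family.

Lemma scomp_icast (d : seq int -> int -> int) (M M' : int -> C)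
    (f : forall n l, hom (seqob U n (M l)) (M' (d n l)))
    n n' z (e : n ++ n' = z) i j k (E : i = j) (h : d n j = k) (h' : d n i = k)
    X (g : hom (seqob U n' X) (M i)) :
  scomp e (icast M' h ∘ f n j) (icast M E ∘ g) = icast M' h' ∘ scomp e (f n i) g.
Proof.
subst j; rewrite (icast_irr _ h h') icast_id comp1m.
by case: k / h' {h}; rewrite icast_id !comp1m.
Qed.

(** The dual of [g] reads it at [- k], whose target index is [- d1 m' l] by [d2_op]; this is where
    the dual of [f] reads [f], so the two compose and [transpose_scomp] applies. *)
Lemma dual_scomp (d1 d2 : seq int -> int -> int)
    (d1_op : forall n l, d1 (rev n) (- d1 n l) = - l)
    (d2_op : forall n l, d2 (rev n) (- d2 n l) = - l)
    (M1 M2 M3 : int -> C)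
    (f : forall n l, hom (seqob U n (M2 l)) (M3 (d1 n l)))
    (g : forall n l, hom (seqob U n (M1 l)) (M2 (d2 n l)))
    m m' z l k (e : m ++ m' = z) (e' : rev m' ++ rev m = rev z)
    (h : k = d2 m (d1 m' l)) (h' : d1 (rev m') (d2 (rev m) (- k)) = - l) :
  sccomp e (dual d2_op g m (d1 m' l)) (dual d1_op f m' l) ∘ icast (opp_fam M1) h
  = transpose adj (erefl (rev z))
      (icast M3 h' ∘ scomp e' (f (rev m') (d2 (rev m) (- k))) (g (rev m) (- k))).
Proof.
subst k; rewrite icast_id compm1 /dual.
by rewrite -(transpose_scomp adj e e' erefl erefl erefl) (scomp_icast f e' _ _ h').
Qed.

End DualFamilies.

(** * Even modules and even comodules *)

Section ModuleComodule.
Variables (K : fieldType) (C : lincat K) (U V : int -> lfunctor C).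
Variable adj : forall n, adjunction (U n) (V n).
Variable theta : forall n, nat_trans (seqfun U n) (U (deg n)).
Let delta := adj_delta adj theta.
Hypothesis theta_even : forall n X, odd (size n) -> theta n X = 0.

Section Relations.
Variable M : int -> C.
Variable f : forall n l, hom (seqob U n (M l)) (M (mdeg n l)).
Hypothesis f_even : forall n l, odd (size n).+1 -> f n l = 0.
Let f' := dual adj mdeg_op f.

Let mrel (z : seq int) (l : int) : Prop :=
    sum3 (fun n n' n'' (e : n ++ n' ++ n'' = z) =>
      sg ((size n)%:Z + (size n')%:Z * (size n'').+1%:Z + (size n')%:Z * sumz n) *:
        (icast M (mdeg_split3 l e)
           ∘ f (n ++ deg n' :: n'') l ∘ whisker theta e (M l)))
    = - sum2 (fun m m' (e : m ++ m' = z) =>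
      sg ((size m)%:Z + (size m').+1%:Z * sumz m) *:
        (icast M (mdeg_split2 l e) ∘ scomp e (f m (mdeg m' l)) (f m' l))).

Let crel (z : seq int) (l : int) : Prop :=
    sum3 (fun n n' n'' (e : n ++ n' ++ n'' = z) =>
      sg ((size n)%:Z * (size n')%:Z + (size n'').+1%:Z + (size n')%:Z * sumz n) *:
        (cowhisker delta e (opp_fam M l) ∘ f' (n ++ deg n' :: n'') l
           ∘ icast (opp_fam M) (esym (mdeg_split3 l e))))
    = - sum2 (fun m m' (e : m ++ m' = z) =>
      sg ((size m)%:Z * (size m').+1%:Z + (size m').+1%:Z * sumz m) *:
        (sccomp e (f' m (mdeg m' l)) (f' m' l)
           ∘ icast (opp_fam M) (esym (mdeg_split2 l e)))).

(** Each side of the comodule relation is minus the [ph]-image of the same side of the module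
    relation for the reversed tuple. The common sign cancels and [ph] is injective. *)
Lemma crel_mrel z l :
  crel z l <-> mrel (rev z) (- (sumz z + l + (2 - (size z)%:Z))).
Proof.
set k := sumz z + l + (2 - (size z)%:Z).
have kE : sumz (rev z) + - k + (2 - (size (rev z))%:Z) = - l.
  by rewrite sumz_rev size_rev /k; lia.
pose ph (x : hom (seqob U (rev z) (M (- k))) _) :=
  transpose adj (erefl (rev z)) (icast M kE ∘ x).
have ph_lin : linear ph by move=> c x y; rewrite /ph comp_linr transpose_lin.
have ph_inj : injective ph by move=> x y /transpose_inj; apply: (@icast_inj _ _ M _ _ kE).
have phN x : ph (- x) = - ph x by rewrite -scaleN1r (linZ ph_lin) scaleN1r.
have E3 : sum3 (fun n n' n'' (e : n ++ n' ++ n'' = z) =>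
      sg ((size n)%:Z * (size n')%:Z + (size n'').+1%:Z + (size n')%:Z * sumz n) *:
        (cowhisker delta e (opp_fam M l) ∘ f' (n ++ deg n' :: n'') l
           ∘ icast (opp_fam M) (esym (mdeg_split3 l e))))
  = - ph (sum3 (fun n n' n'' (e : n ++ n' ++ n'' = rev z) =>
      sg ((size n)%:Z + (size n')%:Z * (size n'').+1%:Z + (size n')%:Z * sumz n) *:
        (icast M (mdeg_split3 (- k) e)
           ∘ f (n ++ deg n' :: n'') (- k) ∘ whisker theta e (M (- k))))).
  rewrite -phN -scaleN1r sum3Z (lin_sum3 ph_lin).
  apply: eq_sum3_rev => n n' n'' e e'; rewrite !(linZ ph_lin) scalerA !size_rev.
  have [on|on] := boolP (odd (size n')).
    rewrite (cowhisker_even adj theta_even) // (whisker_even theta_even) ?size_rev //.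
    by rewrite (lin0 (comp_linr _)) (lin0 ph_lin) !(lin0 (comp_linl _)) !scaler0.
  (* With q even, the comodule sign is (-1)^(|n''|+1) and the module sign of the reversed partition
     is (-1)^|n''|, whence the factor -1. *)
  congr (_ *: _).
    rewrite !sgD !(sg_evenl _ _ on) (sg_evenr _ _ on) !mulr1 mul1r -addn1 PoszD sgD.
    by rewrite [sg 1](_ : _ = -1) ?mulrN1 ?mulN1r // /sg expr1z.
  have h' : mdeg (rev n'' ++ deg (rev n') :: rev n) (- k) = - l.
    by rewrite (mdeg_split3 _ e').
  rewrite (dual_whisker adj theta _ _ _ e' _ h') /ph.
  congr (transpose _ _ _); rewrite [RHS]compA; congr (_ ∘ _).
  by rewrite [RHS]compA icast_icast; congr (_ ∘ _); apply: icast_irr.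
have E2 : sum2 (fun m m' (e : m ++ m' = z) =>
      sg ((size m)%:Z * (size m').+1%:Z + (size m').+1%:Z * sumz m) *:
        (sccomp e (f' m (mdeg m' l)) (f' m' l)
           ∘ icast (opp_fam M) (esym (mdeg_split2 l e))))
  = - ph (sum2 (fun m m' (e : m ++ m' = rev z) =>
      sg ((size m)%:Z + (size m').+1%:Z * sumz m) *:
        (icast M (mdeg_split2 (- k) e) ∘ scomp e (f m (mdeg m' (- k))) (f m' (- k))))).
  rewrite -phN -scaleN1r sum2Z (lin_sum2 ph_lin).
  apply: eq_sum2_rev => m m' e e'; rewrite !(linZ ph_lin) scalerA !size_rev.
  have h' : mdeg (rev m') (mdeg (rev m) (- k)) = - l.
    by rewrite (mdeg_split2 _ e').
  rewrite (dual_scomp adj mdeg_op mdeg_op f f e e' _ h') /ph compA icast_icast.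
  rewrite (icast_irr _ (etrans _ _) h').
  have [om|om] := boolP (odd (size m).+1).
    rewrite [f (rev m) _]f_even ?size_rev //.
    by rewrite (lin0 (scomp_linr _ _)) (lin0 (comp_linr _)) transpose0 !scaler0.
  have [om'|om'] := boolP (odd (size m').+1).
    rewrite [f (rev m') _]f_even ?size_rev //.
    by rewrite (lin0 (scomp_linl _ _)) (lin0 (comp_linr _)) transpose0 !scaler0.
  (* Now |m| and |m'| are odd: the comodule sign is 1 and the module sign of the reversed partition
     is (-1)^|m'| = -1. *)
  congr (_ *: _).
  rewrite !sgD !(sg_evenl _ _ om) !(sg_evenl _ _ om') (sg_evenr _ _ om') !mulr1 sg_nat.
  by move: om'; rewrite /= negbK => ->; rewrite mulrNN mulr1.
rewrite /crel /mrel E3 E2; split => [/oppr_inj|->]; last by rewrite phN.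
by rewrite -phN; apply: ph_inj.
Qed.

Lemma dual_rel : (forall z l, mrel z l) <-> (forall z l, crel z l).
Proof.
split=> h z l; first by apply/crel_mrel.
have /crel_mrel := h (rev z) (- (sumz z + l + (2 - (size z)%:Z))).
have -> : - (sumz (rev z) + - (sumz z + l + (2 - (size z)%:Z)) + (2 - (size (rev z))%:Z)) = l.
  by rewrite sumz_rev size_rev; lia.
by rewrite revK.
Qed.

End Relations.

Definition comodule_of (M : even_module theta) : even_comodule delta.
Proof.
refine (@EvenComodule K C V delta (opp_fam M) (dual adj mdeg_op (mact M)) _ _).
- exact: (dual_rel (@mact_even _ _ _ _ M)).1 (@mact_rel _ _ _ _ M).
- by move=> n l on; apply/(dual_eq0 adj mdeg_op); apply: mact_even; rewrite size_rev.
Defined.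

Lemma comodule_of_inj : injective comodule_of.
Proof.
case=> [M f f_rel f_ev] [M' f' f'_rel f'_ev] E.
have MM' : M = M' by apply: opp_fam_inj; exact: (f_equal (@pob _ _ _ _) E).
subst M'.
have ff' : f = f'.
  apply: (dual_inj (adj := adj) (d_op := mdeg_op)).
  (* The type of the action depends on the underlying family, so the equality is projected from a
     dependent pair. *)
  pose F P := forall n l, hom (P (mdeg n l)) (seqob V n (P l)).
  have Ep := f_equal (fun N => existT F (pob N) (@cact _ _ _ _ N)) E.
  by have := projT2_eq Ep; rewrite (Prop_irrelevance (projT1_eq Ep) erefl).
by subst f'; congr EvenModule; exact: Prop_irrelevance.
Qed.

Lemma comodule_of_surj N : exists M, comodule_of M = N.
Proof.
case: N => [P r r_rel r_ev].
have [M MP] := opp_fam_surj P; subst P.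
have [f fr] := dual_surj adj mdeg_op r; subst r.
have f_ev n l : odd (size n).+1 -> f n l = 0.
  move: n l; apply: (dual_index_ind mdeg_op) => n l; rewrite size_rev => on.
  by apply/(dual_eq0 adj mdeg_op); apply: r_ev.
exists (EvenModule ((dual_rel f_ev).2 r_rel) f_ev).
by rewrite /comodule_of; congr EvenComodule; exact: Prop_irrelevance.
Qed.

(** Strict morphisms are reindexed by negation and not transposed; naturality of transposition in
    both variables turns one compatibility square into the other. *)
Lemma chmap_actE (M M' : even_module theta) (f : forall l, hom (M l) (M' l)) n l :
  cact (comodule_of M') n l ∘ f (- mdeg n l)
    = seqmap V n (f (- l)) ∘ cact (comodule_of M) n l <->
  f (mdeg (rev n) (- mdeg n l)) ∘ mact M (rev n) (- mdeg n l)
    = mact M' (rev n) (- mdeg n l) ∘ seqmap U (rev n) (f (- mdeg n l)).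
Proof.
rewrite /= /dual -transpose_comp -transpose_pre.
have fE i j (E : i = j) : f j ∘ icast M E = icast M' E ∘ f i.
  by case: j / E; rewrite !icast_id comp1m compm1.
rewrite [X in _ = transpose _ _ X <-> _]compA fE -!compA.
split=> [/transpose_inj E|->//]; symmetry; move: E; exact: (@icast_inj _ _ M' _ _ (mdeg_op n l)).
Qed.

Definition comod_hom_of (M M' : even_module theta) (f : mod_hom M M') :
  comod_hom (comodule_of M) (comodule_of M').
Proof.
refine (@ComodHom _ _ _ _ (comodule_of M) (comodule_of M') (fun l => f (- l)) _).
by move=> n l; apply/chmap_actE; exact: mhom_act.
Defined.

Definition strict_duality : cfunctor (EMe_mod theta) (EMe_comod delta).
Proof.
refine (@CFunctor (EMe_mod theta) (EMe_comod delta) comodule_of comod_hom_of _ _).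
- by move=> M; apply: eq_comod_hom.
- by move=> M1 M2 M3 g f; apply: eq_comod_hom.
Defined.

Lemma EMe_iso : cat_iso (EMe_mod theta) (EMe_comod delta).
Proof.
apply: (cat_iso_bij (F := strict_duality)).
- exact: comodule_of_inj.
- exact: comodule_of_surj.
- move=> M M' f f' E; apply: eq_mod_hom; apply/functional_extensionality_dep => l.
  pose T l : Type := hom (M l) (M' l).
  apply: (@involutive_reindex_inj _ _ T (fun l => T (- l)) (fun l => id)
    (@opprK int) f f') => [i x y //|i].
  have E' : comod_hom_of f = comod_hom_of f' := E.
  exact: (f_equal (fun h => chmap h i) E').
- move=> M M' g.
  pose T l : Type := hom (M l) (M' l).
  have [f fg] := @involutive_reindex_surj _ _ T (fun l => T (- l)) (fun l => id) (@opprK int) g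
    (fun l y => ex_intro _ y erefl).
  have f_act n l : f (mdeg n l) ∘ mact M n l = mact M' n l ∘ seqmap U n (f l).
    move: n l; apply: (dual_index_ind mdeg_op) => n l; apply/chmap_actE.
    by rewrite !fg; exact: (chmap_act g n l).
  exists (ModHom f_act); apply: eq_comod_hom.
  by apply/functional_extensionality_dep => l; exact: fg.
Qed.

(** * Odd ∞-morphisms under duality *)

Section InfRelations.
Variables M1 M2 : even_module theta.
Variable f : forall n l, hom (seqob U n (M1 l)) (M2 (adeg n l)).
Hypothesis f_odd : forall n l, ~~ odd (size n).+1 -> f n l = 0.
Let f' := dual adj adeg_op f.
Let N1 := comodule_of M1.
Let N2 := comodule_of M2.

Let mrel (z : seq int) (l : int) : Prop :=
    sum2 (fun m m' (e : m ++ m' = z) =>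
      sg ((size m)%:Z + (size m').+1%:Z * sumz m) *:
        (icast M2 (adeg_mdeg l e) ∘ scomp e (f m (mdeg m' l)) (mact M1 m' l)))
    + sum3 (fun n n' n'' (e : n ++ n' ++ n'' = z) =>
      sg ((size n)%:Z + (size n')%:Z * (size n'').+1%:Z + (size n')%:Z * sumz n) *:
        (icast M2 (adeg_split3 l e)
           ∘ f (n ++ deg n' :: n'') l ∘ whisker theta e (M1 l)))
    = sum2 (fun p p' (e : p ++ p' = z) =>
        icast M2 (mdeg_adeg l e) ∘ scomp e (mact M2 p (adeg p' l)) (f p' l)).

Let crel (z : seq int) (l : int) : Prop :=
    sum2 (fun m m' (e : m ++ m' = z) =>
      sg ((size m)%:Z * (size m').+1%:Z + (size m').+1%:Z * sumz m) *:
        (sccomp e (f' m (mdeg m' l)) (cact N2 m' l)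
           ∘ icast N1 (esym (adeg_mdeg l e))))
    + sum3 (fun n n' n'' (e : n ++ n' ++ n'' = z) =>
      sg ((size n'').+1%:Z + (size n)%:Z * (size n')%:Z + (size n')%:Z * sumz n) *:
        (cowhisker delta e (N2 l) ∘ f' (n ++ deg n' :: n'') l
           ∘ icast N1 (esym (adeg_split3 l e))))
    = sum2 (fun p p' (e : p ++ p' = z) =>
        sccomp e (cact N1 p (adeg p' l)) (f' p' l)
          ∘ icast N1 (esym (mdeg_adeg l e))).

(** Duality exchanges the two sums involving actions, which lie on opposite sides of the relation,
    and changes the sign of the θ-sum. Moving the latter across the equation restores the form of
    the relation. *)
Lemma crel_mrel_inf z l :
  crel z l <-> mrel (rev z) (- (sumz z + l + (1 - (size z)%:Z))).
Proof.
set k := sumz z + l + (1 - (size z)%:Z).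
have kE : sumz (rev z) + - k + (1 - (size (rev z))%:Z) = - l.
  by rewrite sumz_rev size_rev /k; lia.
pose ph (x : hom (seqob U (rev z) (M1 (- k))) _) :=
  transpose adj (erefl (rev z)) (icast M2 kE ∘ x).
have ph_lin : linear ph by move=> c x y; rewrite /ph comp_linr transpose_lin.
have ph_inj : injective ph by move=> x y /transpose_inj; apply: (@icast_inj _ _ M2 _ _ kE).
have phN x : ph (- x) = - ph x by rewrite -scaleN1r (linZ ph_lin) scaleN1r.
have E1 : sum2 (fun m m' (e : m ++ m' = z) =>
      sg ((size m)%:Z * (size m').+1%:Z + (size m').+1%:Z * sumz m) *:
        (sccomp e (f' m (mdeg m' l)) (cact N2 m' l)
           ∘ icast N1 (esym (adeg_mdeg l e))))
  = ph (sum2 (fun p p' (e : p ++ p' = rev z) =>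
        icast M2 (mdeg_adeg (- k) e) ∘ scomp e (mact M2 p (adeg p' (- k))) (f p' (- k)))).
  rewrite (lin_sum2 ph_lin); apply: eq_sum2_rev => m m' e e'.
  have h' : mdeg (rev m') (adeg (rev m) (- k)) = - l by rewrite (mdeg_adeg _ e').
  rewrite (dual_scomp adj mdeg_op adeg_op (mact M2) f e e' _ h') /ph compA icast_icast.
  rewrite (icast_irr _ (etrans _ _) h').
  have [om|om] := boolP (odd (size m).+1); last first.
    by rewrite f_odd ?size_rev // (lin0 (scomp_linr _ _)) (lin0 (comp_linr _)) transpose0 scaler0.
  have [om'|om'] := boolP (odd (size m').+1).
    rewrite mact_even ?size_rev //.
    by rewrite (lin0 (scomp_linl _ _)) (lin0 (comp_linr _)) transpose0 scaler0.
  (* Only even b = |m'| + 1 is left, so the comodule sign is 1, matching the unsigned sum of the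
     module relation. *)
  by rewrite sgD (sg_evenl _ _ om') (sg_evenr _ _ om') mulr1 scale1r.
have E3 : sum2 (fun p p' (e : p ++ p' = z) =>
        sccomp e (cact N1 p (adeg p' l)) (f' p' l)
          ∘ icast N1 (esym (mdeg_adeg l e)))
  = ph (sum2 (fun m m' (e : m ++ m' = rev z) =>
      sg ((size m)%:Z + (size m').+1%:Z * sumz m) *:
        (icast M2 (adeg_mdeg (- k) e) ∘ scomp e (f m (mdeg m' (- k))) (mact M1 m' (- k))))).
  rewrite (lin_sum2 ph_lin); apply: eq_sum2_rev => m m' e e'.
  have h' : adeg (rev m') (mdeg (rev m) (- k)) = - l by rewrite (adeg_mdeg _ e').
  rewrite (dual_scomp adj adeg_op mdeg_op f (mact M1) e e' _ h').
  rewrite (linZ ph_lin) /ph compA icast_icast (icast_irr _ (etrans _ _) h') !size_rev.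
  have [om'|om'] := boolP (odd (size m').+1); last first.
    by rewrite f_odd ?size_rev // (lin0 (scomp_linl _ _)) (lin0 (comp_linr _)) transpose0 scaler0.
  have [om|om] := boolP (odd (size m).+1).
    rewrite mact_even ?size_rev //.
    by rewrite (lin0 (scomp_linr _ _)) (lin0 (comp_linr _)) transpose0 scaler0.
  (* Oddness of [f] leaves |m'| even and evenness of the action leaves |m| odd, so the module sign
     is 1. *)
  by rewrite sgD (sg_evenl _ _ om) sg_nat (negbTE (om' : ~~ odd (size m'))) mulr1 scale1r.
have E2 : sum3 (fun n n' n'' (e : n ++ n' ++ n'' = z) =>
      sg ((size n'').+1%:Z + (size n)%:Z * (size n')%:Z + (size n')%:Z * sumz n) *:
        (cowhisker delta e (N2 l) ∘ f' (n ++ deg n' :: n'') l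
           ∘ icast N1 (esym (adeg_split3 l e))))
  = - ph (sum3 (fun n n' n'' (e : n ++ n' ++ n'' = rev z) =>
      sg ((size n)%:Z + (size n')%:Z * (size n'').+1%:Z + (size n')%:Z * sumz n) *:
        (icast M2 (adeg_split3 (- k) e)
           ∘ f (n ++ deg n' :: n'') (- k) ∘ whisker theta e (M1 (- k))))).
  rewrite -phN -scaleN1r sum3Z (lin_sum3 ph_lin).
  apply: eq_sum3_rev => n n' n'' e e'; rewrite !(linZ ph_lin) scalerA !size_rev.
  have [on|on] := boolP (odd (size n')).
    rewrite (cowhisker_even adj theta_even) // (whisker_even theta_even) ?size_rev //.
    by rewrite (lin0 (comp_linr _)) (lin0 ph_lin) !(lin0 (comp_linl _)) !scaler0.
  congr (_ *: _).
    rewrite !sgD !(sg_evenl _ _ on) (sg_evenr _ _ on) !mulr1 -addn1 PoszD sgD.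
    by rewrite [sg 1](_ : _ = -1) ?mulrN1 ?mulN1r // /sg expr1z.
  have h' : adeg (rev n'' ++ deg (rev n') :: rev n) (- k) = - l.
    by rewrite (adeg_split3 _ e').
  rewrite (dual_whisker adj theta _ _ _ e' _ h') /ph.
  congr (transpose _ _ _); rewrite [RHS]compA; congr (_ ∘ _).
  by rewrite [RHS]compA icast_icast; congr (_ ∘ _); apply: icast_irr.
rewrite /crel /mrel E1 E2 E3; split => [E|<-].
  by apply: ph_inj; rewrite (linD ph_lin) -E subrK.
by rewrite (linD ph_lin) addrK.
Qed.

Lemma coinf_inf :
  @coinf_morphism _ _ _ delta (comodule_of M1) (comodule_of M2) (dual adj adeg_op f)
  <-> inf_morphism f.
Proof.
change ((forall z l, crel z l) <-> (forall z l, mrel z l)); split=> h z l; last first.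
  by apply/crel_mrel_inf.
have /crel_mrel_inf := h (rev z) (- (sumz z + l + (1 - (size z)%:Z))).
have -> : - (sumz (rev z) + - (sumz z + l + (1 - (size z)%:Z)) + (1 - (size (rev z))%:Z)) = l.
  by rewrite sumz_rev size_rev; lia.
by rewrite revK.
Qed.

End InfRelations.

(** Transposition reverses composites, but [coinf_comp] lists its two factors in the opposite order
    from [inf_comp], so the duality is covariant. *)
Lemma dual_inf_comp (M1 M2 M3 : even_module theta)
    (g : forall n l, hom (seqob U n (M2 l)) (M3 (adeg n l)))
    (f : forall n l, hom (seqob U n (M1 l)) (M2 (adeg n l))) :
  dual adj adeg_op (inf_comp g f)
  = @coinf_comp _ _ _ delta (comodule_of M1) (comodule_of M2) (comodule_of M3)
      (dual adj adeg_op g) (dual adj adeg_op f).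
Proof.
apply/functional_extensionality_dep => z; apply/functional_extensionality_dep => l.
pose ph (x : hom (seqob U (rev z) (M1 (- adeg z l))) _) :=
  transpose adj (erefl (rev z)) (icast M3 (adeg_op z l) ∘ x).
have ph_lin : linear ph by move=> c x y; rewrite /ph comp_linr transpose_lin.
transitivity (ph (inf_comp g f (rev z) (- adeg z l))); first by [].
rewrite /inf_comp (lin_sum2 ph_lin); symmetry; apply: eq_sum2_rev => m m' e e'.
have h' : adeg (rev m') (adeg (rev m) (- adeg z l)) = - l.
  by rewrite (adeg_adeg _ e') adeg_op.
rewrite (dual_scomp adj adeg_op adeg_op g f e e' _ h') /ph compA icast_icast.
by rewrite (icast_irr _ (etrans _ _) h').
Qed.

Lemma dual_inf_id (M : even_module theta) :
  dual adj adeg_op (@inf_id _ _ _ _ M) = @coinf_id _ _ _ delta (comodule_of M).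
Proof.
apply/functional_extensionality_dep => n; apply/functional_extensionality_dep => l.
case: n => [|a n]; last first.
  (* [rev (a :: n)] does not reduce to a cons, so the vanishing of [inf_id] is restated through the
     size. *)
  have inf_id0 w l' : size w != 0%N -> inf_id M w l' = 0 by case: w.
  rewrite /dual inf_id0 ?size_rev //.
  by rewrite (lin0 (comp_linr _)) transpose0.
rewrite /dual /= icast_icast /transpose /= idto_id compm1.
exact: idto_irr.
Qed.

Definition coinf_of (M1 M2 : even_module theta) (f : odd_inf_morphism M1 M2) :
  odd_coinf_morphism (comodule_of M1) (comodule_of M2).
Proof.
refine (@OddCoinfMorphism _ _ _ _ (comodule_of M1) (comodule_of M2)
  (dual adj adeg_op f) _ _).
- by apply/coinf_inf; [exact: imap_odd | exact: imap_rel].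
- by move=> n l on; apply/(dual_eq0 adj adeg_op); apply: imap_odd; rewrite size_rev.
Defined.

Definition inf_duality : cfunctor (EMeo_mod theta) (EMeo_comod delta).
Proof.
refine (@CFunctor (EMeo_mod theta) (EMeo_comod delta) comodule_of coinf_of _ _).
- by move=> M; apply: eq_odd_coinf; exact: dual_inf_id.
- by move=> M1 M2 M3 g f; apply: eq_odd_coinf; exact: dual_inf_comp.
Defined.

Lemma EMeo_iso : cat_iso (EMeo_mod theta) (EMeo_comod delta).
Proof.
apply: (cat_iso_bij (F := inf_duality)).
- exact: comodule_of_inj.
- exact: comodule_of_surj.
- move=> M M' f f' E; apply: eq_odd_inf.
  apply: (dual_inj (adj := adj) (d_op := adeg_op)).
  exact: (f_equal (@cimap _ _ _ _ _ _) E).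
- move=> M1 M2 [g g_rel g_odd].
  have [f fg] := dual_surj adj adeg_op g; subst g.
  have f_odd n l : ~~ odd (size n).+1 -> f n l = 0.
    move: n l; apply: (dual_index_ind adeg_op) => n l; rewrite size_rev => on.
    by apply/(dual_eq0 adj adeg_op); apply: g_odd.
  exists (OddInfMorphism ((coinf_inf f_odd).1 g_rel) f_odd).
  exact: eq_odd_coinf.
Qed.

End ModuleComodule.

(** * The identity monad and the conclusion *)

Lemma delta_A_comonad (K : fieldType) (C : lincat K) (T : copowers C) (H : internal_hom T)
    (A : Ainf_algebra K) :
  Ainf_comonad (delta_AId H A) -> Ainf_comonad (delta_A H A).
Proof.
move=> h z X z0; apply: etrans (h z X z0).
apply: eq_sum3 => n n' n'' e.
rewrite /cowhisker.
(* Objects and maps of the two systems are convertible; only the equality proofs inside the casts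
   differ. *)
rewrite (idto_irr (esym (seqob_split3 (V_A H A) e X))
  (esym (seqob_split3 (V_AG H A (lfunctor_id C)) e X))).
by rewrite (idto_irr (seqob_cat (V_A H A) n (deg n' :: n'') X)
  (seqob_cat (V_AG H A (lfunctor_id C)) n (deg n' :: n'') X)).
Qed.

Theorem proposition7p2 (K : fieldType) (C : lincat K) (hC : grothendieck C)
    (T : copowers C) (H : internal_hom T)
    (A : Ainf_algebra K) (hA : Ainf_even A)
    (F : nonunital_monad C) (G : lfunctor C) (FG : adjunction F G) :
  [/\ Ainf_comonad (delta_AG H A FG),
      Ainf_comonad (delta_A H A),
      cat_iso (EMe_mod (theta_AF T A FG)) (EMe_comod (delta_AG H A FG))
    & cat_iso (EMeo_mod (theta_AF T A FG)) (EMeo_comod (delta_AG H A FG))].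
Proof.
(* Stated for an arbitrary adjoint pair, to be applied both to F with G and to the identity
   monad. *)
have comonad_AG F' G' (FG' : adjunction (nufun F') G') :
    Ainf_comonad (delta_AG H A FG').
  apply: Ainf_comonad_adj; last exact: theta_AF_monad.
  by move=> n X; apply: theta_AF_even.
split.
- exact: comonad_AG.
- by apply: delta_A_comonad; apply: comonad_AG.
- by apply: EMe_iso => n X; apply: theta_AF_even.
- by apply: EMeo_iso => n X; apply: theta_AF_even.
Qed.
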